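(* There exists a constant $C>0$ depending only on $\Omega,d,\varrho,k,l$ such that, for every $h\in\mathcal H$, every $T\in\mathcal T_h$ and every $\underline v_T\in\underline U_T^{k,l}$, $$|\underline v_T|_{1,\mathbf K,\partial T}^2\le C\,\alpha_T\Big(\|\mathbf K_T^{1/2}\nabla\mathrm p_{\mathbf K,T}^{k+1}\underline v_T\|_T^2+\mathrm s_{\mathbf K,T}(\underline v_T,\underline v_T)\Big)$$ both for $\mathrm s_{\mathbf K,T}=\mathrm s_{\mathbf K,T}^{\partial}$, where $$\mathrm s_{\mathbf K,T}^{\partial}(\underline u_T,\underline v_T)=h_T^{-1}\big(\delta_{\mathbf K,\mathcal F_T}^k\underline u_T-\delta_{\mathbf K,T}^l\underline u_T,\ \delta_{\mathbf K,\mathcal F_T}^k\underline v_T-\delta_{\mathbf K,T}^l\underline v_T\big)_{\mathbf K,\partial T},$$ and for $\mathrm s_{\mathbf K,T}=\mathrm s_{\mathbf K,T}^{\nabla,\max}$, where $$\mathrm s_{\mathbf K,T}^{\nabla,\max}(\underline u_T,\underline v_T)=\overline K_T\Big[(\nabla\delta_{\mathbf K,T}^l\underline u_T,\nabla\delta_{\mathbf K,T}^l\underline v_T)_T+h_T^{-1}(\delta_{\mathbf K,\mathcal F_T}^k\underline u_T,\delta_{\mathbf K,\mathcal F_T}^k\underline v_T)_{\partial T}\Big].$$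
   Context: Mesh. $d\ge 2$, $\Omega\subset\mathbb R^d$ is a polytopal domain, and $\mathcal H\subset(0,\infty)$ is a countable set with $0$ as unique cluster point. For each $h\in\mathcal H$, $(\mathcal T_h,\mathcal F_h)$ is a polytopal mesh of $\Omega$: $\mathcal T_h$ is a finite collection of disjoint open polytopes (elements) with $\overline\Omega=\bigcup_{T}\overline T$; $\mathcal F_h$ is a finite collection of disjoint flat, relatively open $(d-1)$-dimensional faces with $\bigcup_{T}\partial T=\bigcup_{F\in\mathcal F_h}\overline F$; each face is contained in $\partial T_1\cap\partial T_2$ for two distinct elements, or in $\partial T\cap\partial\Omega$ for one element $T$. $h_X$ is the diameter of $X$, $h=\max_Th_T$. $\mathcal F_T=\{F\in\mathcal F_h:F\subset\partial T\}$, so $\partial T=\bigcup_{F\in\mathcal F_T}\overline F$; $\mathbf n_{\partial T}$ is the piecewise constant outer unit normal on $\partial T$. Regularity assumption. There is $\varrho>0$ such that for all $h\in\mathcal H$, each $X\in\mathcal T_h\cup\mathcal F_h$ is connected by star-shaped sets with parameter $\varrho$: $X$ is a union of fewer than $\varrho^{-1}$ sets $X_i$, each star-shaped with respect to all points of a ball of radius $\varrho h_{X_i}$, and between any two of the sets $X_i,X_j$ there is a path of such sets whose successive pairwise intersections contain balls of radius $\varrho h_X$ (for faces, understood in the hyperplane of the face). No assumption is made on the number of faces per element or on the ratios $h_F/h_T$. Diffusion. $\mathbf K$ is symmetric, uniformly elliptic and constant on each element: $\mathbf K|_T=\mathbf K_T$; $0<\underline K_T\le\overline K_T$ satisfy $\underline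 K_Tx\cdot x\le(\mathbf K_Tx)\cdot x\le\overline K_Tx\cdot x$ for all $x\in\mathbb R^d$; $\alpha_T=\overline K_T/\underline K_T$. Notation. $(\cdot,\cdot)_X$, $\|\cdot\|_X$: $L^2(X)$ inner product and norm. $(v,w)_{\mathbf K,\partial T}=([\mathbf K_T\mathbf n_{\partial T}\cdot\mathbf n_{\partial T}]v,w)_{\partial T}$, with norm $\|\cdot\|_{\mathbf K,\partial T}$. $\mathbb P^m(X)$: polynomials of degree $\le m$ on $X$; $\mathbb P^k(\mathcal F_T)=\{v\in L^1(\partial T):v|_F\in\mathbb P^k(F)\ \forall F\in\mathcal F_T\}$. $\pi_T^{0,m}$: $L^2(T)$-orthogonal projector onto $\mathbb P^m(T)$; $\pi_{\mathcal F_T}^{0,k}$: $L^2(\partial T)$-orthogonal projector onto $\mathbb P^k(\mathcal F_T)$. HHO objects. $k,l\ge0$ are integers with $|k-l|\le1$. $\underline U_T^{k,l}=\mathbb P^l(T)\times\mathbb P^k(\mathcal F_T)$, with elements $\underline v_T=(v_T,v_{\mathcal F_T})$; $|\underline v_T|_{1,\mathbf K,\partial T}=h_T^{-1/2}\|v_{\mathcal F_T}-v_T\|_{\mathbf K,\partial T}$. $\mathrm p_{\mathbf K,T}^{k+1}:\underline U_T^{k,l}\to\mathbb P^{k+1}(T)$ is defined by $(\mathbf K_T\nabla\mathrm p_{\mathbf K,T}^{k+1}\underline v_T,\nabla w)_T=-(v_T,\nabla\cdot(\mathbf K_T\nabla w))_T+(v_{\mathcal F_T},\mathbf K_T\nabla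 w\cdot\mathbf n_{\partial T})_{\partial T}$ for all $w\in\mathbb P^{k+1}(T)$ and $(v_T-\mathrm p_{\mathbf K,T}^{k+1}\underline v_T,1)_T=0$. Difference operators: $\delta_{\mathbf K,T}^l\underline v_T=\pi_T^{0,l}(\mathrm p_{\mathbf K,T}^{k+1}\underline v_T-v_T)$ and $\delta_{\mathbf K,\mathcal F_T}^k\underline v_T=\pi_{\mathcal F_T}^{0,k}(\mathrm p_{\mathbf K,T}^{k+1}\underline v_T-v_{\mathcal F_T})$. *)

(* Defs.v *)
From HB Require Import structures.
From mathcomp Require Import all_boot all_order all_algebra.
From mathcomp Require Import all_classical all_reals all_analysis.
From mathcomp Require mpoly.

Set Implicit Arguments.
Unset Strict Implicit.
Unset Printing Implicit Defensive.

Import Order.TTheory GRing.Theory Num.Theory.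
Import numFieldNormedType.Exports.

Local Open Scope classical_set_scope.
Local Open Scope ring_scope.

Section Euclidean.
Context {R : realType} {n : nat}.
Implicit Types (x y : 'rV[R]_n) (X : set 'rV[R]_n).

Definition dot x y : R := (x *m y^T) 0 0.

(* The norm that the library puts on 'rV[R]_n is the max norm. *)
Definition enorm x : R := Num.sqrt (dot x x).

Definition diam X : R :=
  sup [set r | exists x y, [/\ X x, X y & r = enorm (x - y)]].

Definition boundary X : set 'rV[R]_n := closure X `\` X°.

Definition star_shaped_wrt X y : Prop :=
  X y /\ forall z t, X z -> 0 <= t <= 1 -> X (t *: y + (1 - t) *: z).

(* Points are row vectors, so the matrix K acts by x |-> x *m K^T. *)
Definition mxact (K : 'M[R]_n) x : 'rV[R]_n := x *m K^T.

Definition symmetric_mx (K : 'M[R]_n) : Prop := K^T = K.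

Definition elliptic (lo up : R) (K : 'M[R]_n) : Prop :=
  forall x, lo * dot x x <= dot (mxact K x) x <= up * dot x x.

(* The symmetric positive semidefinite square root K^(1/2). *)
Definition mxsqrt (K : 'M[R]_n) : 'M[R]_n :=
  xget 0 [set S | [/\ symmetric_mx S,
                      forall x, 0 <= dot (mxact S x) x & S *m S = K]].

End Euclidean.

Section Lebesgue.
Context {R : realType}.
Local Notation gR := (measurableTypeR R).

Definition tcons n (p : gR * n.-tuple gR) : n.+1.-tuple gR :=
  [tuple of p.1 :: p.2].

(* Lebesgue measure on R^n, as an iterated product. *)
Fixpoint lebesgue_n n : set (n.-tuple gR) -> \bar R :=
  match n with
  | 0 => dirac [tuple]
  | m.+1 => pushforward (@lebesgue_measure R \x^ @lebesgue_n m)%E (@tcons m)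
  end.

Lemma lebesgue_n_measure n :
  exists m : {measure set (n.-tuple gR) -> \bar R}, @lebesgue_n n = m.
Proof.
elim: n => [|n [m IHm]]; first by exists (dirac [tuple]).
have mf : measurable_fun [set: gR * n.-tuple gR] (@tcons n).
  exact: measurable_cons.
unshelve eexists; first by
  refine (pushforward (@lebesgue_measure R \x^ m)%E (@tcons n)); exact: mf.
by rewrite /= IHm.
Qed.

Lemma lebesgue_n_set0 n : @lebesgue_n n set0 = 0%E.
Proof. by have [m ->] := lebesgue_n_measure n; exact: measure0. Qed.

Lemma lebesgue_n_ge0 n A : (0 <= @lebesgue_n n A)%E.
Proof. by have [m ->] := lebesgue_n_measure n; exact: measure_ge0. Qed.

Lemma lebesgue_n_sigma_additive n : semi_sigma_additive (@lebesgue_n n).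
Proof.
by have [m ->] := lebesgue_n_measure n; exact: measure_semi_sigma_additive.
Qed.

HB.instance Definition _ n := isMeasure.Build _ _ _ (@lebesgue_n n)
  (@lebesgue_n_set0 n) (@lebesgue_n_ge0 n) (@lebesgue_n_sigma_additive n).

Definition rv_of_tuple n (t : n.-tuple gR) : 'rV[R]_n := \row_i tnth t i.

Definition integral_vol n (X : set 'rV[R]_n) (f : 'rV[R]_n -> R) : R :=
  \int[@lebesgue_n n]_(t in @rv_of_tuple n @^-1` X) f (rv_of_tuple t).

End Lebesgue.

Section Mesh.
Context {R : realType} {d : nat}.
Local Notation pt := 'rV[R]_d.
Implicit Types (X Omega T F A : set pt) (Th Fh : set (set pt)).

Definition nondegenerate_simplex (V : 'I_d.+1 -> pt) : Prop :=
  row_free (\matrix_(i < d) (V (lift ord0 i) - V ord0)).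

Definition closed_simplex (V : 'I_d.+1 -> pt) : set pt :=
  [set x | exists c : 'I_d.+1 -> R,
    [/\ forall i, 0 <= c i, \sum_i c i = 1 & x = \sum_i c i *: V i]].

Definition open_polytope X : Prop :=
  X !=set0 /\
  exists (n : nat) (V : 'I_n -> 'I_d.+1 -> pt),
    (forall i, nondegenerate_simplex (V i)) /\
    X = (\bigcup_i closed_simplex (V i))°.

(* A chart (a, B), with B having orthonormal rows, is the isometric
   parametrization t |-> a + t B of a hyperplane by R^(d-1). *)
Definition orthonormal_chart (c : pt * 'M[R]_(d.-1, d)) : Prop :=
  c.2 *m c.2^T = 1%:M.

Definition chart_map (c : pt * 'M[R]_(d.-1, d)) (t : 'rV[R]_d.-1) : pt :=
  c.1 + t *m c.2.

Definition flat_face F : Prop :=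
  exists c (U : set 'rV[R]_d.-1),
    [/\ orthonormal_chart c, open U, U !=set0 & F = chart_map c @` U].

Definition face_chart F : pt * 'M[R]_(d.-1, d) :=
  xget (0, 0) [set c | orthonormal_chart c /\ F `<=` range (chart_map c)].

Definition face_plane F : set pt := range (chart_map (face_chart F)).

(* Integral with respect to the (d-1)-dimensional measure; it does not depend
   on the chart, two charts of a hyperplane differing by an isometry. *)
Definition integral_face F (f : pt -> R) : R :=
  integral_vol (chart_map (face_chart F) @^-1` F) (f \o chart_map (face_chart F)).

Record polytopal_mesh Omega (h : R) Th Fh : Prop := {
  mesh_elt_finite : finite_set Th;
  mesh_elt_disjoint : trivIset Th id;
  mesh_elt_polytope : forall T, Th T -> open_polytope T;
  mesh_elt_cover : closure Omega = \bigcup_(T in Th) closure T;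
  mesh_face_finite : finite_set Fh;
  mesh_face_disjoint : trivIset Fh id;
  mesh_face_flat : forall F, Fh F -> flat_face F;
  mesh_face_cover :
    \bigcup_(T in Th) boundary T = \bigcup_(F in Fh) closure F;
  mesh_face_sides : forall F, Fh F ->
    (exists T1 T2, [/\ Th T1, Th T2, T1 <> T2 &
                       F `<=` boundary T1 `&` boundary T2]) \/
    (exists2 T, Th T & F `<=` boundary T `&` boundary Omega);
  mesh_size_le : forall T, Th T -> diam T <= h;
  mesh_size_max : exists2 T, Th T & diam T = h }.

(* Balls are those of the ambient affine space A: the whole space for
   elements, the hyperplane of the face for faces. *)
Definition ball_in A (x : pt) (r : R) : set pt :=
  A `&` [set y | enorm (y - x) < r].

Definition connected_by_star_shaped A (rho : R) X : Prop :=
  exists (n : nat) (Y : 'I_n -> set pt),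
    [/\ n%:R < rho^-1,
        X = \bigcup_i Y i,
        forall i, exists2 c, A c &
          forall y, ball_in A c (rho * diam (Y i)) y -> star_shaped_wrt (Y i) y &
        forall i j, exists s : seq 'I_n,
          path (fun a b => `[< exists2 c, A c &
                  ball_in A c (rho * diam X) `<=` Y a `&` Y b >]) i s
          /\ last i s = j].

Definition regular_mesh (rho : R) Th Fh : Prop :=
  (forall T, Th T -> connected_by_star_shaped setT rho T) /\
  (forall F, Fh F -> connected_by_star_shaped (face_plane F) rho F).

Definition mesh_sizes (H : set R) : Prop :=
  [/\ countable H, (forall h, H h -> 0 < h) & limit_point H = [set 0]].

Definition diffusion_field Omega (K : pt -> 'M[R]_d) : Prop :=
  (forall x, Omega x -> symmetric_mx (K x)) /\
  exists lo up : R, 0 < lo /\ forall x, Omega x -> elliptic lo up (K x).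

Definition constant_on T (K : pt -> 'M[R]_d) (KT : 'M[R]_d) : Prop :=
  forall x, T x -> K x = KT.

(* The unit vector n such that T coincides near x with the half-space
   (y - x) . n < 0; such an n is unique, and for an open polytope it exists at
   all points of the boundary but those of a set of dimension d - 2, where the
   value is 0. *)
Definition outer_normal T (x : pt) : pt :=
  xget 0 [set n | dot n n = 1 /\ \forall y \near x, T y <-> dot (y - x) n < 0].

Definition faces_of Fh T : set (set pt) := [set F | Fh F /\ F `<=` boundary T].

(* The boundary of T is the disjoint union of the faces of T, up to the relative
   boundaries of these, which have zero (d-1)-dimensional measure. *)
Definition integral_bd Fh T (f : pt -> R) : R :=
  \sum_(F \in faces_of Fh T) integral_face F f.

End Mesh.

Section HHO.
(* The notations of multinomials clash with those of analysis. *)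
Import -(notations) mpoly.
Context {R : realType} {d : nat}.
Local Notation pt := 'rV[R]_d.
Local Notation poly := (mpoly.mpoly d R).
Implicit Types (T F : set pt) (Fh : set (set pt)) (K : 'M[R]_d).

Definition peval (p : poly) (x : pt) : R := mpoly.meval (x 0) p.

Definition deg_le (m : nat) (p : poly) : Prop := (mpoly.msize p <= m.+1)%N.

Definition grad (p : poly) (x : pt) : pt := \row_i peval (mpoly.mderiv i p) x.

(* The polynomial div (K grad w). *)
Definition div_Kgrad K (w : poly) : poly :=
  \sum_i mpoly.mderiv i (\sum_j K i j *: mpoly.mderiv j w).

(* P^k(F_T); only the values on the faces of T matter. *)
Definition face_poly k Fh T (g : pt -> R) : Prop :=
  forall F, faces_of Fh T F ->
    exists2 q, deg_le k q & forall x, F x -> g x = peval q x.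

Definition ip_vol T (f g : pt -> R) : R := integral_vol T (fun x => f x * g x).

Definition ip_vec T (f g : pt -> pt) : R :=
  integral_vol T (fun x => dot (f x) (g x)).

Definition norm_vec T (f : pt -> pt) : R := Num.sqrt (ip_vec T f f).

Definition ip_bd Fh T (f g : pt -> R) : R :=
  integral_bd Fh T (fun x => f x * g x).

Definition ip_K_bd K Fh T (f g : pt -> R) : R :=
  let n := outer_normal T in
  ip_bd Fh T (fun x => dot (mxact K (n x)) (n x) * f x) g.

Definition norm_K_bd K Fh T (f : pt -> R) : R := Num.sqrt (ip_K_bd K Fh T f f).

Definition proj_elt m T (f : pt -> R) : poly :=
  xget 0 [set q | deg_le m q /\
    forall w, deg_le m w -> ip_vol T (peval q \- f) (peval w) = 0].

Definition proj_faces k Fh T (f : pt -> R) : pt -> R :=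
  xget (fun=> 0) [set g | face_poly k Fh T g /\
    forall w, face_poly k Fh T w -> ip_bd Fh T (g \- f) w = 0].

(* Pairs (v_T, v_{F_T}). *)
Definition hho := (poly * (pt -> R))%type.
Implicit Types u v : hho.

Definition hho_space k l Fh T v : Prop :=
  deg_le l v.1 /\ face_poly k Fh T v.2.

Definition hho_seminorm K Fh T v : R :=
  (Num.sqrt (diam T))^-1 * norm_K_bd K Fh T (v.2 \- peval v.1).

Definition reconstruction k K Fh T v : poly :=
  xget 0 [set p | [/\ deg_le k.+1 p,
    forall w, deg_le k.+1 w ->
      ip_vec T (fun x => mxact K (grad p x)) (grad w) =
        - ip_vol T (peval v.1) (peval (div_Kgrad K w))
        + ip_bd Fh T v.2 (fun x => dot (mxact K (grad w x)) (outer_normal T x)) &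
    ip_vol T (peval v.1 \- peval p) (fun=> 1) = 0]].

Definition delta_elt k l K Fh T v : poly :=
  proj_elt l T (peval (reconstruction k K Fh T v) \- peval v.1).

Definition delta_faces k K Fh T v : pt -> R :=
  proj_faces k Fh T (peval (reconstruction k K Fh T v) \- v.2).

Definition stab_bd k l K Fh T u v : R :=
  let diff w := delta_faces k K Fh T w \- peval (delta_elt k l K Fh T w) in
  (diam T)^-1 * ip_K_bd K Fh T (diff u) (diff v).

Definition stab_grad_max k l K (up : R) Fh T u v : R :=
  up * (ip_vec T (grad (delta_elt k l K Fh T u)) (grad (delta_elt k l K Fh T v))
        + (diam T)^-1 *
          ip_bd Fh T (delta_faces k K Fh T u) (delta_faces k K Fh T v)).

End HHO.

(* Main.v *)
(* Writing p for the reconstruction, e_F := delta_F - (p - v_F) and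
   e_T := delta_T - (p - v_T) are projection errors and
   v_F - v_T = e_F - e_T - (delta_F - delta_T).  By best approximation both
   errors are controlled by p - p(c), c a point of T.  As only polynomials occur,
   everything is done in the sup norm: T contains a cube of size comparable to
   h_T, on which Lagrange interpolation gives an inverse estimate
   sup q^2 <= C h^(-d) ||q||_T^2, and the trace inequality reduces to
   sum_F |F| <= C h^(d-1).  For the latter, the radial projection from the centre
   of a star-shaped piece onto the surface of a cube has a Lipschitz inverse, so
   the boundary of T is covered by N G^(d-1) sets of diameter at most C h / G;
   once C h / G is below the distance between compact parts of distinct faces,
   each of these sets meets only one of them. *)
Require Import Defs.
From HB Require Import structures.
From mathcomp Require Import all_boot all_order all_algebra.
From mathcomp Require Import all_classical all_reals all_analysis.
From mathcomp Require Import measurable_realfun zify ring lra.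
From mathcomp Require mpoly polyrcf complex.

Set Implicit Arguments.
Unset Strict Implicit.
Unset Printing Implicit Defensive.

Import Order.TTheory GRing.Theory Num.Theory.
Import numFieldNormedType.Exports.
Import -(notations) mpoly.
Local Open Scope classical_set_scope.
Local Open Scope ring_scope.

(** Nothing bounds the number or the size of the faces, so an estimate obtained face by face and
    then summed would involve their number. A sup bound near T does not see the faces at all; they
    enter only through their total measure. That measure is bounded by counting: N G^(d-1) cells,
    each of measure at most (C h / G)^(d-1) in a chart, give a bound free of G, and so G may depend
    on T. The point value p(c) may compete with p because constants belong to every polynomial space
    and the projections reproduce v_T and v_F. The factor alpha_T arises only once: the weight K n .
    n of the projection errors is bounded from above and the energy of p from below, whereas delta_F
    - delta_T keeps its weight. The gradient stabilization is reduced to the boundary one: the mean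
    value condition on p makes delta_T mean-free, so that its gradient controls its trace.
    Projections, reconstructions, charts, normals and square roots are selected by [xget]; each is
    usable only once its existence is proved or its default value is dealt with. *)

Section MaxNorm.
Context {R : realType} {n : nat}.
Implicit Types (x y : 'rV[R]_n) (s : R).

Lemma rVnorm_leP x s : 0 <= s -> `|x| <= s <-> forall i, `|x 0 i| <= s.
Proof.
move=> s0; rewrite /Num.norm /= mx_normrE; split.
  by move/bigmax_leP => [_ xs] i; exact: (xs (0, i)).
move=> xs; apply/bigmax_leP; split=> // -[i j] _ /=.
by rewrite (ord1 i); exact: xs.
Qed.

Lemma rVnorm_ltP x s : 0 < s -> `|x| < s <-> forall i, `|x 0 i| < s.
Proof.
move=> s0; rewrite /Num.norm /= mx_normrE; split.
  by move/bigmax_ltP => [_ xs] i; exact: (xs (0, i)).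
move=> xs; apply/bigmax_ltP; split=> // -[i j] _ /=.
by rewrite (ord1 i); exact: xs.
Qed.

Lemma rVnorm_coord x i : `|x 0 i| <= `|x|.
Proof. by have /rVnorm_leP := lexx `|x|; apply. Qed.

Lemma nbhs_rVP x (A : set 'rV[R]_n) :
  nbhs x A <-> exists2 e : R, 0 < e & forall y, `|y - x| < e -> A y.
Proof.
rewrite -nbhs_ballE; split => -[e e0 eA]; exists e => // y yx.
  by apply: eA; rewrite mx_norm_ball /= distrC.
by move: yx; rewrite mx_norm_ball /= distrC; exact: eA.
Qed.

Lemma open_rVP (A : set 'rV[R]_n) :
  open A <-> forall x, A x -> exists2 e : R, 0 < e & forall y, `|y - x| < e -> A y.
Proof.
rewrite openE; split => H x Ax; first exact/nbhs_rVP/H.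
by apply/nbhs_rVP/H.
Qed.

End MaxNorm.

(** * Lebesgue measure in coordinates *)

Section LebesgueN.
Context {R : realType}.
Local Notation gR := (measurableTypeR R).
Local Notation leb := (@lebesgue_measure R).

Lemma measurable_tcons n :
  measurable_fun [set: gR * n.-tuple gR] (@tcons R n).
Proof. exact: measurable_cons. Qed.

Lemma measurable_box n (B : 'I_n -> set gR) :
  (forall i, measurable (B i)) ->
  measurable [set t : n.-tuple gR | forall i, B i (tnth t i)].
Proof.
move=> mB.
have -> : [set t : n.-tuple gR | forall i, B i (tnth t i)] =
   ~` (\bigcup_i ~` ((fun t : n.-tuple gR => tnth t i) @^-1` B i)).
  rewrite setC_bigcup; apply/seteqP; split => t /=.
    by move=> Bt i _; apply; exact: Bt.
  by move=> Bt i; apply: contrapT => nB; exact: (Bt i I).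
apply: measurableC; apply: countable_bigcupT_measurable => // i.
apply: measurableC.
by rewrite -[X in measurable X]setTI; apply: measurable_tnth.
Qed.

Lemma lebesgue_n_box n (B : 'I_n -> set gR) :
  (forall i, measurable (B i)) ->
  (@lebesgue_n R n [set t | forall i, B i (tnth t i)] =
   \prod_(i < n) leb (B i))%E.
Proof.
elim: n B => [B mB|n IHn B mB].
  rewrite big_ord0 /= diracE; rewrite mem_set//=.
  by case.
rewrite big_ord_recl -IHn; last by move=> i; exact: mB.
rewrite /= /pushforward.
have mB' : measurable [set t : n.-tuple gR | forall i, B (lift ord0 i) (tnth t i)].
  exact: (@measurable_box n (fun i => B (lift ord0 i)) (fun i => mB _)).
rewrite -(product_measure2E leb (@lebesgue_n R n) (mB ord0) mB').
congr (_ _); apply/seteqP; split => -[x t] /= H.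
  split; first exact: (H ord0).
  by move=> i; have := H (lift ord0 i); rewrite tnthS.
by move=> i; case: (unliftP ord0 i) => [j ->|->];
  [rewrite tnthS; exact: H.2 | exact: H.1].
Qed.

Definition cube n (c : 'rV[R]_n) (s : R) : set 'rV[R]_n :=
  [set x | `|x - c| <= s].

Lemma preimage_cube n (c : 'rV[R]_n) s : 0 <= s ->
  @rv_of_tuple R n @^-1` cube c s =
  [set t | forall i, `[c 0 i - s, c 0 i + s]%classic (tnth t i)].
Proof.
move=> s0; apply/seteqP; split => t /=; rewrite /cube /= rVnorm_leP// => H i.
  by have := H i; rewrite !mxE ler_distl in_itv.
by have := H i; rewrite /= in_itv !mxE ler_distl.
Qed.

Lemma measurable_cube n (c : 'rV[R]_n) s :
  0 <= s -> measurable (@rv_of_tuple R n @^-1` cube c s).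
Proof.
move=> s0; rewrite preimage_cube//.
exact: (@measurable_box n (fun i => `[c 0 i - s, c 0 i + s]%classic)).
Qed.

Lemma lebesgue_n_cube n (c : 'rV[R]_n) s : 0 <= s ->
  lebesgue_n (@rv_of_tuple R n @^-1` cube c s) = ((2 * s) ^+ n)%:E.
Proof.
move=> s0; rewrite preimage_cube//.
rewrite (@lebesgue_n_box n (fun i => `[c 0 i - s, c 0 i + s]%classic))//.
rewrite (eq_bigr (fun=> (2 * s)%:E)) => [|i _].
  by rewrite prodEFin prodr_const card_ord.
rewrite lebesgue_measure_itv /= lte_fin.
case: ltP => [_|h]; first by rewrite -EFinB; congr EFin; ring.
have -> : s = 0 by apply/eqP; rewrite eq_le s0 andbT; lra.
by rewrite mulr0.
Qed.

Lemma lebesgue_n_sigma_finite n : sigma_finite setT (@lebesgue_n R n).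
Proof.
exists (fun k => @rv_of_tuple R n @^-1` cube 0 k%:R).
  apply/seteqP; split => // t _.
  exists (Num.truncn `|rv_of_tuple t|).+1 => //=.
  by rewrite /cube /= subr0; apply/ltW/truncnS_gt.
by move=> k; split; [exact: measurable_cube|rewrite lebesgue_n_cube// ltry].
Qed.

HB.instance Definition _ n := Measure_isSigmaFinite.Build _ _ _ (@lebesgue_n R n)
  (@lebesgue_n_sigma_finite n).

(** The sigma-algebra on tuples is the product one, so openness is traded for a countable union:
    each point of [U] lies in a cube inside [U] with rational centre and radius 1 / (k + 1). *)
Lemma open_rV_measurable n (U : set 'rV[R]_n) :
  open U -> measurable (@rv_of_tuple R n @^-1` U).
Proof.
move=> oU.
pose F (q : 'rV[rat]_n * nat) : set (n.-tuple gR) :=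
  if `[< cube (map_mx ratr q.1) q.2.+1%:R^-1 `<=` U >]
  then @rv_of_tuple R n @^-1` cube (map_mx ratr q.1) q.2.+1%:R^-1 else set0.
have -> : @rv_of_tuple R n @^-1` U = \bigcup_q F q.
  apply/seteqP; split => t; last first.
    by move=> -[q _]; rewrite /F; case: asboolP => // qU /qU.
  move=> /= Ut; have /open_rVP/(_ _ Ut)[e e0 eU] := oU.
  pose k := (Num.truncn (2 / e)); pose s : R := k.+1%:R^-1.
  have s0 : 0 < s by rewrite invr_gt0.
  have se : s < e / 2.
    rewrite -[e / 2]invrK invf_div ltf_pV2 ?posrE ?divr_gt0//.
    exact: truncnS_gt.
  have Hq i : {q : rat | `|ratr q - tnth t i| < s}.
    apply: cid; have [|q] := @rat_in_itvoo R (tnth t i - s) (tnth t i + s).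
      lra.
    by rewrite in_itv /= => h; exists q; rewrite ltr_distl.
  exists (\row_i sval (Hq i), k) => //; rewrite /F /= asboolT.
    rewrite /cube /= rVnorm_leP; last by [].
    by move=> i; rewrite !mxE distrC; case: (Hq i) => q /= /ltW.
  move=> y; rewrite /cube /= => /rVnorm_leP -/(_ (ltW s0)) yq.
  apply: eU; apply/rVnorm_ltP => // i.
  have := yq i; rewrite !mxE; case: (Hq i) => q /=.
  rewrite -/s; set a := ratr q; set b := tnth t i => h1 h2.
  rewrite (_ : _ - _ = (y 0 i - a) + (a - b)); last by ring.
  by apply: le_lt_trans (ler_normD _ _) _; lra.
apply: countable_bigcupT_measurable => // q; rewrite /F.
by case: ifP => // _; apply: measurable_cube.
Qed.

Lemma rv_of_tuple_continuous_measurable n (f : 'rV[R]_n -> R) :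
  continuous f -> measurable_fun setT (f \o @rv_of_tuple R n).
Proof.
move=> cf; apply: (measurability _ (RGenOpens.measurableE R)).
move=> _ [_ [a [b ->] <-]]; rewrite setTI.
rewrite comp_preimage; apply: open_rV_measurable.
by apply: open_comp => //; exact: interval_open.
Qed.


Lemma tonelli_n n (f : n.+1.-tuple gR -> R) :
  measurable_fun setT f -> (forall t, 0 <= f t) ->
  (\int[@lebesgue_n R n.+1]_t (f t)%:E =
   \int[@lebesgue_n R n]_t \int[leb]_x (f (tcons (x, t)))%:E)%E.
Proof.
move=> mf f0.
have mft : measurable_fun setT (EFin \o (f \o @tcons R n)).
  by apply/measurable_EFinP; apply: measurableT_comp => //; exact: measurable_tcons.
transitivity (\int[pushforward (leb \x^ @lebesgue_n R n) (@tcons R n)]_t (f t)%:E)%E.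
  by [].
rewrite ge0_integral_pushforward//.
(* [lebesgue_n] recurses through [\x^] while Tonelli is applied to [\x]; the two product measures
   agree on rectangles, hence everywhere. *)
- rewrite preimage_setT (eq_measure_integral (leb \x @lebesgue_n R n))%E.
    by rewrite fubini_tonelli2// => z; rewrite lee_fin.
  move=> A mA _ /=; apply/esym.
  by apply: product_measure_unique => // B C mB mC/=; rewrite product_measure2E.
- exact: measurable_tcons.
- exact/measurable_EFinP.
- by move=> t _; rewrite lee_fin.
Qed.

End LebesgueN.

(** * Polynomial sup bounds *)

Section UnivariateBound.
Context {R : realType}.
Local Notation gR := (measurableTypeR R).
Local Notation leb := (@lebesgue_measure R).

Lemma card_neq_ord m (i : 'I_m.+1) : #|[pred j | j != i]| = m.
Proof. by have := cardC (pred1 i); rewrite card1 card_ord add1n => -[]. Qed.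

(** The difference of both sides has degree at most m and the m + 1 distinct nodes as roots. *)
Lemma lagrange_interpolation (m : nat) (p : {poly R}) (t : 'I_m.+1 -> R) (x : R) :
  (size p <= m.+1)%N -> injective t ->
  p.[x] = \sum_i p.[t i] * \prod_(j | j != i) ((x - t j) / (t i - t j)).
Proof.
move=> sp tinj.
pose L i := \prod_(j | j != i) ((t i - t j)^-1 *: ('X - (t j)%:P)).
pose q := p - \sum_i p.[t i] *: L i.
have LE i y : (L i).[y] = \prod_(j | j != i) ((y - t j) / (t i - t j)).
  rewrite /L horner_prod; apply: eq_bigr => j _.
  by rewrite hornerZ hornerXsubC mulrC.
suff q0 : q = 0.
  have := congr1 (horner^~ x) q0; rewrite horner0 /q hornerD hornerN horner_sum.
  move/subr0_eq ->; apply: eq_bigr => i _; by rewrite hornerZ LE.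
apply/eqP; apply: contraT => q0.
have := max_poly_roots q0 (rs := map t (enum 'I_m.+1)).
rewrite map_inj_uniq ?enum_uniq// size_map size_enum_ord => H.
suff : (m.+1 < size q)%N.
  apply: contraTT => _; rewrite -leqNgt /q.
  apply: leq_trans (size_polyD _ _) _; rewrite geq_max sp /= size_polyN.
  apply/leq_sizeP => k mk; rewrite coef_sum big1// => i _.
  rewrite coefZ (_ : (L i)`_k = 0) ?mulr0//.
  apply/leq_sizeP: k mk.
  rewrite /L scaler_prod; apply: leq_trans (size_scale_leq _ _) _.
  rewrite -big_filter; case: big_enumP => e _ _ [_ se].
  by rewrite size_prod_XsubC se card_neq_ord.
apply: H => //; apply/allP => _ /mapP[i _ ->].
rewrite /root /q hornerD hornerN horner_sum (bigD1 i)//= hornerZ LE.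
rewrite big1 ?mulr1 => [|j ji]; last first.
  by rewrite divff// subr_eq0; apply: contra_neq ji => /tinj.
rewrite big1 ?addr0 ?subrr// => j ji; rewrite hornerZ LE.
by rewrite (bigD1 i) ?(eq_sym i)//= subrr mul0r !mul0r mulr0.
Qed.

(** If [f] exceeded the bound on all of [a, b], its integral would be at least A + e. The slack [e]
    makes the contradiction strict. *)
Lemma integral_pick (a b : R) (f : R -> R) (A e : R) : a < b ->
  measurable_fun setT f -> (forall x, 0 <= f x) ->
  (\int[leb]_(t in `[a, b]%classic) (f t)%:E <= A%:E)%E -> 0 < e ->
  exists2 t, a <= t <= b & f t <= (A + e) / (b - a).
Proof.
move=> ab mf f0 fA e0; apply: contrapT => H.
have {}H t : a <= t <= b -> (A + e) / (b - a) <= f t.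
  move=> tab; rewrite leNgt; apply/negP => h; apply: H; exists t => //; exact: ltW.
have A0 : 0 <= A.
  rewrite -lee_fin; apply: le_trans fA; apply: integral_ge0 => t _.
  by rewrite lee_fin.
have : (\int[leb]_(t in `[a, b]%classic) ((A + e) / (b - a))%:E <=
        \int[leb]_(t in `[a, b]%classic) (f t)%:E)%E.
  apply: ge0_le_integral => //.
  - move=> t _; rewrite lee_fin divr_ge0 ?subr_ge0 ?(ltW ab)//; lra.
  - by apply/measurable_EFinP; exact: measurable_funTS.
rewrite integral_cst//= lebesgue_measure_itv /= lte_fin ab -EFinB -EFinM => h.
have := le_trans h fA; rewrite lee_fin divfK; first by lra.
by rewrite subr_eq0 gt_eqF.
Qed.

(** Inside [c - s, c + s] are m + 1 short intervals; in each, p^2 is at some node at most the whole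
    integral, plus a slack, divided by the length. Gaps between the intervals keep the nodes apart,
    so the Lagrange basis at [x] is bounded wherever the nodes fall. *)
Lemma univariate_sup_bound (m : nat) (L : R) : 0 <= L ->
  exists2 C : R, 0 < C & forall (p : {poly R}) (c s x : R),
    (size p <= m.+1)%N -> 0 < s -> `|x - c| <= L * s ->
    ((p.[x] ^+ 2)%:E <= (C / s)%:E *
       \int[leb]_(t in `[(c - s)%R, (c + s)%R]%classic) (p.[t] ^+ 2)%:E)%E.
Proof.
move=> L0; pose M : R := (L + 1) * m.+1%:R; pose N : R := m.+1%:R.
have N1 : 1 <= N by rewrite /N -natr1 ler_wpDl.
have M1 : 1 <= M by rewrite /M -[1]mulr1 ler_pM//; lra.
(* The square of a sum of N terms gives N^2, the interval length s / N one more N, and the m factors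
   of a basis polynomial give (M^m)^2. *)
exists (N ^+ 3 * M ^+ m ^+ 2); first by rewrite mulr_gt0 ?exprn_gt0//; lra.
move=> p c s x sp s0 xc.
set J := (\int[leb]_(t in _) _)%E.
have J0 : (0 <= J)%E by apply: integral_ge0 => t _; rewrite lee_fin sqr_ge0.
have C0 : 0 < N ^+ 3 * M ^+ m ^+ 2 by rewrite mulr_gt0 ?exprn_gt0//; lra.
case EJ : J J0 => [A| |]// J0; last by rewrite gt0_muley ?leey// lte_fin divr_gt0.
rewrite -EFinM lee_fin; rewrite lee_fin in J0.
apply/ler_addgt0Pr => e' e'0.
pose e := e' * s / (N ^+ 3 * M ^+ m ^+ 2).
have e0 : 0 < e by rewrite divr_gt0// mulr_gt0.
suff : p.[x] ^+ 2 <= N ^+ 3 * M ^+ m ^+ 2 / s * (A + e).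
  rewrite mulrDr /e; rewrite [X in _ + X](_ : _ = e')//; field.
  by rewrite !gt_eqF ?exprn_gt0//; lra.
have mp2 : measurable_fun setT (fun t => p.[t] ^+ 2 : R).
  by apply: measurable_funX; apply: continuous_measurable_fun; exact: continuous_horner.
pose dl := s / N.
have dl0 : 0 < dl by rewrite divr_gt0//; lra.
have Ndl : N * dl = s by rewrite /dl mulrC divfK// gt_eqF//; lra.
(* The stride is twice the length [dl], so consecutive intervals are [dl] apart; the last one fits
   since (2 m + 1) [dl] <= 2 s. *)
pose lo (i : 'I_m.+1) := c - s + (2 * i)%:R * dl.
have hlo (i : 'I_m.+1) : lo i + dl <= c + s.
  have : (2 * i)%:R * dl + dl <= 2 * s.
    rewrite -{2}[dl]mul1r -mulrDl -Ndl mulrA ler_pM2r// /N -!natrM natr1 ler_nat.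
    by have := ltn_ord i; lia.
  by rewrite /lo; lra.
have Hpick (i : 'I_m.+1) : {t | lo i <= t <= lo i + dl & p.[t] ^+ 2 <= (A + e) / dl}.
  apply: cid2; have := @integral_pick (lo i) (lo i + dl) (fun t => p.[t] ^+ 2) A e.
  rewrite (_ : lo i + dl - lo i = dl); last by ring.
  apply => //; first by lra.
  - by move=> y; exact: sqr_ge0.
  - rewrite -EJ; apply: ge0_subset_integral => //.
    + by apply/measurable_EFinP; exact: measurable_funTS.
    + by move=> y _; rewrite lee_fin sqr_ge0.
    + move=> y /=; rewrite !in_itv /= => /andP[h1 h2]; apply/andP; split.
        by apply: le_trans h1; rewrite /lo lerDl mulr_ge0// ltW.
      exact: le_trans h2 _.
pose t i := s2val (Hpick i).
have tlo i : lo i <= t i <= lo i + dl by rewrite /t; case: (Hpick i).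
have tp i : p.[t i] ^+ 2 <= (A + e) / dl by rewrite /t; case: (Hpick i).
have tsep' (i j : 'I_m.+1) : (i < j)%N -> dl <= t j - t i.
  move=> ij; have := tlo i; have := tlo j.
  have : (2 * i)%:R * dl + 2%:R * dl <= (2 * j)%:R * dl.
    by rewrite -mulrDl -natrD ler_pM2r// ler_nat; lia.
  rewrite /lo; set u := (2 * i)%:R * dl; set v := (2 * j)%:R * dl.
  by lra.
have tsep i j : i != j -> dl <= `|t i - t j|.
  move=> ij; have [h|h|h] := ltngtP i j.
  - by rewrite distrC; apply: le_trans (ler_norm _); exact: tsep'.
  - by apply: le_trans (ler_norm _); exact: tsep'.
  - by move: ij; rewrite (val_inj h) eqxx.
have tinj : injective t.
  move=> i j tij; apply/eqP; apply: contraT => /tsep.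
  by rewrite tij subrr normr0 leNgt dl0.
have xt i : `|x - t i| <= (L + 1) * s.
  rewrite (_ : x - t i = (x - c) + (c - t i)); last by ring.
  apply: le_trans (ler_normD _ _) _; rewrite mulrDl mul1r lerD//.
  have := tlo i; have := hlo i.
  have : 0 <= (2 * i)%:R * dl by rewrite mulr_ge0// ltW.
  by rewrite ler_norml /lo; lra.
pose b := Num.sqrt ((A + e) / dl).
have Ae0 : 0 <= (A + e) / dl by rewrite divr_ge0 ?(ltW dl0)//; lra.
have b0 : 0 <= b by exact: sqrtr_ge0.
have tb i : `|p.[t i]| <= b.
  by rewrite -sqrtr_sqr /b ler_wsqrtr.
have px : `|p.[x]| <= N * (b * M ^+ m).
  rewrite (lagrange_interpolation x sp tinj).
  apply: le_trans (ler_norm_sum _ _ _) _.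
  apply: le_trans (ler_sum (G := fun=> b * M ^+ m) _ _) _; last first.
    by rewrite sumr_const card_ord -mulr_natl.
  move=> i _; rewrite normrM ler_pM// normr_prod.
  rewrite -[X in M ^+ X](card_neq_ord i) -prodr_const; apply: ler_prod => j /= ji.
  rewrite normr_ge0 /= normrM normfV ler_pdivrMr; last first.
    by apply: lt_le_trans (tsep _ _ _); rewrite // eq_sym.
  apply: le_trans (xt j) _; rewrite /M -mulrA ler_pM2l; last by lra.
  by rewrite -Ndl ler_pM2l ?tsep 1?eq_sym//; lra.
rewrite -(real_normK (num_real _)); apply: le_trans (lerXn2r 2 _ _ px) _; rewrite ?nnegrE//.
  by rewrite mulr_ge0 ?mulr_ge0 ?exprn_ge0//; lra.
rewrite !exprMn sqr_sqrtr// le_eqVlt; apply/orP; left; apply/eqP.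
rewrite /dl; field; apply/andP; split; rewrite gt_eqF//; lra.
Qed.

End UnivariateBound.

Section MultivariateBound.
Context {R : realType}.
Local Notation gR := (measurableTypeR R).
Local Notation leb := (@lebesgue_measure R).

(** Degree at most m in each coordinate, the others being frozen. The recursion follows that of
    [lebesgue_n], so that the sup bound can be proved by induction on the dimension. *)
Fixpoint separately_poly (m n : nat) : (n.-tuple gR -> R) -> Prop :=
  match n with
  | 0 => fun=> True
  | n'.+1 => fun f =>
      (forall t, exists2 p : {poly R}, (size p <= m.+1)%N &
         forall x, f (tcons (x, t)) = p.[x]) /\
      forall x, @separately_poly m n' (fun t => f (tcons (x, t)))
  end.

Lemma separately_poly_sum m n (J : finType) (c : J -> R) (e : J -> 'I_n -> nat) :
  (forall j i, (e j i <= m)%N) ->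
  @separately_poly m n (fun t => \sum_j c j * \prod_i tnth t i ^+ e j i).
Proof.
elim: n c e => //= n IHn c e em.
have tconsE x t : \sum_j c j * \prod_i tnth (@tcons R n (x, t)) i ^+ e j i =
    \sum_j (c j * x ^+ e j ord0) * \prod_i tnth t i ^+ e j (lift ord0 i).
  apply: eq_bigr => j _; rewrite big_ord_recl mulrA.
  by congr (_ * _ * _); apply: eq_bigr => i _; rewrite tnthS.
split=> [t|x].
  exists (\sum_j (c j * \prod_i tnth t i ^+ e j (lift ord0 i)) *: 'X^(e j ord0)).
    apply/leq_sizeP => k mk; rewrite coef_sum big1// => j _.
    rewrite coefZ coefXn (_ : k == _ = false) ?mulr0//.
    by apply/eqP => kE; have := em j ord0; rewrite -kE leqNgt mk.
  move=> x; rewrite tconsE horner_sum; apply: eq_bigr => j _.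
  by rewrite hornerZ hornerXn mulrAC.
rewrite (_ : (fun t => _) = fun t => \sum_j (c j * x ^+ e j ord0) *
   \prod_i tnth t i ^+ e j (lift ord0 i)); last by apply/funext => t; rewrite tconsE.
exact: (IHn (fun j => c j * x ^+ e j ord0) (fun j i => e j (lift ord0 i))).
Qed.

Definition tcube n (c : n.-tuple gR) (s : R) : set (n.-tuple gR) :=
  [set t | forall i, `|tnth t i - tnth c i| <= s].

Lemma measurable_tcube n (c : n.-tuple gR) s : measurable (tcube c s).
Proof.
rewrite (_ : tcube c s =
  [set t | forall i, `[tnth c i - s, tnth c i + s]%classic (tnth t i)]).
  exact: (@measurable_box R n (fun i => `[tnth c i - s, tnth c i + s]%classic)).
by apply/seteqP; split => t /= H i; have := H i; rewrite in_itv /= ler_distl.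
Qed.

(** The one-variable bound is applied once per coordinate: the head is frozen for the induction
    hypothesis, then freed under the integral by Tonelli. The cube is kept as an indicator so that
    Tonelli is used on the whole space. *)
Lemma separately_poly_sup_bound m (L : R) : 0 <= L ->
  exists2 C : R, 0 < C & forall n (f : n.-tuple gR -> R) (c x : n.-tuple gR) s,
    measurable_fun setT f -> separately_poly m f -> 0 < s ->
    tcube c (L * s) x ->
    ((f x ^+ 2)%:E <= ((C / s) ^+ n)%:E *
       \int[@lebesgue_n R n]_t (f t ^+ 2 * \1_(tcube c s) t)%:E)%E.
Proof.
move=> L0; have [C C0 HC] := @univariate_sup_bound R m L L0.
exists C => // n; elim: n => [|n IHn] f c x s mf sf s0 xc.
  rewrite expr0 mul1e /= integral_dirac//=.
    rewrite diracT mul1e (tuple0 x) indicE mem_set ?mulr1//=.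
    by case.
  apply/measurable_EFinP; apply: measurable_funM.
    exact: measurable_funX.
  by apply: measurable_indic; exact: measurable_tcube.
have Cs0 : 0 < C / s by rewrite divr_gt0.
case: sf => fp sf.
case/tupleP: c xc => c0 c; case/tupleP: x => x0 x xc.
have xc0 : `|x0 - c0| <= L * s by have := xc ord0.
have {}xc : tcube c (L * s) x.
  by move=> i; have := xc (lift ord0 i); rewrite !tnthS.
pose g t := f t ^+ 2 * \1_(tcube [tuple of c0 :: c] s) t.
have mg : measurable_fun setT g.
  apply: measurable_funM; first exact: measurable_funX.
  by apply: measurable_indic; exact: measurable_tcube.
have g0 t : 0 <= g t by rewrite mulr_ge0 ?sqr_ge0.
rewrite (tonelli_n mg g0).
have mft : measurable_fun setT (f \o @tcons R n).
  by apply: measurableT_comp => //; exact: measurable_tcons.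
have mfx : measurable_fun setT (fun t => f (tcons (x0, t))).
  exact: (measurableT_comp mft (measurable_pair1 _)).
have := IHn _ c x s mfx (sf x0) s0 xc.
rewrite (_ : tcons (x0, x) = [tuple of x0 :: x])//.
move/le_trans; apply.
rewrite exprSr EFinM -muleA; apply: lee_wpmul2l.
  by rewrite lee_fin exprn_ge0// ltW.
have mgt : measurable_fun setT (EFin \o (g \o @tcons R n)).
  apply/measurable_EFinP; apply: measurableT_comp => //; exact: measurable_tcons.
have mI : measurable_fun setT (fun t => \int[leb]_x1 (g (tcons (x1, t)))%:E)%E.
  have := @measurable_fun_fubini_tonelli_G _ _ gR (n.-tuple gR) R leb _ mgt.
  by apply => z; rewrite lee_fin g0.
rewrite -ge0_integralZl//; last 2 first.
- by move=> t _; apply: integral_ge0 => y _; rewrite lee_fin g0.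
- by rewrite lee_fin ltW.
apply: ge0_le_integral => //.
- by move=> t _; rewrite lee_fin mulr_ge0 ?sqr_ge0.
- apply/measurable_EFinP; apply: measurable_funM.
    exact: measurable_funX.
  by apply: measurable_indic; exact: measurable_tcube.
- exact: emeasurable_funM.
move=> t _.
have [p sp fpE] := fp t.
have gE y : g (tcons (y, t)) =
    (p.[y] ^+ 2 * \1_(`[c0 - s, c0 + s]%classic) y) * \1_(tcube c s) t.
  rewrite /g fpE -mulrA; congr (_ * _); rewrite !indicE -natrM mulnb.
  congr ((nat_of_bool _)%:R); apply/idP/andP.
    rewrite inE => H; rewrite !inE /= in_itv /= -ler_distl; split.
      exact: (H ord0).
    by move=> i; have := H (lift ord0 i); rewrite !tnthS.
  rewrite !inE /= in_itv /= -ler_distl => -[h1 h2] i.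
  by case: (unliftP ord0 i) => [j ->|->//]; rewrite !tnthS; exact: h2.
under eq_integral do rewrite gE EFinM.
rewrite fpE indicE; case: (boolP (t \in _)) => _; last first.
  rewrite !mulr0; under eq_integral do rewrite mule0.
  by rewrite integral0 mule0.
rewrite mulr1; under eq_integral do rewrite mule1.
have := HC p c0 s x0 sp s0 xc0.
rewrite [X in (_ <= _ * X)%E -> _]integral_mkcond.
rewrite (_ : _ \_ _ = fun y => (p.[y] ^+ 2 * \1_(`[c0 - s, c0 + s]%classic) y)%:E)//.
apply/funext => y; rewrite patchE indicE; case: ifP => _; first by rewrite mulr1.
by rewrite mulr0.
Qed.

End MultivariateBound.

Section Mpoly.
Context {R : realType} {d : nat}.
Local Notation gR := (measurableTypeR R).
Local Notation mp := (mpoly d R).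

Lemma pevalE (k : nat) (q : mp) (x : 'rV[R]_d) : (msize q <= k)%N ->
  peval q x = \sum_(m : bmultinom d k) mcoeff m q * \prod_i x 0 i ^+ (m : multinom d) i.
Proof.
move=> qk; rewrite /peval {1}(mpolywE qk) raddf_sum; apply: eq_bigr => m _ /=.
by rewrite mevalZ mevalX.
Qed.

Lemma continuous_bigsum (T : topologicalType) (I : Type) (r : seq I) (f : I -> T -> R) :
  (forall i, continuous (f i)) -> continuous (fun x => \sum_(i <- r) f i x).
Proof.
move=> cf; elim: r => [|i r IHr].
  under eq_fun do rewrite big_nil.
  exact: cst_continuous.
under eq_fun do rewrite big_cons.
by move=> x; apply: cvgD; [exact: cf|exact: IHr].
Qed.

Lemma continuous_bigprod (T : topologicalType) (I : Type) (r : seq I) (f : I -> T -> R) :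
  (forall i, continuous (f i)) -> continuous (fun x => \prod_(i <- r) f i x).
Proof.
move=> cf; elim: r => [|i r IHr].
  under eq_fun do rewrite big_nil.
  exact: cst_continuous.
under eq_fun do rewrite big_cons.
by move=> x; apply: cvgM; [exact: cf|exact: IHr].
Qed.

Lemma continuous_peval (q : mp) : continuous (peval q).
Proof.
rewrite (_ : peval q = fun x : 'rV[R]_d => \sum_(m : bmultinom d (msize q)) mcoeff m q *
   \prod_i x 0 i ^+ (m : multinom d) i); last first.
  by apply/funext => x; rewrite -pevalE.
apply: (@continuous_bigsum _ _ _ (fun (m : bmultinom d (msize q)) (x : 'rV[R]_d) =>
  mcoeff m q * \prod_i x 0 i ^+ (m : multinom d) i)) => m.
have cp : continuous (fun x : 'rV[R]_d => \prod_i x 0 i ^+ (m : multinom d) i).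
  apply: (@continuous_bigprod _ _ _ (fun i (y : 'rV[R]_d) => y 0 i ^+ (m : multinom d) i)) => i y.
  apply: (@continuous_comp _ _ _ (fun y : 'rV[R]_d => y 0 i) (fun a : R => a ^+ _)).
    exact: coord_continuous.
  exact: exprn_continuous.
by move=> x; apply: (@continuousM _ _ (cst (mcoeff m q)) _ x); [exact: cst_continuous|exact: cp].
Qed.

Lemma peval_separately_poly m (q : mp) : deg_le m q ->
  separately_poly m (fun t : d.-tuple gR => peval q (rv_of_tuple t)).
Proof.
move=> qm.
rewrite (_ : (fun t => _) = fun t : d.-tuple gR => \sum_(j : bmultinom d m.+1) mcoeff j q *
   \prod_i tnth t i ^+ (j : multinom d) i).
  apply: separately_poly_sum => j i.
  have := bmdeg j; rewrite ltnS; apply: leq_trans.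
  by rewrite mdegE (bigD1 i)//= leq_addr.
apply/funext => t; rewrite (pevalE _ qm); apply: eq_bigr => j _; congr (_ * _).
by apply: eq_bigr => i _; rewrite mxE.
Qed.

End Mpoly.

(** * Integrals of bounded measurable functions *)

Section BoundedMeasurable.
Context {R : realType} {n : nat}.
Local Notation gR := (measurableTypeR R).
Local Notation mu := (@lebesgue_n R n).
Implicit Types (A : set 'rV[R]_n) (f g : 'rV[R]_n -> R).

Definition tuples_of A : set (n.-tuple gR) := @rv_of_tuple R n @^-1` A.

Definition bset A : Prop :=
  measurable (tuples_of A) /\ exists M : R, forall x, A x -> `|x| <= M.

(* Rintegral is 0 on non-integrable functions, so that linearity and monotonicity
   need integrability; bounded measurable functions on bounded sets suffice. *)
Definition bmeas A f : Prop :=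
  measurable_fun (tuples_of A) (f \o @rv_of_tuple R n) /\
  exists M : R, forall x, A x -> `|f x| <= M.

Lemma bset_fin A : bset A -> (mu (tuples_of A) < +oo)%E.
Proof.
move=> [mA [M AM]].
have M0 : 0 <= Num.max M 0 by rewrite le_max lexx orbT.
apply: (@le_lt_trans _ _ (mu (tuples_of (cube 0 (Num.max M 0))))).
  apply: le_measure; rewrite ?inE//; first exact: measurable_cube.
  by move=> t /AM h; rewrite /tuples_of /cube /= subr0 le_max h.
by rewrite lebesgue_n_cube// ltry.
Qed.

Lemma bmeas_integrable A f : bset A -> bmeas A f ->
  mu.-integrable (tuples_of A) (EFin \o (f \o @rv_of_tuple R n)).
Proof.
move=> bA [mf [M fM]]; apply: measurable_bounded_integrable => //.
- by case: bA.
- exact: bset_fin.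
- exists `|M|; split; first exact: num_real.
  move=> y My t At; apply: le_trans (fM _ At) _; apply: le_trans (ler_norm _) (ltW My).
Qed.

Lemma continuous_bmeas A f : bset A -> continuous f -> bmeas A f.
Proof.
move=> [mA [M AM]] cf; split.
  by apply: measurable_funTS; exact: rv_of_tuple_continuous_measurable.
have cK : compact (cube (0 : 'rV[R]_n) M).
  apply: bounded_closed_compact.
    exists M; split; first exact: num_real.
    by move=> y My x; rewrite /cube /= subr0 => /le_trans; apply; exact: ltW.
  rewrite (_ : cube _ _ = (fun x : 'rV[R]_n => `|x|) @^-1` [set y | y <= M]).
    by apply: closed_comp => [x _|]; [exact: norm_continuous|exact: closed_le].
  by apply/seteqP; split => x; rewrite /cube /= subr0.
have /compact_bounded[N [_ HN]] : compact (f @` cube (0 : 'rV[R]_n) M).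
  by apply: continuous_compact => //; exact: continuous_subspaceT.
exists (`|N| + 1) => x /AM xM; apply: (HN (`|N| + 1)).
  by rewrite ltr_pwDr// ler_norm.
by exists x => //; rewrite /cube /= subr0.
Qed.

Lemma bmeasD A f g : bmeas A f -> bmeas A g -> bmeas A (fun x => f x + g x).
Proof.
move=> [mf [M fM]] [mg [N gN]]; split; first exact: measurable_funD.
by exists (M + N) => x Ax; apply: le_trans (ler_normD _ _) _; rewrite lerD ?fM ?gN.
Qed.

Lemma bmeasM A f g : bmeas A f -> bmeas A g -> bmeas A (fun x => f x * g x).
Proof.
move=> [mf [M fM]] [mg [N gN]]; split; first exact: measurable_funM.
by exists (M * N) => x Ax; rewrite normrM ler_pM ?fM ?gN.
Qed.

Lemma bmeas_cst A (c : R) : bmeas A (fun=> c).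
Proof. by split; [exact: measurable_cst|exists `|c|]. Qed.

Lemma bmeasZ A c f : bmeas A f -> bmeas A (fun x => c * f x).
Proof. by move=> bf; apply: bmeasM => //; exact: bmeas_cst. Qed.

Lemma bmeasN A f : bmeas A f -> bmeas A (fun x => - f x).
Proof.
move=> /(bmeasZ (- 1)); rewrite (_ : (fun x => -1 * _) = fun x => - f x)//.
by apply/funext => x; rewrite mulN1r.
Qed.

Lemma bmeasB A f g : bmeas A f -> bmeas A g -> bmeas A (fun x => f x - g x).
Proof. by move=> bf bg; apply: bmeasD => //; exact: bmeasN. Qed.

Lemma bmeas_sum A (I : Type) (r : seq I) (F : I -> 'rV[R]_n -> R) :
  (forall i, bmeas A (F i)) -> bmeas A (fun x => \sum_(i <- r) F i x).
Proof.
move=> bF; elim: r => [|i r IHr].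
  under eq_fun do rewrite big_nil.
  exact: bmeas_cst.
under eq_fun do rewrite big_cons.
exact: bmeasD.
Qed.

Lemma bmeas_eq A f g : (forall x, A x -> f x = g x) -> bmeas A f -> bmeas A g.
Proof.
move=> fg [mf [M fM]]; split.
  by apply: eq_measurable_fun mf => t; rewrite inE => /fg.
by exists M => x Ax; rewrite -fg ?fM.
Qed.

Lemma integral_volZ A f (r : R) : bset A -> bmeas A f ->
  integral_vol A (fun x => r * f x) = r * integral_vol A f.
Proof. by move=> bA bf; apply: RintegralZl; [case: bA|exact: bmeas_integrable]. Qed.

Lemma integral_volD A f g : bset A -> bmeas A f -> bmeas A g ->
  integral_vol A (fun x => f x + g x) = integral_vol A f + integral_vol A g.
Proof. by move=> bA bf bg; apply: RintegralD; [case: bA|exact: bmeas_integrable..]. Qed.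

Lemma integral_volB A f g : bset A -> bmeas A f -> bmeas A g ->
  integral_vol A (fun x => f x - g x) = integral_vol A f - integral_vol A g.
Proof. by move=> bA bf bg; apply: RintegralB; [case: bA|exact: bmeas_integrable..]. Qed.

Lemma eq_integral_vol A f g : (forall x, A x -> f x = g x) ->
  integral_vol A f = integral_vol A g.
Proof. by move=> fg; apply: eq_Rintegral => t; rewrite inE => /fg. Qed.

Lemma integral_vol_ge0 A f : (forall x, A x -> 0 <= f x) -> 0 <= integral_vol A f.
Proof. by move=> f0; apply: Rintegral_ge0 => t /f0. Qed.

Lemma le_integral_vol A f g : bset A -> bmeas A f -> bmeas A g ->
  (forall x, A x -> f x <= g x) -> integral_vol A f <= integral_vol A g.
Proof.
move=> bA bf bg fg; apply: le_Rintegral; [by case: bA|exact: bmeas_integrable..|].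
by move=> t /fg.
Qed.

Definition vol A : R := fine (mu (tuples_of A)).

Lemma integral_vol_cst A r : bset A -> integral_vol A (fun=> r) = r * vol A.
Proof. by move=> [mA _]; rewrite /integral_vol Rintegral_cst. Qed.

Lemma vol_le_cube A (c : 'rV[R]_n) s : bset A -> 0 <= s -> A `<=` cube c s ->
  vol A <= (2 * s) ^+ n.
Proof.
move=> bA s0 As; rewrite /vol -[leRHS]/(fine ((2 * s) ^+ n)%:E).
rewrite -(lebesgue_n_cube c s0); apply: fine_le.
- by rewrite ge0_fin_numE//; exact: bset_fin.
- by rewrite lebesgue_n_cube.
- apply: le_measure; rewrite ?inE//; [by case: bA|exact: measurable_cube|].
  by move=> t; exact: As.
Qed.

End BoundedMeasurable.

Section PolySup.
Context {R : realType} {d : nat}.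

Lemma bmeas_peval (A : set 'rV[R]_d) (q : mpoly d R) : bset A -> bmeas A (peval q).
Proof. by move=> bA; apply: continuous_bmeas => //; exact: continuous_peval. Qed.

(** The point [x] is located only by its distance to the centre of the cube, up to [L] radii, and
    not by membership in [A]; this gives access to values on the boundary of an element. *)
Lemma poly_sup_bound (m : nat) (L : R) : 0 <= L ->
  exists2 C : R, 0 < C &
    forall (A : set 'rV[R]_d) (q : mpoly d R) (c x : 'rV[R]_d) (s : R),
      bset A -> deg_le m q -> 0 < s -> cube c s `<=` A -> `|x - c| <= L * s ->
      peval q x ^+ 2 <= C / s ^+ d * integral_vol A (fun y => peval q y ^+ 2).
Proof.
move=> L0; have [C C0 HC] := @separately_poly_sup_bound R m L L0.
exists (C ^+ d); first exact: exprn_gt0.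
move=> A q c x s bA qm s0 cA xc.
pose tup (y : 'rV[R]_d) := [tuple y 0 i | i < d].
have tupK y : rv_of_tuple (tup y) = y.
  by apply/rowP => i; rewrite mxE tnth_mktuple.
have Ls0 : 0 <= L * s by rewrite mulr_ge0// ltW.
have cubeE r y : 0 <= r -> tcube (tup c) r (tup y) <-> cube c r y.
  by move=> r0; rewrite /cube /= rVnorm_leP//; split => H i;
    have := H i; rewrite !mxE !tnth_mktuple.
have mq : measurable_fun setT (fun t => peval q (@rv_of_tuple R d t)).
  apply: rv_of_tuple_continuous_measurable; exact: continuous_peval.
have := HC d (fun t => peval q (rv_of_tuple t)) (tup c) (tup x) s mq
  (peval_separately_poly qm) s0 ((cubeE _ _ Ls0).2 xc).
rewrite tupK -expr_div_n -lee_fin => /le_trans; apply.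
rewrite EFinM; apply: lee_wpmul2l; first by rewrite lee_fin exprn_ge0// divr_ge0// ltW.
have bq2 : bmeas A (fun y => peval q y ^+ 2).
  under eq_fun do rewrite expr2.
  by apply: bmeasM; exact: bmeas_peval.
rewrite /integral_vol /Rintegral fineK; last first.
  exact: (integrable_fin_num bA.1 (bmeas_integrable bA bq2)).
rewrite [leRHS]integral_mkcond; apply: ge0_le_integral => //.
- by move=> t _; rewrite lee_fin mulr_ge0 ?sqr_ge0.
- apply/measurable_EFinP; apply: measurable_funM; first exact: measurable_funX.
  by apply: measurable_indic; exact: measurable_tcube.
- apply/(measurable_restrictT _ _).1; first by case: bA.
  by apply/measurable_EFinP; apply: measurable_funX; exact: measurable_funTS.
move=> t _; rewrite indicE patchE; case: (boolP (t \in tcube _ _)).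
  rewrite inE mulr1 => tc; rewrite ifT// inE; apply: cA.
  rewrite (_ : t = tup (rv_of_tuple t)) in tc.
    by move/(cubeE _ _ (ltW s0)) : tc.
  by apply: eq_from_tnth => i; rewrite tnth_mktuple mxE.
by rewrite mulr0 => _; case: ifP; rewrite lee_fin// sqr_ge0.
Qed.

End PolySup.

(** * Restriction of polynomials to lines *)

Section Line.
Context {R : realType} {d : nat}.
Implicit Types (q : mpoly d R) (c v x : 'rV[R]_d).

Definition line c v q : {poly R} :=
  mmap (@polyC R) (fun i => (c 0 i)%:P + (v 0 i) *: 'X) q.

Lemma horner_line c v q t : (line c v q).[t] = peval q (c + t *: v).
Proof.
rewrite /line /mmap horner_sum /peval /meval /mmap; apply: eq_bigr => m _.
rewrite hornerM hornerC /mmap1 horner_prod; congr (_ * _); apply: eq_bigr => i _.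
by rewrite horner_exp hornerD hornerC hornerZ hornerX !mxE mulrC.
Qed.

(** Chain rule. [line c v] is a ring morphism and both sides obey the Leibniz rule along it, so
    constants and variables suffice. *)
Lemma deriv_line c v q :
  (line c v q)^`() = \sum_i v 0 i *: line c v (mderiv i q).
Proof.
pose P p := (line c v p)^`() = \sum_i v 0 i *: line c v (mderiv i p).
have lineD p1 p2 : line c v (p1 + p2) = line c v p1 + line c v p2 by rewrite /line raddfD.
have lineM p1 p2 : line c v (p1 * p2) = line c v p1 * line c v p2 by rewrite /line rmorphM.
have lineC a : line c v (mpolyC d a) = a%:P by rewrite /line mmapC.
have PD p1 p2 : P p1 -> P p2 -> P (p1 + p2).
  rewrite /P lineD derivD => -> ->; rewrite -big_split; apply: eq_bigr => i _ /=.
  by rewrite mderivD lineD scalerDr.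
have PM p1 p2 : P p1 -> P p2 -> P (p1 * p2).
  rewrite /P lineM derivM => -> ->; rewrite mulr_suml mulr_sumr -big_split.
  apply: eq_bigr => i _ /=.
  by rewrite mderivM lineD !lineM scalerDr scalerAl scalerAr.
have PC a : P (mpolyC d a).
  rewrite /P lineC derivC big1// => i _.
  by rewrite mderivC -mpolyC0 lineC scaler0.
have PX i : P (mpolyX R (mnm1 i)).
  rewrite /P {1}/line mmapX mmap1U derivD derivC add0r derivZ derivX.
  rewrite (bigD1 i)//= big1 ?addr0 => [|j ji].
    rewrite mderivX mnm1E eqxx scale1r (_ : mnm_sub _ _ = mnm0).
      by rewrite mpolyX0 -mpolyC1 lineC.
    by apply/mnmP => j; rewrite mnmBE subnn mnm0E.
  by rewrite mderivX mnm1E eq_sym (negPf ji) scale0r -mpolyC0 lineC scaler0.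
suff H : forall p, P p by exact: H.
apply: mpolyind => [|a m p _ _ IHp].
  by rewrite -mpolyC0; exact: PC.
apply: (PD) => //; rewrite -mul_mpolyC; apply: (PM); first exact: PC.
rewrite mpolyXE_id; apply: big_ind; [by rewrite -mpolyC1; exact: (PC)|by move=> *; exact: (PM)|].
move=> i _; move: (fun_of_multinom m i) => n; elim: n => [|k IHk]; first by rewrite expr0 -mpolyC1; exact: PC.
by rewrite exprS; exact: PM.
Qed.

(** Mean value theorem on the segment from [c] to [x]; the factor d counts the partial derivatives,
    each paired with a coordinate of x - c. *)
Lemma peval_mvt q c x (G : R) :
  (forall i t, 0 <= t <= 1 -> `|peval (mderiv i q) (c + t *: (x - c))| <= G) ->
  `|peval q x - peval q c| <= d%:R * `|x - c| * G.
Proof.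
move=> HG; pose p := line c (x - c) q.
have [t /andP[t0 t1] pE] := polyrcf.poly_mvt p (ltr01 : 0 < 1 :> R).
have -> : peval q x - peval q c = p.[1] - p.[0].
  by rewrite !horner_line scale1r scale0r addr0 [c + _]addrC subrK.
rewrite pE subr0 mulr1 deriv_line horner_sum.
apply: le_trans (ler_norm_sum _ _ _) _.
apply: le_trans (ler_sum (G := fun=> `|x - c| * G) _ _) _; last first.
  by rewrite sumr_const card_ord -mulrA mulr_natl.
move=> i _; rewrite hornerZ horner_line normrM ler_pM ?rVnorm_coord// HG//.
by rewrite (ltW t0) (ltW t1).
Qed.

(** The restriction of [q] to a coordinate line has the roots 0, 1, 2, ..., as many as its size if
    it is nonzero; hence it is the zero polynomial, and so is its derivative. *)
Lemma peval0_mderiv q : (forall x, peval q x = 0) ->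
  forall i x, peval (mderiv i q) x = 0.
Proof.
move=> q0 i x.
have : line x (delta_mx 0 i) q = 0.
  apply/eqP; apply: contraT => p0.
  have := max_poly_roots p0 (rs := map (fun k => k%:R) (iota 0 (size (line x (delta_mx 0 i) q)))).
  rewrite size_map size_iota map_inj_uniq ?iota_uniq ?ltnn; last first.
    by move=> a b /eqP; rewrite eqr_nat => /eqP.
  move=> H; rewrite H//; apply/allP => _ /mapP[k _ ->].
  by rewrite /root horner_line q0.
move=> /(congr1 (fun p => p^`().[0])); rewrite deriv_line deriv0 horner0 horner_sum.
rewrite (bigD1 i)//= big1 ?addr0 => [|j ji].
  by rewrite hornerZ horner_line mxE !eqxx mul1r scale0r addr0.
by rewrite hornerZ mxE eqxx (negPf ji) mul0r.
Qed.

End Line.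

(** * Geometry of star-shaped elements *)

Section Dot.
Context {R : realType} {n : nat}.
Implicit Types (x y z : 'rV[R]_n) (X : set 'rV[R]_n).

Lemma dotE x y : dot x y = \sum_i x 0 i * y 0 i.
Proof. by rewrite /dot mxE; apply: eq_bigr => i _; rewrite mxE. Qed.

Lemma dotC x y : dot x y = dot y x.
Proof. by rewrite !dotE; apply: eq_bigr => i _; rewrite mulrC. Qed.

Lemma dotDl x y z : dot (x + y) z = dot x z + dot y z.
Proof. by rewrite /dot mulmxDl mxE. Qed.

Lemma dotZl a x z : dot (a *: x) z = a * dot x z.
Proof. by rewrite /dot -scalemxAl mxE. Qed.

Lemma dotDr x y z : dot z (x + y) = dot z x + dot z y.
Proof. by rewrite dotC dotDl !(dotC z). Qed.

Lemma dotZr a x z : dot z (a *: x) = a * dot z x.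
Proof. by rewrite dotC dotZl dotC. Qed.

Lemma dot_ge0 x : 0 <= dot x x.
Proof. by rewrite dotE sumr_ge0// => i _; rewrite -expr2 sqr_ge0. Qed.

Lemma dot_eq0 x : dot x x = 0 -> x = 0.
Proof.
rewrite dotE => /eqP; rewrite psumr_eq0 => [/allP x0|i _]; last by rewrite -expr2 sqr_ge0.
apply/rowP => i; have := x0 i; rewrite mem_index_enum => /(_ isT).
by rewrite mxE mulf_eq0 orbb => /eqP.
Qed.

Lemma enorm_ge0 x : 0 <= enorm x.
Proof. exact: sqrtr_ge0. Qed.

Lemma rVnorm_le_enorm x : `|x| <= enorm x.
Proof.
apply/rVnorm_leP; first exact: enorm_ge0.
move=> i; rewrite -sqrtr_sqr /enorm ler_wsqrtr// dotE (bigD1 i)//= expr2 lerDl.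
by rewrite sumr_ge0// => j _; rewrite -expr2 sqr_ge0.
Qed.

Lemma enorm_le_rVnorm x : enorm x <= n%:R * `|x|.
Proof.
have h0 : 0 <= n%:R * `|x| by rewrite mulr_ge0.
rewrite /enorm -[leRHS](ger0_norm h0) -sqrtr_sqr ler_wsqrtr// dotE.
apply: le_trans (ler_sum (G := fun=> `|x| ^+ 2) _ _) _.
  move=> i _; rewrite -expr2 -(real_normK (num_real (x 0 i))).
  by rewrite lerXn2r ?nnegrE// rVnorm_coord.
rewrite sumr_const card_ord -[leLHS]mulr_natl exprMn ler_wpM2r ?sqr_ge0//.
by rewrite -natrX ler_nat; case: (n) => // k; rewrite -mulnn leq_pmulr.
Qed.

Definition bounded_rV X := exists M : R, forall x, X x -> `|x| <= M.

Lemma diam_ge X x y : bounded_rV X -> X x -> X y -> enorm (x - y) <= diam X.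
Proof.
move=> [M XM] Xx Xy; apply: ub_le_sup; last by exists x, y.
exists (n%:R * (M + M)) => _ [a [b [Xa Xb ->]]].
apply: le_trans (enorm_le_rVnorm _) _; rewrite ler_wpM2l//.
by apply: le_trans (ler_normB _ _) _; rewrite lerD// XM.
Qed.

Lemma diam_ge_norm X x y : bounded_rV X -> X x -> X y -> `|x - y| <= diam X.
Proof. by move=> bX Xx Xy; apply: le_trans (rVnorm_le_enorm _) (diam_ge bX Xx Xy). Qed.

Lemma diam_le X Y : bounded_rV Y -> X `<=` Y -> X !=set0 -> diam X <= diam Y.
Proof.
move=> bY XY [x Xx]; apply: ge_sup; first by exists (enorm (x - x)), x, x.
by move=> _ [a [b [/XY Xa /XY Xb ->]]]; exact: diam_ge.
Qed.

Lemma bounded_rVS X Y : X `<=` Y -> bounded_rV Y -> bounded_rV X.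
Proof. by move=> XY [M YM]; exists M => x /XY /YM. Qed.

Lemma ball_in_cube c r x : (0 < n)%N -> `|x - c| < r / n%:R -> ball_in setT c r x.
Proof.
move=> n0 xc; split=> //=; apply: le_lt_trans (enorm_le_rVnorm _) _.
by rewrite mulrC -ltr_pdivlMr// ltr0n.
Qed.

Lemma closure_diam X x c : bounded_rV X -> closure X x -> X c -> `|x - c| <= diam X.
Proof.
move=> bX Xx Xc; apply/ler_addgt0Pr => e e0.
have [|y [Xy /= yx]] := Xx [set y | `|y - x| < e].
  by apply/nbhs_rVP; exists e.
rewrite (_ : x - c = (y - c) - (y - x)); last by rewrite opprB [RHS]addrC addrA subrK.
apply: le_trans (ler_normB _ _) _; rewrite lerD ?(ltW yx)//.
exact: diam_ge_norm.
Qed.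

End Dot.

Lemma diam_gt0 (R : realType) n (X : set 'rV[R]_n.+1) c (r : R) : bounded_rV X ->
  0 < r -> (forall y, `|y - c| < r -> X y) -> 0 < diam X.
Proof.
move=> bX r0 rX.
have Xc : X c by apply: rX; rewrite subrr normr0.
have nE : `|(r / 2) *: delta_mx 0 0 : 'rV[R]_n.+1| = r / 2.
  apply/eqP; rewrite eq_le; apply/andP; split.
    apply/rVnorm_leP; first lra.
    move=> i; rewrite !mxE /=; case: (i == 0); rewrite ?mulr1 ?mulr0 ?normr0; last by lra.
    by rewrite ger0_norm; lra.
  have := rVnorm_coord ((r / 2) *: delta_mx 0 0 : 'rV[R]_n.+1) 0.
  by rewrite !mxE !eqxx mulr1; apply: le_trans; exact: ler_norm.
apply: (@lt_le_trans _ _ (r / 2)); first by lra.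
rewrite -nE -{1}[_ *: _](addrK c) [X in `|X - _|]addrC.
apply: diam_ge_norm => //; apply: rX.
by rewrite addrAC subrr add0r nE; lra.
Qed.

Section Cone.
Context {R : realType} {n : nat}.
Implicit Types (x y c : 'rV[R]_n) (T Y : set 'rV[R]_n).

(** Since [x] is only in the closure of [Y], it is replaced by a nearby x' in [Y], and the error is
    absorbed by moving [y] to a point y' of the ball with t x + (1 - t) y = t x' + (1 - t) y'.
    Solving for y' is where t < 1 enters. *)
Lemma star_cone T Y x y c (r t : R) : Y `<=` T ->
  (forall z, `|z - c| < r -> star_shaped_wrt Y z) ->
  closure Y x -> `|y - c| < r -> 0 <= t < 1 -> T (t *: x + (1 - t) *: y).
Proof.
move=> YT star Yx yr /andP[t0 t1]; apply: YT.
have t1' : 0 < 1 - t by lra.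
pose a := t / (1 - t); have a0 : 0 <= a by rewrite divr_ge0// ltW.
pose e := (r - `|y - c|) / (a + 1).
have e0 : 0 < e by rewrite divr_gt0 ?subr_gt0//; lra.
have [|x' [Yx' /= xx]] := Yx [set z | `|z - x| < e]; first by apply/nbhs_rVP; exists e.
pose y' := y + a *: (x - x').
have y'r : `|y' - c| < r.
  rewrite /y' addrAC; apply: le_lt_trans (ler_normD _ _) _.
  rewrite normrZ (ger0_norm a0) [`|x - _|]distrC.
  apply: (@le_lt_trans _ _ (`|y - c| + a * e)).
    by rewrite lerD2l ler_wpM2l// ltW.
  have : (a + 1) * e = r - `|y - c| by rewrite /e mulrC divfK// gt_eqF//; lra.
  by rewrite mulrDl mul1r; lra.
have [_ star'] := star y' y'r.
have := star' x' (1 - t) Yx'; rewrite (_ : 0 <= 1 - t <= 1); last by apply/andP; split; lra.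
move=> /(_ isT); congr Y.
rewrite (_ : 1 - (1 - t) = t); last by ring.
rewrite /y' scalerDr scalerA (_ : (1 - t) * a = t); last first.
  by rewrite /a mulrC divfK// gt_eqF.
by rewrite scalerBr -addrA subrK addrC.
Qed.

Definition radial c x : 'rV[R]_n := `|x - c|^-1 *: (x - c).

(* If |x - c| were much smaller than |x' - c| for two almost aligned points,
   then x would lie in the open cone from x' to the ball around c, hence in T. *)
Lemma radial_lipschitz T Y x x' c (r D : R) : 0 < r -> Y `<=` T ->
  (forall z, `|z - c| < r -> star_shaped_wrt Y z) ->
  closure Y x -> ~ T x -> closure Y x' -> ~ T x' ->
  `|x - c| <= D -> `|x' - c| <= D ->
  `|x - x'| <= (D + D ^+ 2 / r) * `|radial c x - radial c x'|.
Proof.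
move=> r0 YT star.
wlog : x x' / `|x - c| <= `|x' - c|.
  move=> H Yx Tx Yx' Tx' xD x'D; have [h|/ltW h] := leP `|x - c| `|x' - c|.
    exact: H.
  by rewrite distrC [X in _ * X]distrC; exact: H.
move=> xx' Yx Tx Yx' Tx' xD x'D.
have Tc : T c by apply: YT; have [] : star_shaped_wrt Y c by apply: star; rewrite subrr normr0.
have nz z : ~ T z -> `|z - c| != 0.
  by move=> Tz; rewrite normr_eq0 subr_eq0; apply: contra_notN Tz => /eqP ->.
have l0 : 0 < `|x - c| by rewrite lt_def nz// normr_ge0.
have l'0 : 0 < `|x' - c| by rewrite lt_def nz// normr_ge0.
have ux : x - c = `|x - c| *: radial c x by rewrite /radial scalerA divff ?nz// scale1r.
have ux' : x' - c = `|x' - c| *: radial c x' by rewrite /radial scalerA divff ?nz// scale1r.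
have nu' : `|radial c x'| = 1.
  by rewrite /radial normrZ normfV normr_id mulVf ?nz.
set u := radial c x in ux *; set u' := radial c x' in ux' nu' *.
set l := `|x - c| in xx' xD l0 ux *; set l' := `|x' - c| in xx' x'D l'0 ux' *.
clearbody u u' l l'.
have ll : l' - l <= D ^+ 2 / r * `|u - u'|.
  rewrite leNgt; apply/negP => H.
  have uu0 : 0 <= `|u - u'| by [].
  have D0 : 0 <= D by apply: le_trans xD; exact: ltW.
  have ll0 : 0 < l' - l.
    by apply: le_lt_trans H; rewrite mulr_ge0// divr_ge0 ?exprn_ge0// ltW.
  (* With t = l / l', this [z] solves x = t x' + (1 - t) (c + z). *)
  apply: Tx; pose z := (l * l' / (l' - l)) *: (u - u').
  have zr : `|(c + z) - c| < r.
    rewrite addrAC subrr add0r normrZ ger0_norm ?divr_ge0 ?mulr_ge0 ?(ltW l0) ?(ltW l'0) ?(ltW ll0)//.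
    rewrite mulrAC ltr_pdivrMr//.
    apply: (@le_lt_trans _ _ (D ^+ 2 * `|u - u'|)).
      by rewrite ler_wpM2r// expr2 ler_pM ?(ltW l0) ?(ltW l'0).
    by move: H; rewrite mulrAC ltr_pdivrMr// [_ * r]mulrC.
  have t01 : 0 <= l / l' < 1.
    rewrite divr_ge0 ?(ltW l0) ?(ltW l'0)//= ltr_pdivrMr// mul1r; lra.
  have := star_cone YT star Yx' zr t01.
  rewrite (_ : _ *: x' + _ = x)//.
  have -> : x' = l' *: u' + c by rewrite -ux' subrK.
  have -> : x = l *: u + c by rewrite -ux subrK.
  apply/rowP => i; rewrite /z !mxE.
  have hl' : l' != 0 by rewrite gt_eqF.
  have hl : l' - l != 0 by rewrite gt_eqF.
  by field; apply/andP.
have -> : x - x' = l *: (u - u') + (l - l') *: u'.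
  by rewrite scalerBr scalerBl addrA subrK -ux -ux' opprB addrA subrK.
apply: le_trans (ler_normD _ _) _; rewrite !normrZ nu' mulr1 mulrDl lerD//.
  by rewrite ger0_norm ?(ltW l0)// ler_wpM2r.
by rewrite distrC ger0_norm// subr_ge0.
Qed.

End Cone.

Section Cells.
Context {R : realType}.

Lemma grid_cell (G : nat) (a : R) : (0 < G)%N -> `|a| <= 1 ->
  exists e : 'I_G, `|a - ((2 * e + 1)%:R / G%:R - 1)| <= G%:R^-1.
Proof.
move=> G0; rewrite ler_norml => /andP[a0 a1].
have g0 : 0 < G%:R :> R by rewrite ltr0n.
pose y := (a + 1) * G%:R / 2.
have aE : a = 2 * y / G%:R - 1 by rewrite /y; field; rewrite gt_eqF.
have y0 : 0 <= y by rewrite /y divr_ge0// mulr_ge0 ?(ltW g0)//; lra.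
have yG : y <= G%:R.
  by rewrite /y ler_pdivrMr// [_ * 2]mulrC ler_wpM2r ?(ltW g0)//; lra.
have key (e : 'I_G) : e%:R <= y <= e%:R + 1 ->
    `|a - ((2 * e + 1)%:R / G%:R - 1)| <= G%:R^-1.
  move=> /andP[h1 h2]; rewrite {1}aE.
  rewrite (_ : _ - _ = (2 * y - (2 * e%:R + 1)) * G%:R^-1); last first.
    by rewrite natrD natrM; ring.
  rewrite normrM (ger0_norm (_ : 0 <= G%:R^-1)) ?invr_ge0 ?(ltW g0)//.
  by rewrite ler_piMl ?invr_ge0 ?(ltW g0)// ler_norml; apply/andP; split; lra.
have /andP[k1 k2] := truncn_itv y0.
have [kG|kG] := ltnP (Num.truncn y) G.
  exists (Ordinal kG); apply: key => /=.
  by rewrite k1 /= ltW// natr1.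
(* The right end a = 1 gives y = G, one past the last index; it is put into the last cell. *)
have GG : (G.-1 < G)%N by rewrite prednK.
exists (Ordinal GG); apply: key => /=.
rewrite natr1 prednK// yG andbT; apply: le_trans k1; rewrite ler_nat.
exact: leq_trans (leq_pred _) kG.
Qed.

(** An index ((j, b), e) selects the side u_j = (-1)^b of the cube [-1, 1]^(m+1) and, on it, one of
    G^m closed cells of edge 2 / G; the numbers (2 e_i + 1) / G - 1 are the coordinates of its
    centre. *)
Definition unit_cell m (G : nat) (k : 'I_m.+1 * bool * {ffun 'I_m -> 'I_G}) : set 'rV[R]_m.+1 :=
  [set u | u 0 k.1.1 = (-1) ^+ k.1.2 /\
     forall i, `|u 0 (lift k.1.1 i) - ((2 * k.2 i + 1)%:R / G%:R - 1)| <= G%:R^-1].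

Lemma unit_cell_cover m (G : nat) (u : 'rV[R]_m.+1) : (0 < G)%N -> `|u| = 1 ->
  exists k, @unit_cell m G k u.
Proof.
move=> G0 u1.
have [j uj] : exists j, `|u 0 j| = 1.
  apply: contrapT => H.
  have : `|u| < 1.
    apply/rVnorm_ltP => // i; rewrite lt_neqAle -{2}u1 rVnorm_coord andbT.
    by apply/eqP => h; apply: H; exists i.
  by rewrite u1 ltxx.
have He i : exists e : 'I_G,
    `|u 0 (lift j i) - ((2 * e + 1)%:R / G%:R - 1)| <= G%:R^-1.
  by apply: grid_cell => //; rewrite -u1 rVnorm_coord.
exists ((j, u 0 j < 0), [ffun i => sval (cid (He i))]); split => [|i] /=.
  case: ltP => h; first by rewrite expr1 -uj ltr0_norm// opprK.
  by rewrite expr0 -uj ger0_norm.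
by rewrite ffunE; case: cid.
Qed.

Lemma unit_cell_diam m (G : nat) k (u v : 'rV[R]_m.+1) :
  @unit_cell m G k u -> @unit_cell m G k v -> `|u - v| <= 2 / G%:R.
Proof.
move=> [u1 uk] [v1 vk]; apply/rVnorm_leP => [|i]; first by rewrite divr_ge0.
rewrite !mxE; case: (unliftP k.1.1 i) => [j ->|->]; last first.
  by rewrite u1 v1 subrr normr0 divr_ge0.
rewrite (_ : _ - _ = (u 0 (lift k.1.1 j) - ((2 * k.2 j + 1)%:R / G%:R - 1)) -
  (v 0 (lift k.1.1 j) - ((2 * k.2 j + 1)%:R / G%:R - 1))); last by ring.
apply: le_trans (ler_normB _ _) _.
by rewrite mulrDl !mul1r lerD.
Qed.

End Cells.

(** * Covering the boundary of an element by small cells *)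

Section BoundaryCover.
Context {R : realType}.

(* A piece overlapping another one contains a ball of radius comparable to the
   diameter of T; a piece overlapping no other one is T itself. *)
Lemma star_shaped_pieces m (rho : R) (T : set 'rV[R]_m.+1) n (Y : 'I_n -> set 'rV[R]_m.+1) :
  0 < rho -> T !=set0 -> 0 < diam T -> T = \bigcup_i Y i ->
  (forall i, exists2 c, setT c &
      forall y, ball_in setT c (rho * diam (Y i)) y -> star_shaped_wrt (Y i) y) ->
  (forall i j, exists s : seq 'I_n,
      path (fun a b => `[< exists2 c, setT c &
              ball_in setT c (rho * diam T) `<=` Y a `&` Y b >]) i s /\ last i s = j) ->
  forall i, exists c, forall y, `|y - c| < rho * diam T / m.+1%:R -> Y i y.
Proof.
move=> rho0 [x Tx] dT TE star conn i.
have [/existsP[j ji]|/existsPn alleq] := boolP [exists j, j != i].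
  have [[|j' s] [/= p lst]] := conn i j; first by rewrite lst eqxx in ji.
  case/andP: p => /asboolP[c _ cY] _; exists c => y yc.
  by have [] := cY y (ball_in_cube (ltn0Sn m) yc).
have YT : Y i = T.
  rewrite TE; apply/seteqP; split => z; first by exists i.
  by move=> [j _]; have := alleq j; rewrite negbK => /eqP ->.
have [c _ cY] := star i; exists c => y yc.
have := cY y; rewrite YT => H.
by have [] := H (ball_in_cube (ltn0Sn m) yc).
Qed.

Lemma regular_inner_ball m (rho : R) (T : set 'rV[R]_m.+1) : 0 < rho ->
  T !=set0 -> 0 < diam T -> connected_by_star_shaped setT rho T ->
  exists c, forall y, `|y - c| < rho * diam T / m.+1%:R -> T y.
Proof.
move=> rho0 T0 dT [n [Y [_ TE star conn]]].
have HP := star_shaped_pieces rho0 T0 dT TE star conn.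
case: T0 => x; rewrite {1}TE => -[i _ Yx].
have [c cY] := HP i; exists c => y /cY Yy.
by rewrite TE; exists i.
Qed.

Lemma closure_bigcup_ord n (V : topologicalType) (Y : 'I_n -> set V) x :
  closure (\bigcup_i Y i) x -> exists i, closure (Y i) x.
Proof.
have cl : closed (\bigcup_i closure (Y i)).
  apply: closed_bigcup => [|i _]; [exact: finite_finset|exact: closed_closure].
move=> cx; have [i _ Yx] : (\bigcup_i closure (Y i)) x; last by exists i.
rewrite ((closure_id _).1 cl).
apply: (@closure_subset _ (\bigcup_i Y i)) => //.
by move=> z [i _ Yz]; exists i => //; exact: subset_closure.
Qed.

(** Each boundary point lies in the closure of some piece, and the cells on the cube surface are
    pulled back by the radial projection from the centre of that piece. [N0] and [L] depend on
    neither [T] nor [G]. *)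
Lemma boundary_cover m (rho : R) : 0 < rho ->
  exists N0 : nat, exists2 L : R, 0 < L &
    forall T : set 'rV[R]_m.+1, open T -> T !=set0 -> bounded_rV T ->
      connected_by_star_shaped setT rho T ->
    forall G, (0 < G)%N ->
      exists (I : finType) (cell : I -> set 'rV[R]_m.+1),
        [/\ (#|I| <= N0 * G ^ m)%N,
            forall x, boundary T x -> exists i, cell i x,
            forall i x, cell i x -> boundary T x &
            forall i x y, cell i x -> cell i y -> `|x - y| <= L * diam T / G%:R].
Proof.
move=> rho0; pose D : R := m.+1%:R.
have D0 : 0 < D by [].
(* Fewer than 1 / rho pieces, and 2 (m + 1) sides of the cube for each. *)
exists ((Num.truncn rho^-1).+1 * (m.+1 * 2))%N.
(* For a piece of diameter dl, the ball contains a max-norm ball of radius rho dl / D, which gives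
   the Lipschitz constant (1 + D / rho) dl; a cell of the cube surface has diameter at most 2 /
   G. *)
exists (2 * (1 + D / rho)); first by rewrite mulr_gt0// addr_gt0// divr_gt0.
move=> T oT T0 bT regT G G0.
have [x0 Tx0] := T0.
have dT : 0 < diam T.
  have /open_rVP/(_ _ Tx0)[e e0 eT] := oT.
  exact: diam_gt0 bT e0 eT.
have [n [Y [nrho TE star conn]]] := regT.
have HP := star_shaped_pieces rho0 T0 dT TE star conn.
have YT i : Y i `<=` T by rewrite TE => z Yz; exists i.
have bY i : bounded_rV (Y i) by exact: bounded_rVS (YT i) bT.
have dY i : 0 < diam (Y i).
  have [c cY] := HP i; apply: diam_gt0 (bY i) _ cY.
  by rewrite divr_gt0// mulr_gt0.
have star' i : exists c, forall z, `|z - c| < rho * diam (Y i) / D -> star_shaped_wrt (Y i) z.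
  have [c _ cY] := star i; exists c => z /(ball_in_cube (ltn0Sn m)); exact: cY.
pose c i := sval (cid (star' i)).
have cP i z : `|z - c i| < rho * diam (Y i) / D -> star_shaped_wrt (Y i) z.
  by rewrite /c; case: cid => /= ?; apply.
have r0 i : 0 < rho * diam (Y i) / D by rewrite divr_gt0// mulr_gt0.
have Yc i : Y i (c i).
  by have [] : star_shaped_wrt (Y i) (c i) by apply: cP; rewrite subrr normr0.
exists ('I_n * ('I_m.+1 * bool * {ffun 'I_m -> 'I_G}))%type.
exists (fun k => [set x | [/\ boundary T x, closure (Y k.1) x &
                             unit_cell k.2 (radial (c k.1) x)]]).
have bdT x : boundary T x -> ~ T x.
  by move=> [_ nT]; rewrite (interior_id T).1 in nT.
split.
- rewrite !card_prod !card_ord card_bool card_ffun !card_ord.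
  rewrite [X in (_ <= X)%N](_ : _ = (Num.truncn rho^-1).+1 * (m.+1 * 2 * G ^ m))%N; last by lia.
  rewrite leq_mul2r; apply/orP; right.
  by rewrite -(ler_nat R) ltW// (lt_trans nrho)// truncnS_gt.
- move=> x bx; have [cx _] := bx; move: cx; rewrite {1}TE => /closure_bigcup_ord[i Yx].
  (* The centre lies in the open set [T], so [x] differs from it and its radial projection is a
     genuine unit vector. *)
  have nx : `|x - c i| != 0.
    rewrite normr_eq0 subr_eq0; apply/eqP => xc; apply: (bdT x bx).
    by apply: (YT i); rewrite xc; exact: Yc.
  have [|k xk] := @unit_cell_cover R m G (radial (c i) x) G0.
    by rewrite /radial normrZ normfV normr_id mulVf.
  by exists (i, k).
- by move=> i x [].
- move=> [i k] x y /= [bx Yx xk] [by_ Yy yk].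
  have dYT : diam (Y i) <= diam T by apply: diam_le => //; exists (c i); exact: Yc.
  have := radial_lipschitz (r0 i) (YT i) (cP i) Yx (bdT x bx) Yy (bdT y by_)
     (closure_diam (bY i) Yx (Yc i)) (closure_diam (bY i) Yy (Yc i)).
  move/le_trans; apply.
  set dl := diam (Y i) in dYT *; have dl0 : 0 < dl by exact: dY.
  rewrite (_ : dl + _ = (1 + D / rho) * dl); last first.
    by rewrite /dl; field; rewrite !gt_eqF.
  rewrite [X in _ <= X](_ : _ = (1 + D / rho) * diam T * (2 / G%:R)); last by ring.
  have h : 0 <= 1 + D / rho by rewrite addr_ge0// divr_ge0// ltW.
  apply: ler_pM => //; first by rewrite mulr_ge0// ltW.
    by rewrite ler_wpM2l.
  exact: unit_cell_diam xk yk.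
Qed.

End BoundaryCover.

(** * Faces and the perimeter bound *)

Section Charts.
Context {R : realType} {m : nat}.
Local Notation chart := ('rV[R]_m.+1 * 'M[R]_(m, m.+1))%type.
Implicit Types (c : chart) (t u : 'rV[R]_m) (F : set 'rV[R]_m.+1).

Lemma chart_mapB c t u : chart_map c t - chart_map c u = (t - u) *m c.2.
Proof. by rewrite /chart_map mulmxBl opprD addrACA subrr add0r. Qed.

Lemma chart_isometry c t u : orthonormal_chart c ->
  enorm (chart_map c t - chart_map c u) = enorm (t - u).
Proof.
rewrite /orthonormal_chart => oc; rewrite chart_mapB /enorm /dot.
by rewrite trmx_mul mulmxA -(mulmxA _ c.2) oc mulmx1.
Qed.

Lemma chart_expand c t u : orthonormal_chart c ->
  `|t - u| <= m.+1%:R * `|chart_map c t - chart_map c u|.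
Proof.
move=> oc; apply: le_trans (rVnorm_le_enorm _) _.
by rewrite -(chart_isometry _ _ oc); exact: enorm_le_rVnorm.
Qed.

Lemma chart_inj c : orthonormal_chart c -> injective (chart_map c).
Proof.
move=> oc t u tu; apply/eqP; rewrite -subr_eq0 -normr_le0.
by have := chart_expand t u oc; rewrite tu subrr normr0 mulr0.
Qed.

Lemma continuous_affine n p (a : 'rV[R]_p) (B : 'M[R]_(n, p)) (b : 'rV[R]_n) :
  continuous (fun t : 'rV[R]_n => a + (t - b) *m B).
Proof.
move=> t A /nbhs_rVP[e e0 eA].
pose M := 1 + \sum_i \sum_j `|B i j|.
have M0 : 0 < M by rewrite ltr_pwDl// sumr_ge0// => i _; rewrite sumr_ge0.
apply/nbhs_rVP; exists (e / M); first exact: divr_gt0.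
move=> u; rewrite ltr_pdivlMr// => ut; apply: eA.
rewrite opprD addrACA subrr add0r -mulmxBl opprB addrA subrK.
apply: le_lt_trans ut.
apply/rVnorm_leP => [|j]; first by rewrite mulr_ge0// ltW.
rewrite mxE; apply: le_trans (ler_norm_sum _ _ _) _.
apply: (@le_trans _ _ (\sum_i `|u - t| * `|B i j|)).
  by apply: ler_sum => i _; rewrite normrM ler_wpM2r// rVnorm_coord.
rewrite -mulr_sumr ler_wpM2l// /M ler_wpDl// ler_sum// => i _.
by rewrite (bigD1 j)//= lerDl sumr_ge0.
Qed.

Lemma continuous_chart_map c : continuous (chart_map c).
Proof.
rewrite (_ : chart_map c = fun t => c.1 + (t - 0) *m c.2); last first.
  by apply/funext => t; rewrite subr0.
exact: continuous_affine.
Qed.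

(** The chart chosen by [face_chart] may differ from the one that witnesses flatness. As [U] is
    open, small steps along each axis put the rows of [c1.2] into the row space of [c0.2]; both
    families being orthonormal, the square transition matrix is orthogonal. *)
Lemma chart_change c0 c1 F (U : set 'rV[R]_m) :
  orthonormal_chart c0 -> F `<=` range (chart_map c0) ->
  orthonormal_chart c1 -> open U -> U !=set0 -> F = chart_map c1 @` U ->
  exists (M : 'M[R]_m) (u t0 : 'rV[R]_m),
    forall t, chart_map c0 t = chart_map c1 (u + (t - t0) *m M).
Proof.
move=> o0 F0 o1 oU [u Uu] FE.
have ht v : U v -> exists t, chart_map c0 t = chart_map c1 v.
  by move=> Uv; have [|t _ tE] := F0 (chart_map c1 v); [rewrite FE; exists v|exists t].
have [t0 t0E] := ht u Uu.
have [e e0 eU] := (open_rVP _).1 oU u Uu.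
have B10 : (c1.2 <= c0.2)%MS.
  apply/row_subP => i.
  have [|t tE] := ht (u + (e / 2) *: delta_mx 0 i).
    apply: eU; rewrite addrAC subrr add0r; apply/rVnorm_ltP => // j.
    rewrite !mxE eqxx /=; case: (j == i); rewrite ?mulr0 ?normr0// mulr1.
    by rewrite ger0_norm; lra.
  have := chart_mapB c1 (u + (e / 2) *: delta_mx 0 i) u.
  rewrite -tE -t0E chart_mapB addrAC subrr add0r -scalemxAl -rowE => h.
  have -> : row i c1.2 = ((e / 2)^-1 *: (t - t0)) *m c0.2.
    by rewrite -scalemxAl h scalerA mulVf ?scale1r// gt_eqF//; lra.
  exact: submxMl.
have [M ME] := submxP B10.
have MM : M *m M^T = 1%:M.
  rewrite /orthonormal_chart in o0 o1.
  by rewrite -o1 ME trmx_mul mulmxA -(mulmxA M) o0 mulmx1.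
have MM' : M^T *m M = 1%:M by exact: mulmx1C.
exists M^T, u, t0 => t.
have -> : chart_map c0 t = (t - t0) *m c0.2 + chart_map c1 u.
  by rewrite -chart_mapB t0E subrK.
have cD w : chart_map c1 (u + w) = w *m c1.2 + chart_map c1 u.
  by rewrite -[X in X *m _](addrK u) [w + u]addrC -chart_mapB subrK.
by rewrite cD; congr (_ + _); rewrite ME !mulmxA -(mulmxA _ M^T) MM' mulmx1.
Qed.

(** An affine change of chart carries openness over from the witness of flatness to the chosen
    chart. *)
Lemma face_chartP F : flat_face F ->
  [/\ orthonormal_chart (face_chart F), F `<=` range (chart_map (face_chart F)),
      open (chart_map (face_chart F) @^-1` F) &
      (chart_map (face_chart F) @^-1` F) !=set0].
Proof.
case=> c1 [U [h1 oU Une FE]].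
have [h0 F0] : [set c : chart | orthonormal_chart c /\ F `<=` range (chart_map c)] (face_chart F).
  apply: xgetPex; exists c1; split => //; rewrite FE => _ [u _ <-]; by exists u.
have [M [u [t0 cE]]] := chart_change h0 F0 h1 oU Une FE.
split => //.
  rewrite (_ : _ @^-1` F = (fun t => u + (t - t0) *m M) @^-1` U).
    by apply: open_comp => // t _; exact: continuous_affine.
  apply/seteqP; split => t /=; rewrite cE FE; last by move=> h; exists (u + (t - t0) *m M).
  by move=> [v Uv /(chart_inj h1) <-].
have [v Uv] := Une; have [|t _ tE] := F0 (chart_map c1 v); first by rewrite FE; exists v.
by exists t; rewrite /= tE FE; exists v.
Qed.

Lemma bset_face F : flat_face F -> bounded_rV F ->
  bset (chart_map (face_chart F) @^-1` F).
Proof.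
move=> fF [M FM]; have [hc _ oU [t0 Ft0]] := face_chartP fF.
split; first exact: open_rV_measurable.
exists (`|t0| + m.+1%:R * (M + M)) => t Ft.
rewrite -[t](subrK t0) addrC; apply: le_trans (ler_normD _ _) _; rewrite lerD2l.
apply: le_trans (chart_expand t t0 hc) _; rewrite ler_wpM2l//.
by apply: le_trans (ler_normB _ _) _; rewrite lerD ?FM.
Qed.

End Charts.

Section Inner.
Context {R : realType} {n : nat}.
Implicit Types (U A B : set 'rV[R]_n).

(** The points at max-norm distance at least 1 / (j + 1) from the complement: an exhaustion by
    compact sets when [U] is open and bounded. *)
Definition inner U (j : nat) : set 'rV[R]_n :=
  [set t | forall t', `|t' - t| < j.+1%:R^-1 -> U t'].

Lemma inner_sub U j : inner U j `<=` U.
Proof. by move=> t; apply; rewrite subrr normr0 invr_gt0. Qed.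

Lemma inner_closed U j : closed (inner U j).
Proof.
rewrite -[inner U j]setCK; apply: open_closedC; apply/open_rVP => t /= /existsNP[t' /not_implyP[tt' Ut']].
exists (j.+1%:R^-1 - `|t' - t|); first by rewrite subr_gt0.
move=> y yt /(_ t')H; apply: Ut'; apply: H.
rewrite (_ : t' - y = (t' - t) - (y - t)); last by rewrite opprB addrA subrK.
apply: le_lt_trans (ler_normB _ _) _.
by rewrite addrC -ltrBrDr.
Qed.

Lemma inner_mono U : nondecreasing_seq (inner U).
Proof.
move=> i j ij; apply/subsetPset => t Ut t' tt'; apply: Ut.
by apply: lt_le_trans tt' _; rewrite lef_pV2 ?posrE// ler_nat ltnS.
Qed.

Lemma inner_bigcup U : open U -> \bigcup_j inner U j = U.
Proof.
move=> oU; apply/seteqP; split => t; first by move=> [j _ /inner_sub].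
move=> Ut; have [e e0 eU] := (open_rVP _).1 oU t Ut.
exists (Num.truncn e^-1) => //= t' tt'; apply: eU; apply: lt_le_trans tt' _.
by rewrite -[leRHS]invrK lef_pV2 ?posrE ?invr_gt0// ltW// truncnS_gt.
Qed.

Lemma bset_inner U j : open U -> bset U -> bset (inner U j).
Proof.
move=> oU [mU [M UM]]; split; last by exists M => x /inner_sub /UM.
rewrite -[inner U j]setCK /tuples_of preimage_setC; apply: measurableC.
exact: (open_rV_measurable (closed_openC (@inner_closed U j))).
Qed.

Lemma vol_inner_cvg U : open U -> bset U -> vol (inner U j) @[j --> \oo] --> vol U.
Proof.
move=> oU bU.
have : @lebesgue_n R n \o (fun j => tuples_of (inner U j)) @ \oo -->
    @lebesgue_n R n (\bigcup_j tuples_of (inner U j)).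
  apply: nondecreasing_cvg_mu.
  - by move=> j; have [] := bset_inner j oU bU.
  - by apply: bigcup_measurable => j _; have [] := bset_inner j oU bU.
  - move=> i j ij; apply/subsetPset => t /=; rewrite /tuples_of /=.
    by apply/subsetPset; exact: inner_mono.
rewrite (_ : \bigcup_j tuples_of (inner U j) = tuples_of U); last first.
  by rewrite -{2}(inner_bigcup oU) /tuples_of preimage_bigcup.
move=> h; apply: fine_cvg.
rewrite /vol fineK; first exact: h.
by rewrite ge0_fin_numE//; exact: bset_fin.
Qed.

Lemma compact_inner U j : bset U -> compact (inner U j).
Proof.
move=> [_ [M UM]]; apply: bounded_closed_compact; last exact: inner_closed.
exists M; split; first exact: num_real.
by move=> y My x /inner_sub /UM /le_trans; apply; exact: ltW.
Qed.

(** The differences x - y form a compact set without 0, which therefore misses a neighbourhood of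
    0. *)
Lemma compact_separated A B : compact A -> compact B -> A `&` B = set0 ->
  exists2 e : R, 0 < e & forall x y, A x -> B y -> e <= `|x - y|.
Proof.
move=> cA cB AB.
have cAB : compact ((fun p : 'rV[R]_n * 'rV[R]_n => p.1 - p.2) @` (A `*` B)).
  apply: continuous_compact; last exact: compact_setX.
  apply: continuous_subspaceT => p.
  apply: (@cvgB _ _ _ (nbhs p) _ fst snd p.1 p.2).
    exact: cvg_fst.
  exact: cvg_snd.
have := compact_closed (@norm_hausdorff _ _) cAB.
move=> /closed_openC /open_rVP/(_ 0)[|e e0 He].
  move=> [[x y] [/= Ax By]] /subr0_eq xy.
  have : (A `&` B) x by split => //; rewrite xy.
  by rewrite AB.
exists e => // x y Ax By; rewrite leNgt; apply/negP => h.
by have := He (x - y); rewrite subr0 => /(_ h); apply; exists (x, y).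
Qed.

End Inner.

Lemma finite_uniform_gt0 (R : realType) (I : eqType) (s : seq I) (P : I -> R -> Prop) :
  (forall i e e', P i e -> e' <= e -> P i e') ->
  (forall i, exists2 e, 0 < e & P i e) ->
  exists2 e, 0 < e & forall i, i \in s -> P i e.
Proof.
move=> Pmono HP; elim: s => [|i s [e e0 es]]; first by exists 1.
have [e' e'0 ie'] := HP i; exists (Num.min e e'); first by rewrite lt_min e0.
by move=> j; rewrite inE => /orP[/eqP ->|/es h]; [apply: Pmono ie' _|apply: Pmono h _];
  rewrite ge_min lexx ?orbT.
Qed.

Section Perimeter.
Context {R : realType}.

Lemma vol_cover_cubes n (A : set 'rV[R]_n) (s : seq 'rV[R]_n) (r : R) : 0 <= r ->
  bset A -> (forall x, A x -> exists2 c, c \in s & cube c r x) ->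
  vol A <= (size s)%:R * (2 * r) ^+ n.
Proof.
move=> r0; elim: s A => [|c s IHs] A bA As.
  rewrite mul0r (_ : A = set0) ?/vol /tuples_of ?preimage_set0 ?measure0//.
  by apply/seteqP; split => // x /As[].
have [mA [M AM]] := bA.
have mC := measurable_cube c r0.
have preD : tuples_of (A `\` cube c r) = tuples_of A `\` tuples_of (cube c r) by [].
have preI : tuples_of (A `&` cube c r) = tuples_of A `&` tuples_of (cube c r) by [].
have bI : bset (A `&` cube c r).
  by split; [rewrite preI; exact: measurableI|exists M => x [/AM]].
have bD : bset (A `\` cube c r).
  split; last by exists M => x [/AM].
  by rewrite preD; exact: measurableD.
have -> : vol A = vol (A `\` cube c r) + vol (A `&` cube c r).
  rewrite /vol -fineD; last 2 first.
  - by rewrite ge0_fin_numE//; exact: bset_fin.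
  - by rewrite ge0_fin_numE//; exact: bset_fin.
  by rewrite preD preI -measureDI.
rewrite /= -natr1 mulrDl mul1r lerD//.
  apply: IHs => // x [/As[c']]; rewrite inE => /orP[/eqP -> //|c's c'x _].
  by exists c'.
exact: (@vol_le_cube _ _ _ c).
Qed.

Lemma cvg_seq_sum (I : eqType) (s : seq I) (f : I -> nat -> R) (l : I -> R) :
  (forall i, i \in s -> f i j @[j --> \oo] --> l i) ->
  \sum_(i <- s) f i j @[j --> \oo] --> \sum_(i <- s) l i.
Proof.
elim: s => [_|i s IHs fl].
  rewrite big_nil (_ : (fun j => _) = fun=> 0); first exact: cvg_cst.
  by apply/funext => j; rewrite big_nil.
rewrite big_cons (_ : (fun j => _) = fun j => f i j + \sum_(i <- s) f i j).
  apply: cvgD; first by apply: fl; rewrite mem_head.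
  by apply: IHs => k ks; apply: fl; rewrite inE ks orbT.
by apply/funext => j; rewrite big_cons.
Qed.

(** Disjoint faces may touch along their relative boundaries, so no cell size separates them. Their
    compact parts [inner] are at positive distance; the estimate obtained for these is uniform in
    [j] and passes to the limit of the volumes. *)
Lemma perimeter_bound m (rho : R) : 0 < rho ->
  exists2 C : R, 0 < C &
    forall (T : set 'rV[R]_m.+1) (s : seq (set 'rV[R]_m.+1)),
      open T -> T !=set0 -> bounded_rV T -> connected_by_star_shaped setT rho T ->
      uniq s -> (forall F F', F \in s -> F' \in s -> F != F' -> F `&` F' = set0) ->
      (forall F, F \in s -> flat_face F /\ F `<=` boundary T) ->
    \sum_(F <- s) vol (chart_map (face_chart F) @^-1` F) <= C * diam T ^+ m.
Proof.
move=> rho0; have [N0 [L L0 HC]] := @boundary_cover R m rho rho0.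
(* The summand 1 makes the constant positive whatever [N0] is. *)
exists (N0%:R * (2 * (m.+1%:R * L)) ^+ m + 1).
  by rewrite ltr_pwDr// mulr_ge0// exprn_ge0// mulr_ge0// mulr_ge0// ltW.
move=> T s oT T0 bT regT us sdisj sP.
have [x0 Tx0] := T0.
have dT : 0 < diam T.
  by have [e e0 eT] := (open_rVP _).1 oT _ Tx0; exact: diam_gt0 bT e0 eT.
pose U (F : set 'rV[R]_m.+1) : set 'rV[R]_m := chart_map (face_chart F) @^-1` F.
have bF F : F \in s -> bounded_rV F.
  move=> /sP[_ FT]; exists (`|x0| + diam T) => x /FT[cx _].
  rewrite -[x](subrK x0) addrC; apply: le_trans (ler_normD _ _) _.
  by rewrite lerD2l; exact: closure_diam.
have hU F : F \in s -> open (U F) by move=> /sP[/face_chartP[]].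
have bU F : F \in s -> bset (U F).
  by move=> Fs; have [fF _] := sP _ Fs; exact: bset_face (bF _ Fs).
pose B := N0%:R * (2 * (m.+1%:R * L)) ^+ m * diam T ^+ m.
suff : \sum_(F <- s) vol (U F) <= B.
  move=> /le_trans; apply; rewrite mulrDl mul1r lerDl exprn_ge0// ltW//.
have cv : \sum_(F <- s) vol (inner (U F) j) @[j --> \oo] --> \sum_(F <- s) vol (U F).
  by apply: cvg_seq_sum => F Fs; apply: vol_inner_cvg; [exact: hU|exact: bU].
rewrite -(cvg_lim _ cv)//; apply: limr_le; first by apply/cvg_ex; eexists; exact: cv.
apply: nearW => j.
pose K (F : set 'rV[R]_m.+1) : set 'rV[R]_m.+1 := chart_map (face_chart F) @` inner (U F) j.
have cK F : F \in s -> compact (K F).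
  move=> Fs; apply: continuous_compact; last exact/compact_inner/bU.
  exact/continuous_subspaceT/continuous_chart_map.
have KF F : K F `<=` F by move=> _ [t /inner_sub Ut <-].
have [e e0 eK] : exists2 e, 0 < e & forall p, p \in [seq (F, F') | F <- s, F' <- s] ->
    p.1 \in s -> p.2 \in s -> p.1 != p.2 ->
    forall x y, K p.1 x -> K p.2 y -> e <= `|x - y|.
  apply: finite_uniform_gt0 => [p e e' He ee' p1 p2 p12 x y Kx Ky|[F F'] /=].
    exact: le_trans ee' (He p1 p2 p12 x y Kx Ky).
  have [/and3P[Fs Fs' FF]|H] := boolP [&& F \in s, F' \in s & F != F'].
    have [|e e0 He] := compact_separated (cK _ Fs) (cK _ Fs').
      by rewrite -subset0 -(sdisj F F' Fs Fs' FF) => x [/KF ? /KF].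
    by exists e => // _ _ _; exact: He.
  by exists 1 => // h1 h2 h3; rewrite h1 h2 h3 in H.
have {}eK F F' x y : F \in s -> F' \in s -> F != F' -> K F x -> K F' y -> e <= `|x - y|.
  move=> Fs Fs' FF; apply: (eK (F, F')) => //=.
  by apply/allpairsP; exists (F, F').
pose G := (Num.truncn (L * diam T / e)).+1.
have G0 : 0 < G%:R :> R by [].
have Ge : L * diam T / G%:R < e.
  by rewrite ltr_pdivrMr// [_ * G%:R]mulrC -ltr_pdivrMr// truncnS_gt.
have [I [cell [cI cov cbd cdiam]]] := HC T oT T0 bT regT G isT.
pose meets (F : set 'rV[R]_m.+1) (i : I) := `[< exists2 t, inner (U F) j t & cell i (chart_map (face_chart F) t) >].
(* Charts are isometric for the Euclidean norm; comparing max norms through them costs the factor m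
   + 1. *)
pose r := m.+1%:R * (L * diam T / G%:R).
have r0 : 0 <= r by rewrite mulr_ge0// divr_ge0// mulr_ge0// ltW.
have volK F : F \in s -> vol (inner (U F) j) <= (\sum_i meets F i)%:R * (2 * r) ^+ m.
  move=> Fs; have [fF FT] := sP _ Fs; have [hc _ _ _] := face_chartP fF.
  (* One point of the compact part for each cell that meets it, used as the centre of a cube of
     radius [r]. The default 0 for the other cells is filtered out below. *)
  pose t i := xget 0 [set t | inner (U F) j t /\ cell i (chart_map (face_chart F) t)].
  have tP i : meets F i -> inner (U F) j (t i) /\ cell i (chart_map (face_chart F) (t i)).
    move=> /asboolP[u Uu cu].
    exact: (@xgetPex _ 0 [set t | inner (U F) j t /\ cell i (chart_map (face_chart F) t)]
      (ex_intro _ u (conj Uu cu))).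
  have := @vol_cover_cubes m (inner (U F) j) [seq t i | i <- enum I & meets F i] r r0
    (bset_inner j (hU _ Fs) (bU _ Fs)).
  rewrite size_map size_filter -sum1_count.
  rewrite (_ : (\sum_(i <- enum I | meets F i) 1)%N = (\sum_i meets F i)%N); last first.
    by rewrite big_enum_cond /= big_mkcond /=; apply: eq_bigr => i _; case: (meets F i).
  apply=> x Ux; have [|i xi] := cov (chart_map (face_chart F) x).
    by apply: FT; exact: (inner_sub Ux).
  have mi : meets F i by apply/asboolP; exists x.
  exists (t i); first by apply/mapP; exists i => //; rewrite mem_filter mi mem_enum.
  have [_ ci] := tP i mi; rewrite /cube /=.
  apply: le_trans (chart_expand _ _ hc) _; rewrite /r ler_wpM2l//.
  exact: cdiam xi ci.
(* Double counting: two faces meeting the same cell would have compact parts closer than [e]. *)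
have cnt : (\sum_(F <- s) \sum_i meets F i <= #|I|)%N.
  rewrite exchange_big -sum1_card /=; apply: leq_sum => i _.
  have [/hasP[F Fs Fi]|/hasPn H] := boolP (has (meets^~ i) s); last first.
    by rewrite big_seq big1// => F /H; case: (meets F i).
  rewrite (bigD1_seq F)//= Fi big_seq_cond big1// => F' /andP[Fs' FF].
  apply/eqP; rewrite eqb0; apply/negP => /asboolP[t' Ut' ct'].
  move: Fi => /asboolP[t Ut ct].
  have := eK F F' _ _ Fs Fs'; rewrite eq_sym FF => /(_ _ _ isT (ex_intro2 _ _ t Ut erefl)
    (ex_intro2 _ _ t' Ut' erefl)).
  by rewrite leNgt (le_lt_trans (cdiam i _ _ ct ct')).
rewrite big_seq; apply: le_trans (ler_sum _ volK) _.
rewrite -big_seq -mulr_suml -natr_sum.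
apply: (@le_trans _ _ ((N0 * G ^ m)%:R * (2 * r) ^+ m)).
  apply: ler_wpM2r; first by rewrite exprn_ge0// mulr_ge0.
  by rewrite ler_nat (leq_trans cnt).
rewrite natrM natrX le_eqVlt; apply/orP; left; apply/eqP.
rewrite /B -!mulrA; congr (_ * _); rewrite -!exprMn; congr (_ ^+ _).
by rewrite /r; field; rewrite gt_eqF.
Qed.

End Perimeter.

(** * The square root of the diffusion matrix *)

Section SquareRoot.
Import -(notations) complex.
Context {R : realType} {m : nat}.
Local Notation M := 'M[R]_m.+1.
Local Notation toC := (@real_complex_def R (Phant R)).
Implicit Types (K S : M).

(** Over the complex numbers [K] is Hermitian, hence diagonalizable with real eigenvalues, and its
    minimal polynomial is the product over the distinct ones. Extension of scalars preserves minimal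
    polynomials and is injective, so the factorization descends to [R]. *)
Lemma mxminpoly_symmetric K : symmetric_mx K ->
  exists2 rs, uniq rs & mxminpoly K = \prod_(r <- rs) ('X - r%:P).
Proof.
move=> Ksym; pose A : 'M[complex R]_m.+1 := map_mx toC K.
have Asym : A \is hermitianmx _ false idfun.
  by apply/is_hermitianmxP; rewrite expr0 scale1r map_mx_id// /A map_trmx Ksym.
have Areal : A \is a mxOver Num.real.
  by apply/mxOverP => i j; rewrite mxE; apply/complex_realP; exists (K i j).
have Aherm := realsym_hermsym Asym Areal.
have [P [d [uP AE dreal]]] : exists P d, [/\ P \in unitmx,
    A = invmx P *m diag_mx d *m P & forall i j, d i j \is Num.real].
  exists (spectralmx A), (spectral_diag A); split.
  - exact: spectral_unit.
  - exact/orthomx_spectralP/hermitian_normalmx.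
  - by apply/mxOverP; exact: hermitian_spectral_diag_real.
have Amin : mxminpoly A = \prod_(r <- undup [seq d 0 i | i <- enum 'I_m.+1]) ('X - r%:P).
  have -> : A = conjmx (invmx P) (diag_mx d).
    by rewrite conjumx ?unitmx_inv// invmxK.
  by rewrite mxminpoly_uconj ?unitmx_inv// mxminpoly_diag.
have hr i : {r | d 0 i = toC r}.
  by apply: cid; have /complex_realP := dreal 0 i.
pose rs := undup [seq sval (hr i) | i <- enum 'I_m.+1].
exists rs; first exact: undup_uniq.
apply: (map_poly_inj toC).
rewrite -mxminpoly_map -/A Amin rmorph_prod /=.
have -> : undup [seq d 0 i | i <- enum 'I_m.+1] = map toC rs.
  rewrite /rs -(undup_map_inj (@complexI R)) -[X in _ = undup X]map_comp; congr (undup _).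
  by apply: eq_map => i /=; case: (hr i).
by rewrite big_map; apply: eq_bigr => r _; rewrite map_polyXsubC.
Qed.

Lemma interpolation (rs : seq R) (g : R -> R) : uniq rs ->
  exists f : {poly R}, forall r, r \in rs -> f.[r] = g r.
Proof.
elim: rs => [|a rs IHrs] /=; first by exists 0.
move=> /andP[ars /IHrs[f fg]].
pose w := \prod_(r <- rs) ('X - r%:P).
have w0 : w.[a] != 0 by rewrite -/(root w a) root_prod_XsubC.
exists (f + ((g a - f.[a]) / w.[a]) *: w) => r; rewrite inE => /orP[/eqP ->|rrs].
  by rewrite hornerD hornerZ divfK// addrC subrK.
rewrite hornerD hornerZ fg// (_ : w.[r] = 0) ?mulr0 ?addr0//.
by apply/eqP; rewrite -/(root w r) root_prod_XsubC.
Qed.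

Lemma horner_mx_sym K p : symmetric_mx K -> symmetric_mx (horner_mx K p).
Proof.
rewrite /symmetric_mx => Ks; elim/poly_ind: p => [|p c IHp].
  by rewrite rmorph0 trmx0.
rewrite rmorphD rmorphM /= horner_mx_X horner_mx_C linearD /= tr_scalar_mx.
rewrite -[_ * K]/(_ *m K) trmx_mul IHp Ks.
congr (_ + _); transitivity (horner_mx K ('X * p)).
  by rewrite rmorphM /= horner_mx_X.
by rewrite mulrC rmorphM /= horner_mx_X.
Qed.

Lemma dot_mxact K x y : dot (mxact K x) y = dot x (mxact K^T y).
Proof. by rewrite /dot /mxact trmxK trmx_mul mulmxA. Qed.

(* If f interpolates the fourth roots of the eigenvalues of K, then f(K)^2 is
   a square root of K, and it is positive as the square of a symmetric matrix. *)
Lemma mxsqrt_exists K (lo : R) : 0 < lo -> symmetric_mx K ->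
  (forall x, lo * dot x x <= dot (mxact K x) x) ->
  exists S, [/\ symmetric_mx S, forall x, 0 <= dot (mxact S x) x & S *m S = K].
Proof.
move=> lo0 Ksym Kell; have [rs urs Kmin] := mxminpoly_symmetric Ksym.
have rpos r : r \in rs -> 0 <= r.
  rewrite -root_prod_XsubC -Kmin -eigenvalue_root_min => /eigenvalueP[v vK v0].
  have := Kell v; rewrite /mxact Ksym vK dotZl => h.
  have v1 : 0 < dot v v.
    by rewrite lt_def dot_ge0 andbT; apply: contra_neq v0; exact: dot_eq0.
  have : 0 < r * dot v v by apply: lt_le_trans h; exact: mulr_gt0.
  by rewrite pmulr_lgt0// => /ltW.
have [f fE] := interpolation (fun r => Num.sqrt (Num.sqrt r)) urs.
(* f^4 - X vanishes at the roots of the minimal polynomial, which are simple, so it is divisible by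
   it. *)
have KE : horner_mx K (f ^+ 4) = K.
  rewrite -[RHS]horner_mx_X; apply/eqP; rewrite -subr_eq0 -rmorphB /=; apply/eqP.
  apply/mxminpoly_minP; rewrite Kmin; apply: uniq_roots_dvdp; last by rewrite uniq_rootsE.
  apply/allP => r rrs; rewrite /root !hornerE fE//.
  by rewrite (exprM _ 2 2) !sqr_sqrtr ?subrr ?sqrtr_ge0 ?rpos.
exists (horner_mx K (f ^+ 2)); split.
- exact: horner_mx_sym.
- move=> x; rewrite rmorphXn /= expr2 /mxact.
  have fs := horner_mx_sym f Ksym; rewrite /symmetric_mx in fs.
  rewrite -[_ * _]/(_ *m _) trmx_mul fs mulmxA.
  by have := dot_mxact (horner_mx K f) (x *m horner_mx K f) x; rewrite /mxact trmxK !fs => ->; exact: dot_ge0.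
- by rewrite -[_ *m _]/(_ * _) -rmorphM /= -exprD.
Qed.

Lemma mxsqrt_dot K (lo : R) x : 0 < lo -> symmetric_mx K ->
  (forall x, lo * dot x x <= dot (mxact K x) x) ->
  dot (mxact (mxsqrt K) x) (mxact (mxsqrt K) x) = dot (mxact K x) x.
Proof.
move=> lo0 Ksym Kell.
have [Ss _ SS] : [/\ symmetric_mx (mxsqrt K), forall x, 0 <= dot (mxact (mxsqrt K) x) x &
    mxsqrt K *m mxsqrt K = K].
  exact: (@xgetPex _ 0 [set S | [/\ symmetric_mx S, forall x, 0 <= dot (mxact S x) x &
    S *m S = K]] (mxsqrt_exists lo0 Ksym Kell)).
rewrite dot_mxact Ss [RHS]dotC; congr (dot x _).
by rewrite /mxact -mulmxA -trmx_mul SS.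
Qed.

End SquareRoot.

(** * Existence of projections and reconstructions *)

Section Degree.
Context {R : realType} {d : nat}.
Implicit Types (p q : mpoly d R).

Lemma deg_leP m p : deg_le m p <-> forall mu : multinom d, (m < mdeg mu)%N -> mcoeff mu p = 0.
Proof.
rewrite /deg_le; split => [pm mu mmu|H].
  by apply: memN_msupp_eq0; apply: msize_mdeg_ge; exact: leq_trans pm mmu.
rewrite msizeE; apply/bigmax_leqP_seq => mu mup _; rewrite ltnS leqNgt.
by apply/negP => /H h; move: mup; rewrite mcoeff_msupp h eqxx.
Qed.

Lemma deg_leD m p q : deg_le m p -> deg_le m q -> deg_le m (p + q).
Proof.
by move=> /deg_leP hp /deg_leP hq; apply/deg_leP => mu h; rewrite mcoeffD hp// hq// addr0.
Qed.

Lemma deg_leZ m a p : deg_le m p -> deg_le m (a *: p).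
Proof. by move=> /deg_leP hp; apply/deg_leP => mu h; rewrite mcoeffZ hp// mulr0. Qed.

Lemma deg_leN m p : deg_le m p -> deg_le m (- p).
Proof. by move=> /(deg_leZ (-1)); rewrite scaleN1r. Qed.

Lemma deg_leB m p q : deg_le m p -> deg_le m q -> deg_le m (p - q).
Proof. by move=> hp hq; apply: deg_leD => //; exact: deg_leN. Qed.

Lemma deg_le0 m : @deg_le R d m 0.
Proof. by apply/deg_leP => mu _; rewrite mcoeff0. Qed.

Lemma deg_leC m a : @deg_le R d m (mpolyC d a).
Proof.
apply/deg_leP => mu h; rewrite mcoeffC; case: eqP => [mu0|_]; last by rewrite mulr0.
by move: h; rewrite mu0 mdeg0 ltn0.
Qed.

Lemma deg_le_sum m (I : Type) (r : seq I) (F : I -> mpoly d R) :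
  (forall i, deg_le m (F i)) -> deg_le m (\sum_(i <- r) F i).
Proof.
by move=> hF; apply: big_ind => //; [exact: deg_le0|move=> *; exact: deg_leD].
Qed.

Lemma deg_leS m n p : (m <= n)%N -> deg_le m p -> deg_le n p.
Proof. by move=> mn pm; apply: leq_trans pm _. Qed.

Lemma deg_le_mderiv m i p : deg_le m p -> deg_le m (mderiv i p).
Proof.
move=> /deg_leP hp; apply/deg_leP => mu h; rewrite mcoeff_mderiv hp ?mul0rn//.
by rewrite mdegD (leq_trans h)// leq_addr.
Qed.

Lemma pevalD p q (x : 'rV[R]_d) : peval (p + q) x = peval p x + peval q x.
Proof. exact: mevalD. Qed.

Lemma pevalZ a p (x : 'rV[R]_d) : peval (a *: p) x = a * peval p x.
Proof. exact: mevalZ. Qed.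

Lemma pevalB p q (x : 'rV[R]_d) : peval (p - q) x = peval p x - peval q x.
Proof. exact: mevalB. Qed.

Lemma pevalC a (x : 'rV[R]_d) : peval (mpolyC d a) x = a.
Proof. exact: mevalC. Qed.

Lemma pevalM p q (x : 'rV[R]_d) : peval (p * q) x = peval p x * peval q x.
Proof. exact: mevalM. Qed.

Lemma peval_sum (I : Type) (r : seq I) (F : I -> mpoly d R) (x : 'rV[R]_d) :
  peval (\sum_(i <- r) F i) x = \sum_(i <- r) peval (F i) x.
Proof. exact: raddf_sum. Qed.

Lemma grad_linear a p q (x : 'rV[R]_d) : grad (a *: p + q) x = a *: grad p x + grad q x.
Proof. by apply/rowP => i; rewrite !mxE mderivD mderivZ pevalD pevalZ. Qed.

Lemma grad_addC p a (x : 'rV[R]_d) : grad (p + mpolyC d a) x = grad p x.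
Proof. by apply/rowP => i; rewrite !mxE mderivD mderivC addr0. Qed.

Lemma peval_div_Kgrad (K : 'M[R]_d) p (x : 'rV[R]_d) :
  peval (div_Kgrad K p) x = \sum_i \sum_j K i j * peval (mderiv i (mderiv j p)) x.
Proof.
rewrite /div_Kgrad peval_sum; apply: eq_bigr => i _.
rewrite raddf_sum peval_sum; apply: eq_bigr => j _.
by rewrite /= mderivZ pevalZ.
Qed.

End Degree.

Section Riesz.
Context {R : realType}.

(** Fredholm alternative: [L] is in the row space of [G] if it is annihilated by the columns of
    [cokermx G]. By symmetry their transposes x satisfy x G = 0, so the hypothesis applies to
    them. *)
Lemma sym_solve N (G : 'M[R]_N) (L : 'rV[R]_N) : G^T = G ->
  (forall x : 'rV[R]_N, x *m G *m x^T = 0 -> x *m L^T = 0) -> exists y, y *m G = L.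
Proof.
move=> Gs H; suff : (L <= G)%MS by move=> /submxP[y ->]; exists y.
rewrite submxE; apply/eqP/matrixP => i j; rewrite (ord1 i) [RHS]mxE.
pose x := (cokermx G *m delta_mx j (0 : 'I_1))^T.
have xG : x *m G = 0.
  by apply: trmx_inj; rewrite trmx_mul Gs trmxK mulmxA mulmx_coker mul0mx trmx0.
have := H x; rewrite xG mul0mx => /(_ erefl)/(congr1 trmx).
rewrite trmx_mul !trmxK trmx0 mulmxA -colE => /matrixP/(_ 0 0).
by rewrite !mxE.
Qed.

Lemma psd_kernel (V : lmodType R) (B : V -> V -> R) :
  (forall a u v w, B (a *: u + v) w = a * B u w + B v w) ->
  (forall u v, B u v = B v u) -> (forall u, 0 <= B u u) ->
  forall u v, B u u = 0 -> B u v = 0.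
Proof.
move=> Bl Bs B0 u v u0; apply/eqP; apply: contraT => uv0.
(* With B u u = 0, the value of the form at a u + v is affine in a; this choice makes it -1. *)
pose a := - (B v v + 1) / (2 * B u v).
have := B0 (a *: u + v).
rewrite Bl ![B _ (_ + _)]Bs !Bl u0 (Bs v u).
rewrite (_ : _ + _ = 2 * a * B u v + B v v); last by ring.
rewrite /a (_ : 2 * _ * _ = - (B v v + 1)); last by field.
by move=> h; exfalso; lra.
Qed.

Context {d : nat}.
Local Notation mp := (mpoly d R).

Lemma linear_comb (f : mp -> R) (I : Type) (r : seq I) (c : I -> R) (e : I -> mp) :
  (forall a p q, f (a *: p + q) = a * f p + f q) ->
  f (\sum_(i <- r) c i *: e i) = \sum_(i <- r) c i * f (e i).
Proof.
move=> fl; elim: r => [|i r IHr]; last by rewrite !big_cons fl IHr.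
rewrite !big_nil; have := fl (-1) 0 0; rewrite scaleN1r addr0 oppr0 mulN1r addrC.
by rewrite subrr.
Qed.

(* B may be degenerate: polynomials in the ambient space are not determined by
   their restriction to a face, and the energy does not see constants. *)
Lemma riesz_poly m (B : mp -> mp -> R) (l : mp -> R) :
  (forall a p q w, B (a *: p + q) w = a * B p w + B q w) ->
  (forall p q, B p q = B q p) ->
  (forall a p q, l (a *: p + q) = a * l p + l q) ->
  (forall w, deg_le m w -> B w w = 0 -> l w = 0) ->
  exists2 p, deg_le m p & forall w, deg_le m w -> B p w = l w.
Proof.
move=> Bl Bs ll H.
pose N := #|{: bmultinom d m.+1}|.
pose e (i : 'I_N) : mp := mpolyX R (enum_val i : bmultinom d m.+1).
pose Q (x : 'rV[R]_N) := \sum_i x 0 i *: e i.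
have Qdeg x : deg_le m (Q x).
  apply: deg_le_sum => i; apply: deg_leZ; rewrite /deg_le msizeX.
  exact: (bmdeg (enum_val i)).
have Br u : forall a p q, B u (a *: p + q) = a * B u p + B u q.
  by move=> a p q; rewrite Bs Bl !(Bs u).
have BQ x p : B (Q x) p = \sum_i x 0 i * B (e i) p.
  by rewrite /Q (linear_comb (f := fun q => B q p)).
have lQ x : l (Q x) = \sum_i x 0 i * l (e i) by rewrite /Q linear_comb.
have repr w : deg_le m w -> exists x, w = Q x.
  move=> wm; exists (\row_i mcoeff (enum_val i : bmultinom d m.+1) w).
  rewrite {1}(mpolywE wm) (reindex (@enum_val _ predT)) /=; last exact/onW_bij/enum_val_bij.
  by apply: eq_bigr => i _; rewrite mxE.
pose G := \matrix_(i, j) B (e i) (e j).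
pose L := \row_j l (e j).
have [|x|y yG] := @sym_solve N G L.
- by apply/matrixP => i j; rewrite !mxE.
- move=> xGx; apply/matrixP => i j; rewrite (ord1 i) (ord1 j) [RHS]mxE.
  transitivity (l (Q x)).
    by rewrite lQ mxE; apply: eq_bigr => a _; rewrite !mxE.
  apply: H => //.
  have := congr1 (fun M : 'M[R]_1 => M 0 0) xGx; rewrite [RHS]mxE => <-.
  rewrite BQ mxE; apply: eq_bigr => a _; rewrite Bs BQ [RHS]mulrC !mxE.
  by congr (_ * _); apply: eq_bigr => b _; rewrite !mxE.
exists (Q y) => // w /repr[x ->].
rewrite Bs BQ lQ; apply: eq_bigr => j _; congr (_ * _).
have := congr1 (fun M : 'rV[R]_N => M 0 j) yG; rewrite [RHS]mxE => <-.
by rewrite Bs BQ mxE; apply: eq_bigr => i _; rewrite mxE.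
Qed.

End Riesz.

(** * Integration over faces and the outer normal *)

Section FaceIntegral.
Context {R : realType} {m : nat}.
Local Notation pt := 'rV[R]_m.+1.
Implicit Types (F T : set pt) (f g : pt -> R) (Fh : set (set pt)).

Definition fpre F : set 'rV[R]_m := chart_map (face_chart F) @^-1` F.

Definition fmeas F f : Prop := bmeas (fpre F) (f \o chart_map (face_chart F)).

Definition fvol F : R := vol (fpre F).

Lemma fmeas_continuous F f : bset (fpre F) -> continuous f -> fmeas F f.
Proof.
move=> bF cf; apply: continuous_bmeas => // t; apply: continuous_comp; last exact: cf.
exact: continuous_chart_map.
Qed.

Lemma fmeas_eq F f g : (forall x, F x -> f x = g x) -> fmeas F f -> fmeas F g.
Proof. by move=> fg; apply: bmeas_eq => t Ft; exact: fg. Qed.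

Lemma fmeas_peval F (q : mpoly m.+1 R) : bset (fpre F) -> fmeas F (peval q).
Proof. by move=> bF; apply: fmeas_continuous => //; exact: continuous_peval. Qed.

Lemma fmeas_poly F f : bset (fpre F) ->
  (exists q : mpoly m.+1 R, forall x, F x -> f x = peval q x) -> fmeas F f.
Proof.
move=> bF [q fq]; apply: fmeas_eq (fmeas_peval q bF) => x /fq ->//.
Qed.

End FaceIntegral.

Section Normal.
Context {R : realType} {n : nat}.
Implicit Types (T : set 'rV[R]_n) (x a b : 'rV[R]_n).

Definition is_normal T x a : Prop :=
  dot a a = 1 /\ \forall y \near x, T y <-> dot (y - x) a < 0.

Lemma dotBr a b x : dot x (a - b) = dot x a - dot x b.
Proof. by rewrite -scaleN1r dotDr dotZr mulN1r. Qed.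

(** Scaling [z] down brings x + z into both neighbourhoods without changing the signs. *)
Lemma is_normal_sign T x a b z : is_normal T x a -> is_normal T x b ->
  dot z a < 0 -> dot z b < 0.
Proof.
move=> [_ /nbhs_rVP[e e0 ea]] [_ /nbhs_rVP[e' e'0 eb]] za.
have z1 : 0 < 1 + `|z| by rewrite ltr_pwDl.
pose s := Num.min e e' / (1 + `|z|).
have ee0 : 0 < Num.min e e' by rewrite lt_min e0.
have s0 : 0 < s by rewrite divr_gt0.
have sz : `|s *: z + x - x| < Num.min e e'.
  rewrite addrK normrZ gtr0_norm// /s mulrAC ltr_pdivrMr// ltr_pM2l//.
  by rewrite ltrDr.
have /ea : `|s *: z + x - x| < e by apply: lt_le_trans sz _; rewrite ge_min lexx.
have /eb : `|s *: z + x - x| < e' by apply: lt_le_trans sz _; rewrite ge_min lexx orbT.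
rewrite addrK !dotZl => -> [_ h].
by have := h; rewrite !(pmulr_rlt0 _ s0); apply.
Qed.

(** Testing with z = - a gives a . b > 0. Testing with z = (a . b) a - b, which is orthogonal to
    [a], excludes (a . b)^2 < 1. Hence a . b >= 1 and |a - b|^2 = 2 - 2 a . b <= 0. *)
Lemma is_normal_uniq T x a b : is_normal T x a -> is_normal T x b -> a = b.
Proof.
move=> na nb; have [aa _] := na; have [bb _] := nb.
have ab0 : 0 < dot a b.
  have := is_normal_sign na nb (z := - a); rewrite -scaleN1r !dotZl aa.
  by move=> H; have := H (ltac:(lra)); lra.
have ab1 : 1 <= dot a b ^+ 2.
  have := is_normal_sign nb na (z := dot a b *: a - b).
  have -> : dot (dot a b *: a - b) b = dot a b ^+ 2 - 1.
    by rewrite -scaleN1r dotDl !dotZl bb; ring.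
  have -> : dot (dot a b *: a - b) a = 0.
    by rewrite -scaleN1r dotDl !dotZl aa (dotC b a); ring.
  by rewrite ltxx => H; rewrite leNgt; apply/negP => h; have := H (ltac:(lra)).
apply/eqP; rewrite -subr_eq0; apply/eqP/dot_eq0/eqP; rewrite eq_le dot_ge0 andbT.
rewrite dotBr ![dot (a - b) _]dotC !dotBr aa bb (dotC b a).
have : 1 <= dot a b by rewrite leNgt; apply/negP => h; nra.
by lra.
Qed.

Lemma outer_normalP T x : (is_normal T x (outer_normal T x)) \/ outer_normal T x = 0.
Proof.
have [[a na]|H] := pselect (exists a, is_normal T x a).
  by left; apply: (@xgetPex _ 0 [set n | is_normal T x n]); exists a.
by right; apply: xgetPN => a na; apply: H; exists a.
Qed.

Lemma outer_normal_le1 T x : dot (outer_normal T x) (outer_normal T x) <= 1.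
Proof. by case: (outer_normalP T x) => [[-> _]//|->]; rewrite /dot mul0mx mxE. Qed.

Lemma coord_le1 a i : dot a a <= 1 -> `|a 0 i| <= 1.
Proof.
move=> a1; apply: le_trans (rVnorm_coord a i) _; apply: le_trans (rVnorm_le_enorm a) _.
by rewrite /enorm -sqrtr1 ler_wsqrtr.
Qed.

End Normal.

Section NormalMeasurable.
Context {R : realType} {m : nat}.
Local Notation pt := 'rV[R]_m.+1.
Implicit Types (F T : set pt).

(** Face points are not in the open set [T], so nearby ones lie on the nonnegative side of the
    half-space; applied to u and - u this gives orthogonality. *)
Lemma is_normal_face T F (c : pt * 'M[R]_(m, m.+1)) t a :
  open T -> F `<=` boundary T -> open (chart_map c @^-1` F) -> F (chart_map c t) ->
  is_normal T (chart_map c t) a -> forall u : 'rV[R]_m, dot (u *m c.2) a = 0.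
Proof.
move=> oT FT oF Ft [_ /nbhs_rVP[e e0 ea]].
have [r r0 rF] := (open_rVP _).1 oF t Ft.
have nT x : F x -> ~ T x.
  by move=> /FT[_]; rewrite ((interior_id T).1 oT).
have [dl dl0 dlP] : exists2 dl : R, 0 < dl & forall u : 'rV[R]_m, `|u| < dl ->
    F (chart_map c (t + u)) /\ `|chart_map c (t + u) - chart_map c t| < e.
  have /nbhs_rVP[dl dl0 dlP] : nbhs t (chart_map c @^-1` [set y | `|y - chart_map c t| < e]).
    by apply: continuous_chart_map; apply/nbhs_rVP; exists e.
  exists (Num.min dl r); first by rewrite lt_min dl0.
  move=> u; rewrite lt_min => /andP[h1 h2]; split.
    by apply: rF; rewrite addrAC subrr add0r.
  by apply: dlP; rewrite addrAC subrr add0r.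
have ge0 (u : 'rV[R]_m) : 0 <= dot (u *m c.2) a.
  rewrite leNgt; apply/negP => u0.
  have u1 : 0 < 1 + `|u| by rewrite ltr_pwDl.
  pose s := dl / (1 + `|u|).
  have s0 : 0 < s by rewrite divr_gt0.
  have su : `|s *: u| < dl.
    rewrite normrZ gtr0_norm// /s mulrAC ltr_pdivrMr// ltr_pM2l//.
    by rewrite ltrDr.
  have [/nT nTu h] := dlP _ su; apply: nTu; apply/(ea _ h).
  by rewrite chart_mapB addrAC subrr add0r -scalemxAl dotZl pmulr_rlt0.
move=> u; apply/eqP; rewrite eq_le ge0 andbT -oppr_ge0 -mulN1r -dotZl scalemxAl.
exact: ge0.
Qed.

(** By orthogonality, moving the base point within the face leaves the half-space unchanged; halving
    the radius keeps the neighbourhood of the new point inside the old one. *)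
Lemma outer_normal_locally_constant T F (c : pt * 'M[R]_(m, m.+1)) t a :
  open T -> F `<=` boundary T -> open (chart_map c @^-1` F) -> F (chart_map c t) ->
  is_normal T (chart_map c t) a ->
  \forall t' \near t, F (chart_map c t') /\ outer_normal T (chart_map c t') = a.
Proof.
move=> oT FT oF Ft na; have orth := is_normal_face oT FT oF Ft na.
have [aa /nbhs_rVP[e e0 ea]] := na.
have [r r0 rF] := (open_rVP _).1 oF t Ft.
have /nbhs_rVP[dl dl0 dlP] :
    nbhs t (chart_map c @^-1` [set y | `|y - chart_map c t| < e / 2]).
  by apply: continuous_chart_map; apply/nbhs_rVP; exists (e / 2) => //; rewrite divr_gt0.
apply/nbhs_rVP; exists (Num.min dl r); first by rewrite lt_min dl0.
move=> t'; rewrite lt_min => /andP[/dlP /= h1 /rF h2]; split => //.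
have na' : is_normal T (chart_map c t') a.
  split=> //; apply/nbhs_rVP; exists (e / 2); first by rewrite divr_gt0.
  move=> y yt'; rewrite ea.
    have -> : y - chart_map c t = (y - chart_map c t') + (chart_map c t' - chart_map c t).
      by rewrite addrA subrK.
    by rewrite dotDl chart_mapB orth addr0.
  rewrite (_ : y - _ = (y - chart_map c t') + (chart_map c t' - chart_map c t)).
    by apply: le_lt_trans (ler_normD _ _) _; rewrite [ltRHS](splitr e) ltrD.
  by rewrite addrA subrK.
have no := @xgetPex _ 0 [set n | is_normal T (chart_map c t') n] (ex_intro _ a na').
exact: is_normal_uniq no na'.
Qed.

(* The normal is locally constant where it exists and 0 elsewhere, hence
   measurable, whether or not it exists almost everywhere on the face. *)
Lemma fmeas_outer_normal T F (phi : pt -> R) (M : R) :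
  open T -> F `<=` boundary T -> flat_face F -> bset (fpre F) ->
  (forall a, dot a a <= 1 -> `|phi a| <= M) ->
  fmeas F (fun x => phi (outer_normal T x)).
Proof.
move=> oT FT fF bF phiM; have [_ _ oF _] := face_chartP fF.
split; last by exists M => t _; apply: phiM; exact: outer_normal_le1.
move=> mA Y mY.
pose c := face_chart F.
pose P := [set t | F (chart_map c t) /\ is_normal T (chart_map c t) (outer_normal T (chart_map c t))].
have oP (Z : set pt) : open (P `&` [set t | Z (outer_normal T (chart_map c t))]).
  apply/open_rVP => t [[Ft nt] Zt].
  have /nbhs_rVP[e e0 He] := outer_normal_locally_constant oT FT oF Ft nt.
  exists e; first exact: e0.
  move=> t' /He[Ft' nE]; split; last by rewrite /= nE.
  split; first exact: Ft'.
  case: (outer_normalP T (chart_map c t')); rewrite nE// => n0.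
  have := nt.1; rewrite n0 /dot mul0mx mxE => /eqP; rewrite eq_sym oner_eq0 //.
have mP Z := open_rV_measurable (oP Z).
rewrite (_ : _ `&` _ = tuples_of (P `&` [set t | (phi @^-1` Y) (outer_normal T (chart_map c t))]) `|`
   (if `[< Y (phi 0) >] then tuples_of (fpre F) `\` tuples_of (P `&` [set t | setT (outer_normal T (chart_map c t))])
    else set0)).
  apply: measurableU; first exact: mP.
  by case: asboolP => // _; apply: measurableD => //; exact: mP.
apply/seteqP; split => t /=.
  move=> [Ft Yt]; case: (outer_normalP T (chart_map c (rv_of_tuple t))) => [nt|n0].
    by left.
  right; rewrite /c in n0; move: Yt; rewrite /= n0 => Y0; rewrite asboolT//; split => //.
  move=> [[_ nt] _]; move: nt; rewrite /c n0 => -[+ _].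
  by rewrite /dot mul0mx mxE => /eqP; rewrite eq_sym oner_eq0.
case=> [[[Ft _] Yt]//|].
case: asboolP => // Y0 [Ft nP]; split => //.
case: (outer_normalP T (chart_map c (rv_of_tuple t))) => [nt|n0].
  by exfalso; apply: nP.
by rewrite /c in n0; rewrite /= n0.
Qed.

End NormalMeasurable.

(** * Projections on an element and on its faces *)

Section Element.
Context {R : realType} {m : nat}.
Local Notation pt := 'rV[R]_m.+1.
Local Notation mp := (mpoly m.+1 R).
Implicit Types (F : set pt) (f g : pt -> R) (p q : mp).
Context (T : set pt) (Fh : set (set pt)) (c : pt) (s : R).
Context (oT : open T) (bT : bset T) (s0 : 0 < s) (cT : cube c s `<=` T).

(** The sup bound reaches any point once [L] is allowed to depend on [x], so a null integral over
    [T] forces [q] to vanish on the whole space. *)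
Lemma integral_sqr_eq0 q : integral_vol T (fun x => peval q x * peval q x) = 0 ->
  forall x, peval q x = 0.
Proof.
move=> q0 x; pose L := `|x - c| / s.
have L0 : 0 <= L by rewrite divr_ge0// ltW.
have [C C0 HC] := @poly_sup_bound R m.+1 (msize q) L L0.
have /HC : deg_le (msize q) q by exact: leqnSn.
move=> /(_ T c x s bT s0 cT); rewrite /L divfK ?gt_eqF// => /(_ (lexx _)).
under eq_integral_vol => y _ do rewrite expr2.
rewrite q0 mulr0 => h; apply/eqP; rewrite -sqrf_eq0 eq_le h sqr_ge0 //.
Qed.

(** The inverse estimate for the polynomial 1. *)
Lemma vol_gt0 : 0 < vol T.
Proof.
have [C C0 HC] := @poly_sup_bound R m.+1 0 0 (lexx 0).
have := HC T (mpolyC m.+1 1) c c s bT (deg_leC _ _) s0 cT.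
rewrite subrr normr0 mul0r lexx => /(_ isT).
under eq_integral_vol => y _ do rewrite pevalC expr1n.
rewrite integral_vol_cst// mul1r pevalC expr1n => h.
have Cs : 0 < C / s ^+ m.+1 by rewrite divr_gt0// exprn_gt0.
by rewrite -(pmulr_rgt0 _ Cs); apply: lt_le_trans h.
Qed.

Lemma bmeas_pevalM p q : bmeas T (fun x => peval p x * peval q x).
Proof. by apply: bmeasM; exact: bmeas_peval. Qed.

(** Pythagoras. In use, [e] is a projection error and e + w the error of a competitor. *)
Lemma best_approx_vol (e w : pt -> R) : bmeas T e -> bmeas T w ->
  integral_vol T (fun x => e x * w x) = 0 ->
  integral_vol T (fun x => e x ^+ 2) <= integral_vol T (fun x => (e x + w x) ^+ 2).
Proof.
move=> me mw ew.
have me2 : bmeas T (fun x => e x ^+ 2) by apply: bmeasM.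
have mw2 : bmeas T (fun x => w x ^+ 2) by apply: bmeasM.
have mew : bmeas T (fun x => 2 * (e x * w x)) by apply: bmeasZ; exact: bmeasM.
have -> : integral_vol T (fun x => (e x + w x) ^+ 2) =
    integral_vol T (fun x => e x ^+ 2 + 2 * (e x * w x) + w x ^+ 2).
  by apply: eq_integral_vol => x _; ring.
rewrite integral_volD//; last exact: bmeasD.
rewrite integral_volD// integral_volZ//; last exact: bmeasM.
rewrite ew mulr0 addr0 lerDl; apply: integral_vol_ge0 => x _; exact: sqr_ge0.
Qed.

Lemma proj_elt_spec k f q : (forall x, f x = peval q x) ->
  deg_le k (proj_elt k T f) /\
  forall w, deg_le k w -> ip_vol T (peval (proj_elt k T f) \- f) (peval w) = 0.
Proof.
move=> fq.
suff : exists p, deg_le k p /\ forall w, deg_le k w -> ip_vol T (peval p \- f) (peval w) = 0.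
  exact: (@xgetPex _ 0 [set q | deg_le k q /\
    forall w, deg_le k w -> ip_vol T (peval q \- f) (peval w) = 0]).
have [|||w wk|p pk pP] := @riesz_poly R m.+1 k
  (fun p w => integral_vol T (fun x => peval p x * peval w x))
  (fun w => integral_vol T (fun x => peval q x * peval w x)).
- move=> a p p' w; rewrite -(integral_volZ a bT (bmeas_pevalM p w)).
  rewrite -(integral_volD bT (bmeasZ a (bmeas_pevalM p w)) (bmeas_pevalM p' w)).
  by apply: eq_integral_vol => x _; rewrite pevalD pevalZ; ring.
- by move=> p w; apply: eq_integral_vol => x _; rewrite mulrC.
- move=> a p w; rewrite -(integral_volZ a bT (bmeas_pevalM q p)).
  rewrite -(integral_volD bT (bmeasZ a (bmeas_pevalM q p)) (bmeas_pevalM q w)).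
  by apply: eq_integral_vol => x _; rewrite pevalD pevalZ; ring.
- move=> /integral_sqr_eq0 w0; rewrite -[RHS](mul0r (vol T)) -integral_vol_cst//.
  by apply: eq_integral_vol => x _; rewrite w0 mulr0.
exists p; split => // w wk; rewrite /ip_vol.
rewrite -[RHS](subrr (integral_vol T (fun x => peval q x * peval w x))) -{1}(pP w wk).
rewrite -(integral_volB bT (bmeas_pevalM p w) (bmeas_pevalM q w)).
by apply: eq_integral_vol => x _ /=; rewrite fq mulrBl.
Qed.

Context (fin : finite_set (faces_of Fh T)).
Context (disj : forall F F', faces_of Fh T F -> faces_of Fh T F' -> F != F' -> F `&` F' = set0).
Context (flat : forall F, faces_of Fh T F -> flat_face F).
Context (bF : forall F, faces_of Fh T F -> bset (fpre F)).

Definition bd_faces : seq (set pt) := finmap.enum_fset (fset_set (faces_of Fh T)).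

Lemma mem_bd_faces F : F \in bd_faces -> faces_of Fh T F.
Proof. by rewrite /bd_faces => h; have := in_fset_set fin F; rewrite [LHS]h => /esym/set_mem. Qed.

Lemma integral_bdE f : integral_bd Fh T f = \sum_(F <- bd_faces) integral_face F f.
Proof. by rewrite /integral_bd fsbig_finite. Qed.

Definition bdmeas f : Prop := forall F, faces_of Fh T F -> fmeas F f.

Definition pwpoly f : Prop := forall F, faces_of Fh T F ->
  exists q : mp, forall x, F x -> f x = peval q x.

Lemma pwpoly_bdmeas f : pwpoly f -> bdmeas f.
Proof. by move=> fp F FT; apply: fmeas_poly; [exact: bF|exact: fp]. Qed.

Lemma face_poly_pwpoly k f : face_poly k Fh T f -> pwpoly f.
Proof. by move=> fp F /fp[q _ fq]; exists q. Qed.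

Lemma pwpoly_peval q : pwpoly (peval q).
Proof. by move=> F _; exists q. Qed.

Lemma pwpolyB f g : pwpoly f -> pwpoly g -> pwpoly (fun x => f x - g x).
Proof.
move=> fp gp F FT; have [p fP] := fp F FT; have [q gq] := gp F FT.
by exists (p - q) => x Fx; rewrite pevalB fP// gq.
Qed.

Lemma bdmeasM f g : bdmeas f -> bdmeas g -> bdmeas (fun x => f x * g x).
Proof. by move=> mf mg F FT; exact: bmeasM (mf F FT) (mg F FT). Qed.

Lemma bdmeasD f g : bdmeas f -> bdmeas g -> bdmeas (fun x => f x + g x).
Proof. by move=> mf mg F FT; exact: bmeasD (mf F FT) (mg F FT). Qed.

Lemma bdmeasZ a f : bdmeas f -> bdmeas (fun x => a * f x).
Proof. by move=> mf F FT; exact: bmeasZ (mf F FT). Qed.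

Lemma bdmeas_sqr f : bdmeas f -> bdmeas (fun x => f x ^+ 2).
Proof. by move=> mf; exact: bdmeasM. Qed.

Lemma integral_bdD f g : bdmeas f -> bdmeas g ->
  integral_bd Fh T (fun x => f x + g x) = integral_bd Fh T f + integral_bd Fh T g.
Proof.
move=> mf mg; rewrite !integral_bdE -big_split; apply: eq_big_seq => F /mem_bd_faces FT.
by apply: integral_volD; [exact: bF|exact: mf|exact: mg].
Qed.

Lemma integral_bdZ a f : bdmeas f ->
  integral_bd Fh T (fun x => a * f x) = a * integral_bd Fh T f.
Proof.
move=> mf; rewrite !integral_bdE mulr_sumr; apply: eq_big_seq => F /mem_bd_faces FT.
by apply: integral_volZ; [exact: bF|exact: mf].
Qed.

Lemma integral_bd_ge0 f : (forall x, 0 <= f x) -> 0 <= integral_bd Fh T f.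
Proof.
by move=> f0; rewrite integral_bdE sumr_ge0// => F _; apply: integral_vol_ge0 => t _; exact: f0.
Qed.

Lemma le_integral_bd f g : bdmeas f -> bdmeas g ->
  (forall F x, faces_of Fh T F -> F x -> f x <= g x) ->
  integral_bd Fh T f <= integral_bd Fh T g.
Proof.
move=> mf mg fg; rewrite !integral_bdE big_seq [leRHS]big_seq.
apply: ler_sum => F /mem_bd_faces FT.
by apply: le_integral_vol => [|||t Ft]; [exact: bF|exact: mf|exact: mg|exact: fg FT Ft].
Qed.

Lemma eq_integral_bd f g : (forall F x, faces_of Fh T F -> F x -> f x = g x) ->
  integral_bd Fh T f = integral_bd Fh T g.
Proof.
move=> fg; rewrite !integral_bdE; apply: eq_big_seq => F /mem_bd_faces FT.
by apply: eq_integral_vol => t Ft; exact: fg FT Ft.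
Qed.

Lemma integral_bd_cst a : integral_bd Fh T (fun=> a) = a * \sum_(F <- bd_faces) fvol F.
Proof.
rewrite integral_bdE mulr_sumr; apply: eq_big_seq => F /mem_bd_faces FT.
by apply: integral_vol_cst; exact: bF.
Qed.

Lemma best_approx_bd (e w : pt -> R) : bdmeas e -> bdmeas w ->
  integral_bd Fh T (fun x => e x * w x) = 0 ->
  integral_bd Fh T (fun x => e x ^+ 2) <= integral_bd Fh T (fun x => (e x + w x) ^+ 2).
Proof.
move=> me mw ew.
have -> : integral_bd Fh T (fun x => (e x + w x) ^+ 2) =
    integral_bd Fh T (fun x => e x ^+ 2 + 2 * (e x * w x) + w x ^+ 2).
  by apply: eq_integral_bd => F x _ _; ring.
have mew := bdmeasM me mw.
have me2 := bdmeas_sqr me; have mw2 := bdmeas_sqr mw.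
rewrite (integral_bdD (bdmeasD me2 (bdmeasZ 2 mew)) mw2).
rewrite (integral_bdD me2 (bdmeasZ 2 mew)) (integral_bdZ 2 mew).
rewrite ew mulr0 addr0 lerDl; apply: integral_bd_ge0 => x; exact: sqr_ge0.
Qed.

(** The L^2 form of a face is only semidefinite on ambient polynomials. The compatibility that
    [riesz_poly] asks for is the degenerate Cauchy-Schwarz inequality [psd_kernel]. *)
Lemma proj_face_exists k F q : faces_of Fh T F ->
  exists2 p, deg_le k p & forall w, deg_le k w ->
    integral_face F (fun x => (peval p x - peval q x) * peval w x) = 0.
Proof.
move=> FT; have b := bF FT.
have mM p w : fmeas F (fun x => peval p x * peval w x).
  by apply: bmeasM; exact: fmeas_peval.
pose B p w := integral_face F (fun x => peval p x * peval w x).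
have BE p w : B p w = integral_vol (fpre F) ((fun x => peval p x * peval w x) \o chart_map (face_chart F)) by [].
have Bl a p p' w : B (a *: p + p') w = a * B p w + B p' w.
  rewrite !BE -(integral_volZ a b (mM p w)).
  rewrite -(integral_volD b (bmeasZ a (mM p w)) (mM p' w)).
  by apply: eq_integral_vol => t _ /=; rewrite pevalD pevalZ; ring.
have Bs p w : B p w = B w p.
  by rewrite !BE; apply: eq_integral_vol => t _ /=; rewrite mulrC.
have B0 p : 0 <= B p p.
  by apply: integral_vol_ge0 => t _ /=; rewrite -expr2 sqr_ge0.
have [|||w wk w0|p pk pP] := @riesz_poly R m.+1 k B (B q).
- by [].
- by [].
- by move=> a p p'; rewrite Bs Bl !(Bs q).
- by rewrite Bs; exact: (psd_kernel Bl Bs B0).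
exists p => // w wk.
rewrite -[RHS](subrr (B q w)) -{1}(pP w wk) !BE -(integral_volB b (mM p w) (mM q w)).
by apply: eq_integral_vol => t _ /=; rewrite mulrBl.
Qed.

Lemma proj_faces_spec k f : pwpoly f ->
  face_poly k Fh T (proj_faces k Fh T f) /\
  forall w, face_poly k Fh T w -> ip_bd Fh T (proj_faces k Fh T f \- f) w = 0.
Proof.
move=> fp.
suff : exists g, face_poly k Fh T g /\ forall w, face_poly k Fh T w -> ip_bd Fh T (g \- f) w = 0.
  exact: (@xgetPex _ (fun=> 0) [set g | face_poly k Fh T g /\
    forall w, face_poly k Fh T w -> ip_bd Fh T (g \- f) w = 0]).
have H F : exists pq : mp * mp, faces_of Fh T F ->
    [/\ deg_le k pq.1, forall x, F x -> f x = peval pq.2 x & forall w, deg_le k w ->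
    integral_face F (fun x => (peval pq.1 x - peval pq.2 x) * peval w x) = 0].
  have [FT|nF] := pselect (faces_of Fh T F); last by exists (0, 0).
  have [q fq] := fp F FT; have [p pk pP] := proj_face_exists k q FT.
  by exists (p, q).
pose pq F := sval (cid (H F)).
have pqP F : faces_of Fh T F -> [/\ deg_le k (pq F).1, forall x, F x -> f x = peval (pq F).2 x &
    forall w, deg_le k w ->
    integral_face F (fun x => (peval (pq F).1 x - peval (pq F).2 x) * peval w x) = 0].
  by rewrite /pq; case: cid.
(* The face containing [x], unique by disjointness; it glues the facewise projections into one
   function. *)
pose the x := xget set0 [set F | faces_of Fh T F /\ F x].
have theE F x : faces_of Fh T F -> F x -> the x = F.
  move=> FT Fx; have [tT tx] := @xgetPex _ set0 [set F | faces_of Fh T F /\ F x]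
    (ex_intro _ F (conj FT Fx)).
  apply/eqP; apply: contraT => ne.
  have : (the x `&` F) x by [].
  by rewrite (disj tT FT ne).
exists (fun x => peval (pq (the x)).1 x); split.
  move=> F FT; have [h _ _] := pqP F FT; exists (pq F).1 => // x Fx.
  by rewrite (theE F).
move=> w wp; rewrite /ip_bd integral_bdE big1_seq// => F /mem_bd_faces FT.
have [h1 h2 h3] := pqP F FT; have [w' w'k ww'] := wp F FT.
rewrite -(h3 w' w'k); apply: eq_integral_vol => t Ft /=.
by rewrite (theE F)// (h2 _ Ft) (ww' _ Ft).
Qed.

End Element.

(** * Trace bounds and coercivity *)

Section Reconstruction.
Context {R : realType} {m : nat}.
Local Notation pt := 'rV[R]_m.+1.
Local Notation mp := (mpoly m.+1 R).
Implicit Types (p q w : mp) (K : 'M[R]_m.+1).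

(** The integrand (K grad p) . grad w as a polynomial, which settles its measurability and
    boundedness. *)
Definition grad_form K p w : mp := \sum_i (\sum_j K i j *: mderiv j p) * mderiv i w.

Lemma mxact_grad K p x i :
  mxact K (grad p x) 0 i = peval (\sum_j K i j *: mderiv j p) x.
Proof.
rewrite /mxact mxE peval_sum; apply: eq_bigr => j _.
by rewrite pevalZ !mxE mulrC.
Qed.

Lemma peval_grad_form K p w x :
  peval (grad_form K p w) x = dot (mxact K (grad p x)) (grad w x).
Proof.
rewrite dotE /grad_form peval_sum; apply: eq_bigr => i _.
by rewrite pevalM mxact_grad [in RHS]mxE.
Qed.

Lemma mxact_linear K a (x y : pt) : mxact K (a *: x + y) = a *: mxact K x + mxact K y.
Proof. by rewrite /mxact mulmxDl -scalemxAl. Qed.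

Lemma bmeas_grad_form (T : set pt) K p w : bset T ->
  bmeas T (fun x => dot (mxact K (grad p x)) (grad w x)).
Proof.
by move=> bT; apply: bmeas_eq (bmeas_peval (grad_form K p w) bT) => x _; rewrite peval_grad_form.
Qed.

Lemma bmeas_grad_sqr (T : set pt) p : bset T -> bmeas T (fun x => dot (grad p x) (grad p x)).
Proof.
move=> bT; apply: bmeas_eq (bmeas_grad_form 1%:M p p bT) => x _.
by rewrite /mxact trmx1 mulmx1.
Qed.

Context (T : set pt) (Fh : set (set pt)) (c : pt) (s : R).
Context (oT : open T) (bT : bset T) (s0 : 0 < s) (cT : cube c s `<=` T).
Context (fin : finite_set (faces_of Fh T)).
Context (flat : forall F, faces_of Fh T F -> flat_face F).
Context (bF : forall F, faces_of Fh T F -> bset (fpre F)).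

Lemma bdmeas_normal_coord i : bdmeas T Fh (fun x => outer_normal T x 0 i).
Proof.
move=> F FT; have [_ FbT] := FT.
apply: (fmeas_outer_normal (phi := fun a => a 0 i) oT FbT (flat FT) (bF FT)).
by move=> a; exact: coord_le1.
Qed.

Lemma bdmeas_flux K (f : pt -> R) w : pwpoly T Fh f ->
  bdmeas T Fh (fun x => f x * dot (mxact K (grad w x)) (outer_normal T x)).
Proof.
move=> fp; have fm := pwpoly_bdmeas bF fp.
have H i : bdmeas T Fh (fun x => peval (\sum_j K i j *: mderiv j w) x * outer_normal T x 0 i).
  exact: bdmeasM (pwpoly_bdmeas bF (pwpoly_peval _)) (bdmeas_normal_coord i).
apply: bdmeasM => // F FT.
have := @bmeas_sum R m (fpre F) _ (index_enum 'I_m.+1)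
  (fun i t => peval (\sum_j K i j *: mderiv j w) (chart_map (face_chart F) t) *
     outer_normal T (chart_map (face_chart F) t) 0 i) (fun i => H i F FT).
by apply: bmeas_eq => t _ /=; rewrite dotE; apply: eq_bigr => i _; rewrite mxact_grad.
Qed.

(** By ellipticity a polynomial of null energy has zero gradient everywhere. The right-hand side
    contains [w] only through derivatives, so it vanishes too and [riesz_poly] applies. Adding a
    constant then adjusts the mean without changing the gradient. *)
Lemma reconstruction_spec k K (lo : R) (v : @hho R m.+1) :
  symmetric_mx K -> 0 < lo -> (forall x, lo * dot x x <= dot (mxact K x) x) ->
  pwpoly T Fh v.2 ->
  deg_le k.+1 (reconstruction k K Fh T v) /\
  ip_vol T (peval v.1 \- peval (reconstruction k K Fh T v)) (fun=> 1) = 0.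
Proof.
move=> Ks lo0 Kell vp.
pose Q p := [/\ deg_le k.+1 p,
    forall w, deg_le k.+1 w ->
      ip_vec T (fun x => mxact K (grad p x)) (grad w) =
        - ip_vol T (peval v.1) (peval (div_Kgrad K w))
        + ip_bd Fh T v.2 (fun x => dot (mxact K (grad w x)) (outer_normal T x)) &
    ip_vol T (peval v.1 \- peval p) (fun=> 1) = 0].
suff ex : exists p, Q p by have [h1 _ h2] := @xgetPex _ 0 [set p | Q p] ex.
pose B p w := ip_vec T (fun x => mxact K (grad p x)) (grad w).
pose l w := - ip_vol T (peval v.1) (peval (div_Kgrad K w))
        + ip_bd Fh T v.2 (fun x => dot (mxact K (grad w x)) (outer_normal T x)).
have Bm p w := @bmeas_grad_form T K p w bT.
have Bl a p q w : B (a *: p + q) w = a * B p w + B q w.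
  rewrite /B /ip_vec -(integral_volZ a bT (Bm p w)).
  rewrite -(integral_volD bT (bmeasZ a (Bm p w)) (Bm q w)).
  by apply: eq_integral_vol => x _; rewrite grad_linear mxact_linear dotDl dotZl.
have Bs p q : B p q = B q p.
  by apply: eq_integral_vol => x _; rewrite dot_mxact Ks dotC.
have ll a p q : l (a *: p + q) = a * l p + l q.
  rewrite /l.
  have -> : ip_vol T (peval v.1) (peval (div_Kgrad K (a *: p + q))) =
      a * ip_vol T (peval v.1) (peval (div_Kgrad K p)) + ip_vol T (peval v.1) (peval (div_Kgrad K q)).
    have vm w := @bmeas_pevalM R m T bT v.1 (div_Kgrad K w).
    rewrite /ip_vol -(integral_volZ a bT (vm p)) -(integral_volD bT (bmeasZ a (vm p)) (vm q)).
    apply: eq_integral_vol => x _; rewrite !peval_div_Kgrad.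
    rewrite mulrCA -mulrDr; congr (_ * _).
    rewrite mulr_sumr -big_split /=; apply: eq_bigr => i _.
    rewrite mulr_sumr -big_split /=; apply: eq_bigr => j _.
    by rewrite !(mderivD, mderivZ) pevalD pevalZ; ring.
  have -> : ip_bd Fh T v.2 (fun x => dot (mxact K (grad (a *: p + q) x)) (outer_normal T x)) =
     a * ip_bd Fh T v.2 (fun x => dot (mxact K (grad p x)) (outer_normal T x)) +
     ip_bd Fh T v.2 (fun x => dot (mxact K (grad q x)) (outer_normal T x)).
    have fm w := @bdmeas_flux K v.2 w vp.
    rewrite /ip_bd -(integral_bdZ fin bF a (fm p)) -(integral_bdD fin bF (bdmeasZ a (fm p)) (fm q)).
    by apply: eq_integral_bd => // F x _ _; rewrite grad_linear mxact_linear dotDl dotZl; ring.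
  by rewrite opprD addrACA mulrDr mulrN.
have Bker w : deg_le k.+1 w -> B w w = 0 -> l w = 0.
  move=> _ w0.
  have E0 : integral_vol T (fun x => dot (grad w x) (grad w x)) = 0.
    apply/eqP; rewrite eq_le integral_vol_ge0 ?andbT => [|x _]; last exact: dot_ge0.
    rewrite -(ler_pM2l lo0) mulr0 -w0 -(integral_volZ lo bT (bmeas_grad_sqr w bT)).
    apply: le_integral_vol => //; exact: bmeasZ (bmeas_grad_sqr w bT).
  have dw0 i x : peval (mderiv i w) x = 0.
    apply: (integral_sqr_eq0 bT s0 cT).
    apply/eqP; rewrite eq_le integral_vol_ge0 ?andbT => [|y _]; last by rewrite -expr2 sqr_ge0.
    rewrite -E0; apply: le_integral_vol (bmeas_pevalM bT _ _) (bmeas_grad_sqr w bT) _ => //.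
    move=> y _; rewrite dotE (bigD1 i)//= !mxE lerDl sumr_ge0// => j _.
    by rewrite -expr2 sqr_ge0.
  have g0 x : grad w x = 0 by apply/rowP => i; rewrite mxE dw0 mxE.
  rewrite /l; have -> : ip_vol T (peval v.1) (peval (div_Kgrad K w)) = 0.
    rewrite -[RHS](mul0r (vol T)) -integral_vol_cst//.
    apply: eq_integral_vol => x _; rewrite peval_div_Kgrad big1 ?mulr0// => i _.
    by rewrite big1// => j _; rewrite (peval0_mderiv (dw0 j)) mulr0.
  rewrite oppr0 add0r -[RHS](mul0r (\sum_(F <- bd_faces T Fh) fvol F)) -(integral_bd_cst fin bF).
  by apply: eq_integral_bd => // F x _ _; rewrite g0 /mxact mul0mx /dot mul0mx mxE mulr0.
have [p pk pP] := riesz_poly Bl Bs ll Bker.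
pose a := integral_vol T (fun x => peval v.1 x - peval p x) / vol T.
have vT := vol_gt0 bT s0 cT.
have gradE x : grad (p + mpolyC _ a) x = grad p x by exact: grad_addC.
exists (p + mpolyC _ a); split.
- by apply: deg_leD => //; exact: deg_leC.
- move=> w wk; rewrite -/(l w) -(pP w wk).
  by apply: eq_integral_vol => x _; rewrite gradE.
- have mv := bmeasB (bmeas_peval v.1 bT) (bmeas_peval p bT).
  rewrite /ip_vol (@eq_integral_vol _ _ _ _ (fun x => (peval v.1 x - peval p x) - a)).
    by rewrite (integral_volB bT mv (bmeas_cst _ a)) integral_vol_cst// /a divfK ?subrr// gt_eqF.
  by move=> x _ /=; rewrite pevalD pevalC; ring.
Qed.

End Reconstruction.

Section TraceBounds.
Context {R : realType} {m : nat}.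
Local Notation pt := 'rV[R]_m.+1.
Local Notation mp := (mpoly m.+1 R).
Implicit Types (p q e : mp) (T : set pt).

(** Mean value theorem from [c]: on the segment each partial derivative is bounded by the inverse
    estimate, and the integral of its square by that of |grad q|^2. [sg] is the ratio of the inner
    cube to [h]. *)
Lemma oscillation (M : nat) (sg : R) : 0 < sg ->
  exists2 C : R, 0 < C & forall T c h q, 0 < h -> bset T -> cube c (sg * h) `<=` T ->
    deg_le M q -> forall x, `|x - c| <= h ->
    (peval q x - peval q c) ^+ 2 <=
      C * h ^+ 2 / h ^+ m.+1 * integral_vol T (fun y => dot (grad q y) (grad q y)).
Proof.
move=> sg0; have [|C1 C10 HC] := @poly_sup_bound R m.+1 M sg^-1; first by rewrite invr_ge0 ltW.
exists (m.+1%:R ^+ 2 * (C1 / sg ^+ m.+1)).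
  by rewrite mulr_gt0 ?exprn_gt0// divr_gt0// exprn_gt0.
move=> T c h q h0 bT cT qM x xc.
set E := integral_vol T _.
have E0 : 0 <= E by apply: integral_vol_ge0 => y _; exact: dot_ge0.
have s0 : 0 < sg * h by rewrite mulr_gt0.
pose G2 := C1 / (sg * h) ^+ m.+1 * E.
have G20 : 0 <= G2 by rewrite mulr_ge0// divr_ge0 ?exprn_ge0// ltW.
have HG i t : 0 <= t <= 1 -> `|peval (mderiv i q) (c + t *: (x - c))| <= Num.sqrt G2.
  move=> /andP[t0 t1]; rewrite -sqrtr_sqr ler_wsqrtr//.
  apply: le_trans (HC T (mderiv i q) c _ (sg * h) bT (deg_le_mderiv i qM) s0 cT _) _.
    rewrite addrAC subrr add0r normrZ ger0_norm// mulrA mulVf ?gt_eqF// mul1r.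
    by apply: le_trans xc; rewrite ler_piMl.
  rewrite ler_wpM2l//; first by rewrite divr_ge0 ?exprn_ge0// ltW.
  apply: le_integral_vol => //.
  - by apply: bmeasM; exact: bmeas_peval.
  - exact: bmeas_grad_sqr.
  - move=> y _; rewrite dotE (bigD1 i)//= !mxE expr2 lerDl sumr_ge0// => j _.
    by rewrite -expr2 sqr_ge0.
have := peval_mvt HG => H.
rewrite -(real_normK (num_real _)).
apply: (@le_trans _ _ ((m.+1%:R * h * Num.sqrt G2) ^+ 2)).
  rewrite lerXn2r ?nnegrE ?mulr_ge0 ?sqrtr_ge0 ?(ltW h0)//.
  by apply: le_trans H _; rewrite ler_wpM2r ?sqrtr_ge0// ler_wpM2l.
rewrite !exprMn sqr_sqrtr// /G2 exprMn le_eqVlt; apply/orP; left; apply/eqP.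
by field; rewrite !expf_neq0 ?gt_eqF.
Qed.

(** Both bounds multiply a sup bound by the perimeter. The second serves projection errors [e],
    which p - p(c) dominates in L^2(T) but not pointwise; the inverse estimate for [e] itself
    restores a sup bound. *)
Lemma trace_bounds (M : nat) (rho : R) : 0 < rho ->
  exists2 C : R, 0 < C & forall T Fh, open T -> T !=set0 -> bounded_rV T ->
    connected_by_star_shaped setT rho T -> finite_set (faces_of Fh T) ->
    (forall F F', faces_of Fh T F -> faces_of Fh T F' -> F != F' -> F `&` F' = set0) ->
    (forall F, faces_of Fh T F -> flat_face F) ->
    0 < diam T /\
    exists c s, [/\ 0 < s, cube c s `<=` T,
      forall p, deg_le M p ->
        integral_bd Fh T (fun x => (peval p x - peval p c) ^+ 2) <=
          C * diam T * integral_vol T (fun y => dot (grad p y) (grad p y)) &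
      forall p e, deg_le M p -> deg_le M e ->
        integral_vol T (fun x => peval e x ^+ 2) <=
          integral_vol T (fun x => (peval p x - peval p c) ^+ 2) ->
        integral_bd Fh T (fun x => peval e x ^+ 2) <=
          C * diam T * integral_vol T (fun y => dot (grad p y) (grad p y))].
Proof.
(* Half of the relative radius of the inner ball, so that a closed cube fits into the open ball. *)
move=> rho0; pose sg : R := rho / (2 * m.+1%:R).
have sg0 : 0 < sg by rewrite divr_gt0// mulr_gt0.
have [|C1 C10 HC1] := @poly_sup_bound R m.+1 M sg^-1; first by rewrite invr_ge0 ltW.
have [C2 C20 HC2] := oscillation M sg0.
have [C3 C30 HC3] := @perimeter_bound R m rho rho0.
(* [C1] / [sg]^d is from the inverse estimate, 2^d from the volume of the cube of radius h that
   contains [T]. *)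
pose C4 := C1 / sg ^+ m.+1 * 2 ^+ m.+1.
have C40 : 0 < C4 by rewrite mulr_gt0 ?exprn_gt0// divr_gt0// exprn_gt0.
exists ((1 + C4) * (C2 * C3)); first by rewrite mulr_gt0 ?mulr_gt0// addr_gt0.
move=> T Fh oT T0 bT0 regT fin disj flat.
have [x0 Tx0] := T0.
have dT : 0 < diam T.
  by have [e e0 eT] := (open_rVP _).1 oT _ Tx0; exact: diam_gt0 bT0 e0 eT.
split=> //; set h := diam T in dT *.
have [c cP] := regular_inner_ball rho0 T0 dT regT.
have s0 : 0 < sg * h by rewrite mulr_gt0.
have cT : cube c (sg * h) `<=` T.
  move=> y yc; apply: cP; apply: (le_lt_trans yc).
  rewrite /sg (_ : rho * diam T / m.+1%:R = 2 * (rho / (2 * m.+1%:R) * h)).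
    by rewrite -/sg ltr_pMl// ltr1n.
  by rewrite -/h; field.
have Tc : T c by apply: cT; rewrite /cube /= subrr normr0 ltW.
have bT : bset T by split; [exact: open_rV_measurable|].
have clT x : closure T x -> `|x - c| <= h by move=> Tx; exact: closure_diam.
have Th : T `<=` cube c h by move=> x Tx; apply: clT; exact: subset_closure.
have FT F x : faces_of Fh T F -> F x -> `|x - c| <= h.
  by move=> [_ Fb] /Fb[cx _]; exact: clT.
have bF F : faces_of Fh T F -> bset (fpre F).
  move=> FF; apply: bset_face; first exact: flat.
  exists (`|c| + h) => x Fx; rewrite -[x](subrK c) addrC.
  by apply: le_trans (ler_normD _ _) _; rewrite lerD2l; exact: FT FF Fx.
have perim : \sum_(F <- bd_faces T Fh) fvol F <= C3 * h ^+ m.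
  apply: HC3 => //; first exact: finmap.fset_uniq.
    by move=> F F' /(mem_bd_faces fin) h1 /(mem_bd_faces fin) h2; exact: disj.
  by move=> F /(mem_bd_faces fin) FF; split; [exact: flat|case: FF].
have bdb (f : pt -> R) (N : R) : 0 <= N -> bdmeas T Fh f -> (forall x, `|x - c| <= h -> f x <= N) ->
    integral_bd Fh T f <= N * (C3 * h ^+ m).
  move=> N0 mf fN; apply: (@le_trans _ _ (integral_bd Fh T (fun=> N))).
    apply: (le_integral_bd fin bF mf) => [F _|F x FF Fx]; first exact: bmeas_cst.
    by apply: fN; exact: FT FF Fx.
  by rewrite (integral_bd_cst fin bF) ler_wpM2l.
have mpoly2 q : bdmeas T Fh (fun x => peval q x ^+ 2).
  by apply: bdmeas_sqr; apply: (pwpoly_bdmeas bF); exact: pwpoly_peval.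
have mosc p a : bdmeas T Fh (fun x => (peval p x - a) ^+ 2).
  have := mpoly2 (p - mpolyC _ a); congr (bdmeas T Fh); apply/funext => x.
  by rewrite pevalB pevalC.
have bosc p a : bmeas T (fun x => (peval p x - a) ^+ 2).
  by apply: bmeasM; apply: bmeasB; exact: bmeas_peval || exact: bmeas_cst.
(* h^2 from the mean value theorem, h^(-d) from the inverse estimate and h^(d-1) from the perimeter
   combine to h. *)
have KE (E a : R) : C2 * h ^+ 2 / h ^+ m.+1 * E * (a * h ^+ m) = C2 * a * h * E.
  have hm0 : h ^+ m != 0 by rewrite expf_neq0// gt_eqF.
  rewrite (exprSr h m); move: (h ^+ m) hm0 => hm hm0.
  by field; rewrite hm0 gt_eqF.
exists c, (sg * h); split => //.
- move=> p pM; set E := integral_vol T _.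
  have E0 : 0 <= E by apply: integral_vol_ge0 => y _; exact: dot_ge0.
  have K0 : 0 <= C2 * h ^+ 2 / h ^+ m.+1 * E.
    by rewrite mulr_ge0// divr_ge0 ?mulr_ge0 ?exprn_ge0// ltW.
  apply: le_trans (bdb _ _ K0 (mosc p _) _) _.
    by move=> x; exact: HC2.
  rewrite KE ler_wpM2r// ler_wpM2r ?(ltW dT)// ler_peMl ?mulr_ge0 ?(ltW C20) ?(ltW C30)//.
  by rewrite lerDl ltW.
- move=> p e pM eM ep; set E := integral_vol T (fun y => dot _ _).
  have E0 : 0 <= E by apply: integral_vol_ge0 => y _; exact: dot_ge0.
  pose K := C2 * h ^+ 2 / h ^+ m.+1 * E.
  have K0 : 0 <= K.
    by rewrite mulr_ge0// divr_ge0 ?mulr_ge0 ?exprn_ge0// ltW.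
  have ev : integral_vol T (fun x => peval e x ^+ 2) <= K * (2 * h) ^+ m.+1.
    apply: le_trans ep _; apply: (@le_trans _ _ (integral_vol T (fun=> K))).
      apply: le_integral_vol => //; first exact: bmeas_cst.
      by move=> x /Th xc; exact: HC2.
    rewrite integral_vol_cst// ler_wpM2l//; exact: vol_le_cube bT (ltW dT) Th.
  have N0 : 0 <= C4 * K by rewrite mulr_ge0// ltW.
  apply: le_trans (bdb _ _ N0 (mpoly2 e) _) _.
    move=> x xc; apply: le_trans (HC1 T e c x (sg * h) bT eM s0 cT _) _.
      by rewrite mulrA mulVf ?gt_eqF// mul1r.
    apply: (@le_trans _ _ (C1 / (sg * h) ^+ m.+1 * (K * (2 * h) ^+ m.+1))).
      by rewrite ler_wpM2l// divr_ge0 ?exprn_ge0// ltW.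
    rewrite /C4 !exprMn le_eqVlt; apply/orP; left; apply/eqP.
    by field; rewrite !expf_neq0 ?gt_eqF.
  rewrite -mulrA KE mulrA [C4 * _]mulrA [C4 * _]mulrA ler_wpM2r// ler_wpM2r ?(ltW dT)//.
  rewrite -mulrA ler_wpM2r ?mulr_ge0 ?(ltW C20) ?(ltW C30)//.
  by rewrite lerDr.
Qed.

End TraceBounds.

(** * The jump estimate on one element *)

Section Coercivity.
Context {R : realType} {m : nat}.
Local Notation pt := 'rV[R]_m.+1.
Local Notation mp := (mpoly m.+1 R).
Context (T : set pt) (Fh : set (set pt)) (c : pt) (s C : R) (k l : nat).
Context (oT : open T) (bT : bset T) (s0 : 0 < s) (cT : cube c s `<=` T).
Context (fin : finite_set (faces_of Fh T)).
Context (disj : forall F F', faces_of Fh T F -> faces_of Fh T F' -> F != F' -> F `&` F' = set0).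
Context (flat : forall F, faces_of Fh T F -> flat_face F).
Context (bF : forall F, faces_of Fh T F -> bset (fpre F)).
Context (h0 : 0 < diam T) (C0 : 0 < C) (lk : (l <= k.+1)%N).
Local Notation energy0 p := (integral_vol T (fun y => dot (grad p y) (grad p y))).
Context (osc_bd : forall p : mp, deg_le k.+1 p ->
  integral_bd Fh T (fun x => (peval p x - peval p c) ^+ 2) <= C * diam T * energy0 p).
Context (trace_bd : forall p e : mp, deg_le k.+1 p -> deg_le k.+1 e ->
  integral_vol T (fun x => peval e x ^+ 2) <=
    integral_vol T (fun x => (peval p x - peval p c) ^+ 2) ->
  integral_bd Fh T (fun x => peval e x ^+ 2) <= C * diam T * energy0 p).
Context (K : 'M[R]_m.+1) (lo up : R).
Context (lo0 : 0 < lo) (loup : lo <= up) (Ks : symmetric_mx K) (Kell : elliptic lo up K).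
Context (v : @hho R m.+1) (vP : hho_space k l Fh T v).

(** The weight of the boundary products. Where [outer_normal] takes its default 0 it vanishes, and
    the bounds 0 and [up] hold there as well. *)
Let kappa (x : pt) := dot (mxact K (outer_normal T x)) (outer_normal T x).
Let p := reconstruction k K Fh T v.
Let dF := delta_faces k K Fh T v.
Let dT := delta_elt k l K Fh T v.
Let energy := norm_vec T (fun x => mxact (mxsqrt K) (grad p x)) ^+ 2.

Let up0 : 0 < up. Proof. exact: lt_le_trans lo0 loup. Qed.
Let Klo x : lo * dot x x <= dot (mxact K x) x. Proof. by have /andP[] := Kell x. Qed.

Lemma kappa_ge0 x : 0 <= kappa x.
Proof. by apply: le_trans (Klo _); rewrite mulr_ge0 ?dot_ge0// ltW. Qed.

Lemma kappa_le x : kappa x <= up.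
Proof.
have /andP[_ h] := Kell (outer_normal T x); apply: le_trans h _.
by rewrite ler_piMr ?outer_normal_le1// ltW.
Qed.

Lemma bdmeas_kappa : bdmeas T Fh kappa.
Proof.
move=> F FT; have [_ FbT] := FT.
apply: (fmeas_outer_normal (phi := fun a => dot (mxact K a) a) (M := up) oT FbT (flat FT) (bF FT)).
move=> a a1; have /andP[h1 h2] := Kell a; rewrite ger0_norm.
  by apply: le_trans h2 _; rewrite ler_piMr// ltW.
by apply: le_trans h1; rewrite mulr_ge0 ?dot_ge0// ltW.
Qed.

Let v2p : pwpoly T Fh v.2. Proof. exact: face_poly_pwpoly vP.2. Qed.

Let recP := reconstruction_spec oT bT s0 cT fin flat bF k Ks lo0 Klo v2p.
Let pk : deg_le k.+1 p := recP.1.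

Let dTP : deg_le l dT /\ forall w, deg_le l w ->
    ip_vol T (peval dT \- (peval p \- peval v.1)) (peval w) = 0.
Proof.
apply: (proj_elt_spec bT s0 cT l (q := p - v.1)) => x.
by rewrite pevalB.
Qed.

Let dFP : face_poly k Fh T dF /\ forall w, face_poly k Fh T w ->
    ip_bd Fh T (dF \- (peval p \- v.2)) w = 0.
Proof.
apply: (proj_faces_spec fin disj bF k).
by apply: pwpolyB => //; exact: pwpoly_peval.
Qed.

Let eF (x : pt) := dF x - (peval p x - v.2 x).
Let eT : mp := dT - (p - v.1).

Let dFp : pwpoly T Fh dF. Proof. exact: face_poly_pwpoly dFP.1. Qed.
Let eFp : pwpoly T Fh eF.
Proof. by apply: pwpolyB => //; apply: pwpolyB => //; exact: pwpoly_peval. Qed.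

Lemma face_error_bound : integral_bd Fh T (fun x => eF x ^+ 2) <= C * diam T * energy0 p.
Proof.
apply: le_trans (osc_bd pk).
(* Chosen so that [eF] plus this function is p(c) - p; it is admissible as a test function because
   v_F and the constants are in P^k(F_T). *)
have wp : face_poly k Fh T (fun x => peval p c - dF x - v.2 x).
  move=> F FT; have [q1 q1k q1E] := dFP.1 F FT; have [q2 q2k q2E] := vP.2 F FT.
  exists (mpolyC _ (peval p c) - q1 - q2).
    by apply: deg_leB => //; apply: deg_leB => //; exact: deg_leC.
  by move=> x Fx; rewrite !pevalB pevalC q1E// q2E.
have orth := dFP.2 _ wp.
have := best_approx_bd fin bF (pwpoly_bdmeas bF eFp)
  (pwpoly_bdmeas bF (face_poly_pwpoly wp)) orth.
move/le_trans; apply; rewrite le_eqVlt; apply/orP; left; apply/eqP.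
by apply: (eq_integral_bd fin) => F x _ _; rewrite /eF; ring.
Qed.

(** Here best approximation holds in L^2(T), and [trace_bd] carries it to the boundary; l <= k + 1
    gives [eT] the required degree. *)
Lemma elt_error_bound :
  integral_bd Fh T (fun x => peval eT x ^+ 2) <= C * diam T * energy0 p.
Proof.
have dTk : deg_le k.+1 dT by exact: deg_leS dTP.1.
have v1k : deg_le k.+1 v.1 by exact: deg_leS vP.1.
apply: trace_bd => //; first by apply: deg_leB => //; exact: deg_leB.
pose w : mp := mpolyC _ (peval p c) - dT - v.1.
have wl : deg_le l w.
  by apply: deg_leB vP.1; apply: deg_leB dTP.1; exact: deg_leC.
have orth : integral_vol T (fun x => peval eT x * peval w x) = 0.
  rewrite -[RHS](dTP.2 w wl); apply: eq_integral_vol => x _ /=.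
  by rewrite /eT !pevalB.
have := best_approx_vol bT (bmeas_peval eT bT) (bmeas_peval w bT) orth.
move/le_trans; apply; rewrite le_eqVlt; apply/orP; left; apply/eqP.
by apply: eq_integral_vol => x _; rewrite /eT /w !pevalB pevalC; ring.
Qed.

(** Testing the projection with 1 and using the mean value condition of the reconstruction shows
    that [dT] has mean zero. Hence subtracting dT(c) can only increase its L^2 norm, and [trace_bd]
    applies with p = e = [dT]. *)
Lemma delta_elt_bound :
  integral_bd Fh T (fun x => peval dT x ^+ 2) <= C * diam T * energy0 dT.
Proof.
have dTk : deg_le k.+1 dT by exact: deg_leS dTP.1.
apply: trace_bd => //.
have mp1 q : bmeas T (fun x => peval q x * 1) by apply: bmeasM; [exact: bmeas_peval|exact: bmeas_cst].
have rec0 : integral_vol T (fun x => peval (v.1 - p) x * 1) = 0.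
  by rewrite -[RHS]recP.2; apply: eq_integral_vol => x _ /=; rewrite pevalB.
have mean0 : integral_vol T (fun x => peval dT x * 1) = 0.
  have := dTP.2 (mpolyC _ 1) (deg_leC _ _); rewrite /ip_vol.
  rewrite (@eq_integral_vol _ _ _ _ (fun x => peval dT x * 1 + peval (v.1 - p) x * 1)).
    by rewrite (integral_volD bT (mp1 dT) (mp1 _)) rec0 addr0.
  by move=> x _ /=; rewrite pevalC pevalB; ring.
have orth : integral_vol T (fun x => peval dT x * (- peval dT c)) = 0.
  rewrite -[RHS](mulr0 (- peval dT c)) -mean0 -(integral_volZ _ bT (mp1 dT)).
  by apply: eq_integral_vol => x _; ring.
exact: (@best_approx_vol _ _ T bT (peval dT) (fun=> - peval dT c)
  (bmeas_peval dT bT) (bmeas_cst T _) orth).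
Qed.

Let D (x : pt) := dF x - peval dT x.
Let g (x : pt) := v.2 x - peval v.1 x.
Let wD := integral_bd Fh T (fun x => kappa x * D x ^+ 2).

Let E0 q : 0 <= energy0 q. Proof. by apply: integral_vol_ge0 => x _; exact: dot_ge0. Qed.

Let bdm f : pwpoly T Fh f -> bdmeas T Fh f. Proof. exact: pwpoly_bdmeas. Qed.

Let Dp : pwpoly T Fh D. Proof. by apply: pwpolyB => //; exact: pwpoly_peval. Qed.

(** The weight is replaced by [up] on the two projection errors only; on [D] it is kept, since
    [stab_bd] carries the same one. The 3 comes from splitting a square into three, the 6 from the
    two errors. *)
Lemma weighted_jump_bound : integral_bd Fh T (fun x => kappa x * g x ^+ 2) <=
  6 * up * C * diam T * energy0 p + 3 * wD.
Proof.
have meF := bdmeas_sqr (bdm eFp).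
have meT := bdmeas_sqr (bdm (pwpoly_peval (T := T) (Fh := Fh) eT)).
have mD := bdmeasM bdmeas_kappa (bdmeas_sqr (bdm Dp)).
have mg : bdmeas T Fh (fun x => kappa x * g x ^+ 2).
  by apply: bdmeasM bdmeas_kappa _; apply/bdmeas_sqr/bdm/pwpolyB => //; exact: pwpoly_peval.
apply: (@le_trans _ _ (integral_bd Fh T (fun x =>
    3 * up * (eF x ^+ 2 + peval eT x ^+ 2) + 3 * (kappa x * D x ^+ 2)))).
  apply: (le_integral_bd fin bF mg).
    exact: bdmeasD (bdmeasZ _ (bdmeasD meF meT)) (bdmeasZ _ mD).
  move=> F x _ _.
  have -> : g x = eF x - peval eT x - D x.
    by rewrite /g /eF /eT /D !pevalB; ring.
  have := kappa_ge0 x; have := kappa_le x.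
  move: (kappa x) (eF x) (peval eT x) (D x) => a e1 e2 e3 au a0.
  apply: (@le_trans _ _ (a * (3 * (e1 ^+ 2 + e2 ^+ 2 + e3 ^+ 2)))).
    rewrite ler_wpM2l//.
    (* 3 (e1^2 + e2^2 + e3^2) - (e1 - e2 - e3)^2 is the sum of these three squares. *)
    have := sqr_ge0 (e1 + e2); have := sqr_ge0 (e1 + e3); have := sqr_ge0 (e2 - e3).
    by rewrite !expr2; nra.
  have : a * (e1 ^+ 2 + e2 ^+ 2) <= up * (e1 ^+ 2 + e2 ^+ 2).
    by rewrite ler_wpM2r// addr_ge0 ?sqr_ge0.
  lra.
rewrite (integral_bdD fin bF (bdmeasZ _ (bdmeasD meF meT)) (bdmeasZ _ mD)).
rewrite (integral_bdZ fin bF _ (bdmeasD meF meT)) (integral_bdZ fin bF _ mD).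
rewrite (integral_bdD fin bF meF meT) -/wD lerD2r.
apply: (@le_trans _ _ (3 * up * (C * diam T * energy0 p + C * diam T * energy0 p))).
  rewrite ler_wpM2l ?mulr_ge0 ?(ltW up0)//.
  by apply: lerD; [exact: face_error_bound|exact: elt_error_bound].
by rewrite le_eqVlt; apply/orP; left; apply/eqP; ring.
Qed.

Lemma hho_seminormE :
  hho_seminorm K Fh T v ^+ 2 = (diam T)^-1 * integral_bd Fh T (fun x => kappa x * g x ^+ 2).
Proof.
have E : ip_K_bd K Fh T (v.2 \- peval v.1) (v.2 \- peval v.1) =
    integral_bd Fh T (fun x => kappa x * g x ^+ 2).
  by apply: (eq_integral_bd fin) => F x _ _ /=; rewrite -mulrA -expr2.
rewrite /hho_seminorm exprMn exprVn sqr_sqrtr ?(ltW h0)// /norm_K_bd E sqr_sqrtr//.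
by apply: (integral_bd_ge0 fin) => x; rewrite mulr_ge0 ?kappa_ge0 ?sqr_ge0.
Qed.

Lemma stab_bdE : stab_bd k l K Fh T v v = (diam T)^-1 * wD.
Proof.
rewrite /stab_bd; congr (_ * _).
by apply: (eq_integral_bd fin) => F x _ _ /=; rewrite -mulrA -expr2.
Qed.

Lemma energy_ge : lo * energy0 p <= energy.
Proof.
have -> : energy = integral_vol T (fun x => dot (mxact K (grad p x)) (grad p x)).
  rewrite /energy /norm_vec sqr_sqrtr.
    by apply: eq_integral_vol => x _; rewrite (mxsqrt_dot (grad p x) lo0 Ks Klo).
  by apply: integral_vol_ge0 => x _; exact: dot_ge0.
rewrite -(integral_volZ lo bT (bmeas_grad_sqr p bT)).
apply: le_integral_vol => //; [exact: bmeasZ (bmeas_grad_sqr p bT)|exact: bmeas_grad_form].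
Qed.

(** Makes the second estimate a consequence of the first. The trace of [dT] is traded for its
    gradient, and the weight for [up], a factor that [stab_grad_max] already contains; hence no
    power of alpha is lost. *)
Lemma stab_bd_le : stab_bd k l K Fh T v v <= (2 + 2 * C) * stab_grad_max k l K up Fh T v v.
Proof.
have mF := bdmeas_sqr (bdm dFp).
have mT := bdmeas_sqr (bdm (pwpoly_peval (T := T) (Fh := Fh) dT)).
have mD := bdmeasM bdmeas_kappa (bdmeas_sqr (bdm Dp)).
set BF := integral_bd Fh T (fun x => dF x ^+ 2).
have BF0 : 0 <= BF by apply: (integral_bd_ge0 fin) => x; exact: sqr_ge0.
have wDle : wD <= 2 * up * (BF + C * diam T * energy0 dT).
  apply: (@le_trans _ _ (integral_bd Fh T (fun x => 2 * up * (dF x ^+ 2 + peval dT x ^+ 2)))).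
    apply: (le_integral_bd fin bF mD); first exact: bdmeasZ (bdmeasD mF mT).
    move=> F x _ _; have := kappa_ge0 x; have := kappa_le x; rewrite /D.
    move: (kappa x) (dF x) (peval dT x) => a e1 e2 au a0.
    apply: (@le_trans _ _ (up * (e1 - e2) ^+ 2)); first by rewrite ler_wpM2r ?sqr_ge0.
    rewrite mulrAC mulrC ler_wpM2r ?(ltW up0)//.
    by have := sqr_ge0 (e1 + e2); rewrite !expr2; nra.
  rewrite (integral_bdZ fin bF _ (bdmeasD mF mT)) (integral_bdD fin bF mF mT).
  by rewrite ler_wpM2l ?mulr_ge0 ?(ltW up0)// lerD2l; exact: delta_elt_bound.
have -> : stab_grad_max k l K up Fh T v v = up * (energy0 dT + (diam T)^-1 * BF).
  by [].
rewrite stab_bdE.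
apply: (@le_trans _ _ ((diam T)^-1 * (2 * up * (BF + C * diam T * energy0 dT)))).
  by rewrite ler_wpM2l ?invr_ge0 ?(ltW h0).
have hE := E0 dT; have hi0 : 0 <= (diam T)^-1 by rewrite invr_ge0 ltW.
have -> : (diam T)^-1 * (2 * up * (BF + C * diam T * energy0 dT)) =
    2 * up * ((diam T)^-1 * BF + C * energy0 dT).
  by field; rewrite gt_eqF.
move: (energy0 dT) hE => E hE.
have X0 : 0 <= (diam T)^-1 * BF by exact: mulr_ge0.
move: ((diam T)^-1 * BF) X0 => X X0.
have := mulr_ge0 (ltW up0) hE; have := mulr_ge0 (ltW C0) (mulr_ge0 (ltW up0) X0).
nra.
Qed.

Lemma coercivity_bd : hho_seminorm K Fh T v ^+ 2 <=
  6 * C * (up / lo) * energy + 3 * stab_bd k l K Fh T v v.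
Proof.
rewrite hho_seminormE stab_bdE.
apply: (@le_trans _ _ ((diam T)^-1 * (6 * up * C * diam T * energy0 p + 3 * wD))).
  by rewrite ler_wpM2l ?invr_ge0 ?(ltW h0)//; exact: weighted_jump_bound.
rewrite mulrDr [_ * (3 * wD)]mulrCA lerD2r.
(* The factor alpha appears here: [up] from the weight, 1 / [lo] from [energy_ge]. *)
have -> : (diam T)^-1 * (6 * up * C * diam T * energy0 p) =
  6 * C * (up / lo) * (lo * energy0 p).
  by field; rewrite !gt_eqF.
by rewrite ler_wpM2l ?energy_ge// !mulr_ge0 ?invr_ge0 ?(ltW C0) ?(ltW up0) ?(ltW lo0).
Qed.

Lemma coercivity :
  hho_seminorm K Fh T v ^+ 2 <=
    (6 * C + 6) * (up / lo) * (energy + stab_bd k l K Fh T v v) /\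
  hho_seminorm K Fh T v ^+ 2 <=
    (6 * C + 6) * (up / lo) * (energy + stab_grad_max k l K up Fh T v v).
Proof.
have al : 1 <= up / lo by rewrite ler_pdivlMr// mul1r.
have en0 : 0 <= energy by exact: sqr_ge0.
have sb0 : 0 <= stab_bd k l K Fh T v v.
  rewrite stab_bdE mulr_ge0 ?invr_ge0 ?(ltW h0)//.
  by apply: (integral_bd_ge0 fin) => x; rewrite mulr_ge0 ?kappa_ge0 ?sqr_ge0.
have sg0 : 0 <= stab_grad_max k l K up Fh T v v.
  rewrite mulr_ge0 ?(ltW up0)// addr_ge0 ?E0// mulr_ge0 ?invr_ge0 ?(ltW h0)//.
  by apply: (integral_bd_ge0 fin) => x; rewrite -expr2 sqr_ge0.
have H1 := coercivity_bd; have H2 := stab_bd_le.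
set A := up / lo in al H1 *.
(* [t] is the factor in front of the stabilization: 3 in the boundary case, 3 (2 + 2 C) = 6 C + 6 in
   the gradient case, which fixes the constant. Since alpha >= 1, it can be factored out of both
   terms. *)
have key (t S : R) : 0 <= S -> 0 <= t <= 6 * C + 6 ->
    6 * C * A * energy + t * S <= (6 * C + 6) * A * (energy + S).
  move=> S0 /andP[t0 t1]; rewrite mulrDr lerD//.
    by rewrite ler_wpM2r// ler_wpM2r; lra.
  rewrite ler_wpM2r// (le_trans t1)// ler_peMr//; have := ltW C0; lra.
have c0 := ltW C0.
split; apply: le_trans H1 _; first by apply: key => //; lra.
apply: le_trans (key (6 * C + 6) _ sg0 _); last by lra.
by rewrite lerD2l; lra.
Qed.

End Coercivity.

(** * Polytopes, and the estimate on a mesh *)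

Section Polytopes.
Context {R : realType} {n : nat}.
Implicit Types (X : set 'rV[R]_n).

Lemma closed_simplex_bounded (V : 'I_n.+1 -> 'rV[R]_n) x :
  closed_simplex V x -> `|x| <= \sum_i `|V i|.
Proof.
move=> [a [a0 a1 ->]]; apply: le_trans (ler_norm_sum _ _ _) _.
apply: ler_sum => i _; rewrite normrZ (ger0_norm (a0 i)) ler_piMl//.
by rewrite -a1 (bigD1 i)//= lerDl sumr_ge0.
Qed.

Lemma open_polytope_bounded X : open_polytope X -> bounded_rV X.
Proof.
move=> [_ [N [V [_ ->]]]]; exists (\sum_i \sum_j `|V i j|) => x /interior_subset[i _].
move=> /closed_simplex_bounded xV; apply: le_trans xV _.
by rewrite [leRHS](bigD1 i)//= lerDl sumr_ge0// => j _; rewrite sumr_ge0.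
Qed.

Lemma open_polytope_open X : open_polytope X -> open X.
Proof. by move=> [_ [N [V [_ ->]]]]; exact: open_interior. Qed.

Lemma boundary_bounded X : bounded_rV X -> bounded_rV (boundary X).
Proof.
move=> bX; have [[c Xc]|X0] := pselect (X !=set0).
  exists (`|c| + diam X) => x [cx _].
  rewrite -[x](subrK c) addrC; apply: le_trans (ler_normD _ _) _.
  by rewrite lerD2l; exact: closure_diam.
exists 0 => x [cx _]; have [y [Xy _]] := cx setT (filterT).
by case: X0; exists y.
Qed.

End Polytopes.

Unset Implicit Arguments.

Theorem corollary15 (R : realType) (d k l : nat) (Omega : set 'rV[R]_d)
    (rho : R) :
  (2 <= d)%N -> (k <= l.+1)%N -> (l <= k.+1)%N ->
  open_polytope Omega -> connected Omega -> 0 < rho ->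
  exists2 C : R, 0 < C &
    forall (H : set R) (Th Fh : R -> set (set 'rV[R]_d))
        (K : 'rV[R]_d -> 'M[R]_d),
      mesh_sizes H ->
      (forall h, H h -> polytopal_mesh Omega h (Th h) (Fh h)) ->
      (forall h, H h -> regular_mesh rho (Th h) (Fh h)) ->
      diffusion_field Omega K ->
      (forall h T, H h -> Th h T -> exists KT, constant_on T K KT) ->
    forall (h : R) (T : set 'rV[R]_d) (KT : 'M[R]_d) (lo up : R) (v : @hho R d),
      H h -> Th h T ->
      constant_on T K KT -> 0 < lo -> lo <= up -> elliptic lo up KT ->
      hho_space k l (Fh h) T v ->
      let energy :=
        norm_vec T (fun x =>
          mxact (mxsqrt KT) (grad (reconstruction k KT (Fh h) T v) x)) ^+ 2 in
      let alpha := up / lo in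
      hho_seminorm KT (Fh h) T v ^+ 2
        <= C * alpha * (energy + stab_bd k l KT (Fh h) T v v) /\
      hho_seminorm KT (Fh h) T v ^+ 2
        <= C * alpha * (energy + stab_grad_max k l KT up (Fh h) T v v).
Proof.
(* With d = m + 1, the dimension d - 1 of the charts computes to m. *)
case: d Omega => [//|m] Omega _ _ lk _ _ rho0.
have [C C0 HC] := @trace_bounds R m k.+1 rho rho0.
exists (6 * C + 6); first by rewrite addr_gt0// mulr_gt0.
move=> H Th Fh K _ mesh reg [Ksym _] _ h T KT lo up v Hh ThT KTP lo0 loup Kell vP energy alpha.
have [mT1 mT2 mT3 mT4 mF1 mF2 mF3 mF4 mF5 _ _] := mesh h Hh.
have pT := mT3 T ThT; have oT := open_polytope_open pT.
have bT := open_polytope_bounded pT; have [T0 _] := pT.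
have fin : finite_set (faces_of (Fh h) T).
  by apply: sub_finite_set mF1 => F [].
have disj F F' : faces_of (Fh h) T F -> faces_of (Fh h) T F' -> F != F' -> F `&` F' = set0.
  move=> [FF _] [FF' _] ne; apply/eqP; apply: contraT => /set0P FF0.
  by rewrite (mF2 F F' FF FF' FF0) eqxx in ne.
have flat F : faces_of (Fh h) T F -> flat_face F by move=> [/mF3].
have bF F : faces_of (Fh h) T F -> bset (fpre F).
  move=> FT; apply: bset_face (flat F FT) _.
  by apply: bounded_rVS (boundary_bounded bT); case: FT.
have [dT [c [s [s0 cT osc tr]]]] :=
  HC T (Fh h) oT T0 bT ((reg h Hh).1 T ThT) fin disj flat.
(* Symmetry is given at points of [Omega], so one of them is sought in [T]: a point of the open set
   [T] is in the closure of [Omega], hence [T] meets [Omega]. *)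
have Ks : symmetric_mx KT.
  have [x Tx] := T0.
  have clx : closure Omega x by rewrite mT4; exists T => //; exact: subset_closure.
  have [y [Oy Ty]] := clx T (open_nbhs_nbhs (conj oT Tx)).
  by rewrite -(KTP y Ty); exact: Ksym.
apply: (coercivity oT (conj (open_rV_measurable oT) bT) s0 cT fin disj flat bF dT C0 lk osc tr
  lo0 loup Ks Kell vP).
Qed.
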